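(* Let $M$ be $\mathbb{R}^3$ or $S^3$ with a fixed Riemannian metric and $K$ a knot type in $M$. For every ring $R$ and every $j\ge0$, the inclusions of sublevels induce an isomorphism $$\operatorname*{colim}_{\Lambda}H_j\bigl(\mathcal{E}_{K,\Lambda}(M);R\bigr)\cong H_j\bigl(\mathcal{E}_K(M);R\bigr).$$
   Context: $\operatorname{Emb}^\infty(S^1,M)$ is the space of smooth embeddings with the $C^\infty$ topology; $\mathcal{E}_K(M)$ is its path component consisting of embeddings of (oriented) knot type $K$. For an embedded closed curve $\gamma$ in $M$, $\operatorname{Len}(\gamma)$ is its length and its thickness $\operatorname{Thi}(\gamma)$ is the normal injectivity radius: the supremum of the radii for which the normal exponential map of $\gamma$ is an embedding. The ropelength is $\operatorname{Rop}(\gamma)=\operatorname{Len}(\gamma)/\operatorname{Thi}(\gamma)$, and $\mathcal{E}_{K,\Lambda}(M)=\{\gamma\in\mathcal{E}_K(M):\operatorname{Rop}(\gamma)\le\Lambda\}$, a family of subspaces increasing in $\Lambda$. $H_j$ is singular homology; the colimit is over $\Lambda\to\infty$ along the maps induced by inclusions. *)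

(* Defs.v *)
From HB Require Import structures.
From mathcomp Require Import all_boot all_order all_algebra.
From mathcomp Require Import finmap.
From mathcomp Require Import all_classical all_reals all_analysis.
Import Order.TTheory GRing.Theory Num.Theory.
Import numFieldNormedType.Exports.

Set Implicit Arguments.
Unset Strict Implicit.
Unset Printing Implicit Defensive.

Local Open Scope classical_set_scope.
Local Open Scope ring_scope.

Section FreeModule.
Variables (A : pzRingType) (T : choiceType).

Definition finsupp : {pred (T -> A^o)} :=
  fun c => `[< finite_set [set t | c t != 0] >].

Lemma finsupp_closed : subsemimod_closed finsupp.
Proof.
split; first split.
- apply/asboolP; rewrite (_ : [set _ | _] = set0) //.
  by rewrite -subset0 => t /=; rewrite eqxx.
- move=> c d /asboolP fc /asboolP fd; apply/asboolP.
  apply: (@sub_finite_set _ _ ([set t | c t != 0] `|` [set t | d t != 0])).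
    move=> t /= cdt; have [c0|c0] := eqVneq (c t) 0; last by left.
    by right; apply: contra_neq cdt => d0; rewrite /GRing.add /= c0 d0 addr0.
  by rewrite finite_setU.
- move=> a c /asboolP fc; apply/asboolP; apply: sub_finite_set fc => t /=.
  by apply: contra_neq => c0; rewrite /GRing.scale /= c0 scaler0.
Qed.

HB.instance Definition _ :=
  GRing.isSubmodClosed.Build A (T -> A^o) finsupp finsupp_closed.

(* The free left A-module on T: finitely supported functions T -> A. *)
Record freemod := FreeMod { fcoef :> T -> A^o ; _ : fcoef \in finsupp }.

HB.instance Definition _ := [isSub for fcoef].
HB.instance Definition _ := [Choice of freemod by <:].
HB.instance Definition _ := [SubChoice_isSubLmodule of freemod by <:].

Lemma finite_fcoef (c : freemod) : finite_set [set t | c t != 0].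
Proof. by case: c => c /= /asboolP. Qed.

Lemma fcoef_sum (s : seq T) (b : T -> A) (h : T -> freemod) u :
  (\sum_(t <- s) b t *: h t) u = \sum_(t <- s) b t * (h t u : A).
Proof.
elim: s => [|t s IHs]; first by rewrite !big_nil.
by rewrite !big_cons -IHs.
Qed.

Lemma notin_supp (c : freemod) t :
  t \notin fset_set [set t | c t != 0] -> c t = 0.
Proof.
apply: contraNeq => ct; rewrite in_fset_set; last exact: finite_fcoef.
by rewrite inE.
Qed.

Lemma fgen_subproof (t : T) : (fun u => (u == t)%:R) \in finsupp.
Proof.
apply/asboolP; apply: (@sub_finite_set _ _ [set t]); last exact: finite_set1.
by move=> u /=; have [->|] := eqVneq u t; rewrite ?eqxx.
Qed.
Definition fgen (t : T) : freemod := FreeMod (fgen_subproof t).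

Variable V : lmodType A.
(* The linear extension of f : T -> V; the sum runs over the support of c. *)
Definition linext (f : T -> V) (c : freemod) : V :=
  \sum_(t \in [set: T]) (c t : A) *: f t.

Lemma linextE (f : T -> V) (c : freemod) (D : {fset T}) :
  (forall t, t \notin D -> c t = 0) -> linext f c = \sum_(t <- D) (c t : A) *: f t.
Proof. by move=> cD; apply: fsbigTE => t /cD ->; rewrite scale0r. Qed.

Lemma linext_is_linear f : linear (linext f).
Proof.
move=> a c d.
pose D := (fset_set [set t | c t != 0] `|` fset_set [set t | d t != 0])%fset.
have cD t : t \notin D -> c t = 0.
  by rewrite in_fsetU negb_or => /andP[/notin_supp].
have dD t : t \notin D -> d t = 0.
  by rewrite in_fsetU negb_or => /andP[_ /notin_supp].
rewrite (linextE f cD) (linextE f dD) (@linextE _ _ D); last first.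
  move=> t tD; change (a * (c t : A) + (d t : A) = 0).
  by rewrite cD // dD // mulr0 addr0.
rewrite scaler_sumr -big_split /=; apply: eq_bigr => t _.
by rewrite -[LHS]/((a * (c t : A) + (d t : A)) *: f t) scalerDl scalerA.
Qed.
HB.instance Definition _ f :=
  GRing.isLinear.Build A freemod V *:%R (linext f) (linext_is_linear f).

Lemma linext_gen f t : linext f (fgen t) = f t.
Proof.
rewrite (@linextE _ _ [fset t]%fset) ?big_seq_fset1 /= ?eqxx ?scale1r //.
by move=> u; rewrite in_fset1 /= => /negbTE ->.
Qed.

Lemma linext_eq (g : {linear freemod -> V}) : g =1 linext (g \o fgen).
Proof.
move=> c; pose D := fset_set [set t | c t != 0].
have cD t : t \notin D -> c t = 0 by exact: notin_supp.
have cE : c = \sum_(t <- D) (c t : A) *: fgen t.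
  apply: val_inj; apply/funext => u; rewrite /= fcoef_sum /=.
  have [uD|uD] := boolP (u \in D); last first.
    rewrite cD // big_seq big1 // => t tD.
    by have [ut|_] := eqVneq u t; [rewrite ut tD in uD | rewrite mulr0].
  rewrite (big_fsetD1 u) //= eqxx mulr1 big_seq big1 ?addr0 // => t.
  by rewrite in_fsetD1 eq_sym => /andP[/negbTE -> _]; rewrite mulr0.
rewrite {1}cE.
by rewrite linear_sum (linextE _ cD); apply: eq_bigr => t _; rewrite linearZ.
Qed.

End FreeModule.
Arguments fgen {A T} t.
Arguments linext {A T V} f c.

Lemma eq_lin_freemod (A : pzRingType) (T : choiceType) (V : lmodType A)
    (g h : {linear freemod A T -> V}) :
  (forall t, g (fgen t) = h (fgen t)) -> g =1 h.
Proof.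
move=> gh c; rewrite (linext_eq g) (linext_eq h); congr linext; apply/funext => t; exact: gh.
Qed.

Section QuotientModule.
Variables (A : pzRingType) (V : lmodType A) (G : set V).

Definition span : {pred V} := fun v => `[< forall S : set V,
  S 0 -> (forall a u w, S u -> S w -> S (a *: u + w)) -> G `<=` S -> S v >].

Lemma span_closed : subsemimod_closed span.
Proof.
split; first split.
- by apply/asboolP => S S0.
- move=> u v /asboolP su /asboolP sv; apply/asboolP => S S0 SD GS.
  by rewrite -[u]scale1r; apply: (SD); [exact: (su S S0 SD GS) | exact: (sv S S0 SD GS)].
- move=> a u /asboolP su; apply/asboolP => S S0 SD GS.
  by rewrite -[_ *: _]addr0; apply: (SD) => //; exact: (su S S0 SD GS).
Qed.
HB.instance Definition _ := GRing.isSubmodClosed.Build A V span span_closed.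

(* The quotient of V by the submodule generated by G. *)
Definition modspan : Type := Quotient.quot span.
HB.instance Definition _ := GRing.Zmodule.on modspan.

Definition mod_pi (v : V) : modspan := (\pi_(Quotient.quot span) v)%qT.
Definition mod_repr (q : modspan) : V := repr (q : Quotient.quot span).

Lemma mod_reprK : cancel mod_repr mod_pi.
Proof. by move=> q; rewrite /mod_pi /mod_repr reprK. Qed.

Lemma mod_piD u v : mod_pi (u + v) = mod_pi u + mod_pi v.
Proof. by rewrite /mod_pi Quotient.pi_add. Qed.

Lemma mod_piP u v : mod_pi u = mod_pi v <-> u - v \in span.
Proof. by rewrite Quotient.idealrBE; split=> [/eqP //|/eqP]. Qed.

Let scaleq (a : A) (q : modspan) : modspan := mod_pi (a *: mod_repr q).

Let pi_scaleq a v : scaleq a (mod_pi v) = mod_pi (a *: v).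
Proof.
by apply/mod_piP; rewrite -scalerBr rpredZ //; apply/mod_piP; rewrite mod_reprK.
Qed.

Let scaleqA a b q : scaleq a (scaleq b q) = scaleq (a * b) q.
Proof. by rewrite -[q]mod_reprK !pi_scaleq scalerA. Qed.

Let scale1q : left_id 1 scaleq.
Proof. by move=> q; rewrite -[q]mod_reprK pi_scaleq scale1r. Qed.

Let scaleqDr : right_distributive scaleq +%R.
Proof.
move=> a p q; rewrite -[p]mod_reprK -[q]mod_reprK -mod_piD !pi_scaleq.
by rewrite scalerDr mod_piD.
Qed.

Let scaleqDl q : {morph scaleq^~ q : a b / a + b}.
Proof.
by move=> a b; rewrite -[q]mod_reprK !pi_scaleq scalerDl mod_piD.
Qed.

HB.instance Definition _ := GRing.Zmodule_isLmodule.Build A modspan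
  scaleqA scale1q scaleqDr scaleqDl.

Lemma mod_pi_is_linear : linear mod_pi.
Proof. by move=> a u v; rewrite mod_piD -pi_scaleq. Qed.
HB.instance Definition _ :=
  GRing.isLinear.Build A V modspan *:%R mod_pi mod_pi_is_linear.

End QuotientModule.

Section Kernel.
Variables (A : pzRingType) (U V : lmodType A) (f : {linear U -> V}).

Definition ker_pred : {pred U} := fun u => f u == 0.
Lemma ker_closed : subsemimod_closed ker_pred.
Proof.
split; first split.
- by apply/eqP; exact: linear0.
- by move=> u v /eqP fu /eqP fv; apply/eqP; rewrite linearD fu fv addr0.
- by move=> a u /eqP fu; apply/eqP; rewrite linearZ /= fu scaler0.
Qed.
HB.instance Definition _ := GRing.isSubmodClosed.Build A U ker_pred ker_closed.

Record kernel := Kernel { kernel_val : U ; _ : kernel_val \in ker_pred }.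
HB.instance Definition _ := [isSub for kernel_val].
HB.instance Definition _ := [Choice of kernel by <:].
HB.instance Definition _ := [SubChoice_isSubLmodule of kernel by <:].

Lemma kernel_valK (z : kernel) : f (kernel_val z) = 0.
Proof. by case: z => z /= /eqP. Qed.
End Kernel.

Definition simplex (R : realType) (n : nat) : set 'rV[R]_n.+1 :=
  [set x | (forall i, 0 <= x 0 i) /\ \sum_i x 0 i = 1].
Arguments simplex R n : clear implicits.

Section Simplex.
Variable R : realType.

Definition face_vec n (i : 'I_n.+2) (x : 'rV[R]_n.+1) : 'rV[R]_n.+2 :=
  \row_k (if unlift i k is Some l then x 0 l else 0).

Lemma face_vec_simplex n (i : 'I_n.+2) x :
  simplex R n x -> simplex R n.+1 (face_vec i x).
Proof.
move=> [x0 x1]; split=> [k|].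
  by rewrite mxE; case: unliftP.
rewrite (bigD1_ord i) //= mxE unlift_none add0r -[RHS]x1.
by apply: eq_bigr => k _; rewrite mxE liftK.
Qed.

Lemma face_vec_continuous n (i : 'I_n.+2) : continuous (face_vec i).
Proof.
move=> x s /= /nbhs_ballP [e e0 es]; apply/nbhs_ballP; exists e => //= y [_ xy].
apply: es; split=> // j k; rewrite !mxE; case: unlift => [l|]; first exact: xy.
exact: ballxx.
Qed.

Definition face n (i : 'I_n.+2) (x : simplex R n) : simplex R n.+1 :=
  SigSub (mem_set (face_vec_simplex i (set_valP x))).

Lemma face_continuous n (i : 'I_n.+2) : continuous (@face n i).
Proof.
apply: (@continuous_comp_initial _ _ _ set_val) => x.
apply: (@continuous_comp _ _ _ set_val (face_vec i)).
  exact: initial_continuous.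
exact: face_vec_continuous.
Qed.
HB.instance Definition _ n (i : 'I_n.+2) :=
  @isContinuous.Build (simplex R n) (simplex R n.+1) (@face n i)
    (@face_continuous n i).
End Simplex.

Section Homology.
Variables (R : realType) (A : pzRingType).

Definition sing (X : topologicalType) n := continuousType (simplex R n) X.
Definition chain (X : topologicalType) n := freemod A (sing X n).

(* In degree 0 the boundary is the zero map, so that every 0-chain is a cycle. *)
Definition bnd_sing (X : topologicalType) n : sing X n -> chain X n.-1 :=
  match n with
  | 0 => fun=> 0
  | m.+1 => fun s =>
      \sum_(i < m.+2) (-1) ^+ i *: fgen ((s \o @face R m i) : sing X m)
  end.

Definition bnd (X : topologicalType) n : chain X n -> chain X n.-1 :=
  linext (@bnd_sing X n).
HB.instance Definition _ X n := GRing.Linear.on (@bnd X n).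

(* H_n(X; A): cycles modulo boundaries. *)
Definition homology n (X : topologicalType) : lmodType A :=
  modspan [set z : kernel (@bnd X n) | exists c, kernel_val z = @bnd X n.+1 c].

Section Functoriality.
Variables (X Y : topologicalType) (f : continuousType X Y).

Definition push n : chain X n -> chain Y n :=
  linext (fun s : sing X n => fgen ((f \o s) : sing Y n)).
HB.instance Definition _ n := GRing.Linear.on (@push n).

Lemma push_bnd n (c : chain X n) : bnd (push c) = push (bnd c).
Proof.
apply: (@eq_lin_freemod _ _ _ (@bnd Y n \o @push n) (@push n.-1 \o @bnd X n)) => s.
rewrite /= /push /bnd !linext_gen; case: n c s => [|n] _ s /=.
  by rewrite linear0.
rewrite linear_sum; apply: eq_bigr => i _; rewrite linearZ /= linext_gen.
by congr (_ *: fgen _); apply/continuousEP.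
Qed.

Lemma push_cycle n (z : kernel (@bnd X n)) :
  push (kernel_val z) \in ker_pred (@bnd Y n).
Proof.
apply/eqP; apply: (etrans (push_bnd (kernel_val z))).
by rewrite (kernel_valK z : bnd _ = 0) linear0.
Qed.

Definition hmap n (q : homology n X) : homology n Y :=
  mod_pi _ (Kernel (push_cycle (mod_repr q))).

(* The class of push z depends only on the class of z. *)
Lemma hmapE n (z : kernel (@bnd X n)) :
  hmap (mod_pi _ z) = mod_pi _ (Kernel (push_cycle z)).
Proof.
apply/mod_piP.
have /mod_piP /asboolP := mod_reprK (mod_pi _ z : homology n X).
set y := mod_repr _ => /(_ [set v | exists c, kernel_val v = @bnd X n.+1 c]) [].
- by exists 0; rewrite linear0.
- move=> a u w [c uc] [d wd]; exists (a *: c + d).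
  apply: (etrans (y := a *: kernel_val u + kernel_val w)) => //.
  rewrite uc wd.
  exact: esym (linearP (@bnd X n.+1) a c d).
- by [].
move=> c ydz; apply/asboolP => S _ _; apply.
exists (push c); rewrite push_bnd -ydz.
exact: esym (linearB (@push n) _ _).
Qed.

Lemma hmap_is_linear n : linear (@hmap n).
Proof.
move=> a p q; rewrite -[p]mod_reprK -[q]mod_reprK -linearP !hmapE -linearP.
by congr mod_pi; apply: val_inj; rewrite /= linearP.
Qed.
HB.instance Definition _ n := GRing.isLinear.Build A (homology n X)
  (homology n Y) *:%R (@hmap n) (@hmap_is_linear n).

End Functoriality.

End Homology.

Section Colimit.
Variables (A : pzRingType) (d : Order.disp_t) (I : porderType d).
Variables (M : I -> lmodType A) (f : forall i j, (i <= j)%O -> M i -> M j).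

Definition colim_gen (i : I) (x : M i) : freemod A {i : I & M i} :=
  fgen (Tagged (fun i => M i : Type) x).

Definition colim_rel : set (freemod A {i : I & M i}) :=
  [set v | (exists i (a : A) (x y : M i),
              v = colim_gen (a *: x + y) - (a *: colim_gen x + colim_gen y)) \/
           (exists i j (ij : (i <= j)%O) (x : M i),
              v = colim_gen x - colim_gen (f ij x))].

(* The colimit of the diagram (M, f), by generators (all elements of all M i)
   and relations (linearity in each M i, and x ~ f x). *)
Definition colim : lmodType A := modspan colim_rel.

Definition colim_in (i : I) (x : M i) : colim := mod_pi _ (colim_gen x).

Lemma colim_in_is_linear i : linear (@colim_in i).
Proof.
move=> a x y; rewrite /colim_in -linearP; apply/mod_piP/asboolP => S _ _; apply.
by left; exists i, a, x, y.
Qed.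
HB.instance Definition _ i :=
  GRing.isLinear.Build A (M i) colim *:%R (@colim_in i) (@colim_in_is_linear i).

Lemma colim_inE i j (ij : (i <= j)%O) (x : M i) :
  colim_in (f ij x) = colim_in x.
Proof.
apply/esym/mod_piP/asboolP => S _ _; apply.
by right; exists i, j, ij, x.
Qed.
End Colimit.

Section SubsetInclusion.
Context {X : topologicalType} (B C : set X) (BC : B `<=` C).

Definition subset_incl (x : B) : C := SigSub (mem_set (BC (set_valP x))).

Lemma subset_incl_continuous : continuous subset_incl.
Proof.
apply: (@continuous_comp_initial _ _ _ set_val).
exact: initial_continuous.
Qed.
HB.instance Definition _ := @isContinuous.Build (set_type B) (set_type C)
  subset_incl subset_incl_continuous.
End SubsetInclusion.

Section Smooth.
Variable R : realType.
Implicit Types V W : normedModType R.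

(* C^k on an open set U, through iterated directional derivatives; this is the
   usual notion when V is finite-dimensional, the only case used below. *)
Fixpoint Ck V W (k : nat) (U : set V) (f : V -> W) : Prop :=
  (forall x, U x -> {for x, continuous f}) /\
  if k is l.+1 then
    forall v, (forall x, U x -> derivable f x v) /\ Ck l U (fun x => 'D_v f x)
  else True.

Definition smooth_on V W (U : set V) (f : V -> W) := forall k, Ck k U f.

(* Smoothness on an arbitrary subset X: local extension to open sets. *)
Definition smooth V W (X : set V) (f : V -> W) :=
  forall x, X x -> exists (U : set V) (F : V -> W),
    [/\ open U, U x, smooth_on U F & {in U `&` X, f =1 F}].

(* Here X is a submanifold of V invariant under translation by e, and f is
   viewed as a map on the quotient X / Ze.  It is a smooth embedding when it is
   smooth, well defined and injective on X / Ze, immersive (tangent vectors of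
   X are velocities of smooth curves in X) and open onto its image (the open
   sets of X / Ze are the traces on X of the e-invariant open sets of V). *)
Definition embedding V W (e : V) (X : set V) (f : V -> W) :=
  [/\ smooth X f /\ (forall x, X x -> f (x + e) = f x),
      forall x y, X x -> X y -> f x = f y -> exists k : int, y = x + e *~ k,
      forall c : R^o -> V, smooth_on setT c -> (forall t, X (c t)) ->
        derive1 c 0 != 0 -> derive1 (f \o c) 0 != 0
    & forall U : set V, open U -> (forall x, U x <-> U (x + e)) ->
        exists2 O, open O & f @` (X `&` U) = f @` X `&` O].

End Smooth.

(* M is R^3, or S^3 realized as the unit sphere of R^4. *)
Inductive ambient := Euclidean3 | Sphere3.

Definition ambient_dim (m : ambient) : nat := if m is Sphere3 then 4 else 3.

Section Knots.
Variables (R : realType) (m : ambient).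

Definition coords := 'rV[R]_(ambient_dim m).

Definition dotp (u v : coords) : R := \sum_i u 0 i * v 0 i.

Definition space : set coords :=
  [set x | if m is Sphere3 then dotp x x = 1 else True].

Definition tangent (x : coords) : set coords :=
  [set w | if m is Sphere3 then dotp x w = 0 else True].

(* The circle is R/Z: a knot is a 1-periodic map R -> M. *)
Definition knots : set (R^o -> coords) :=
  [set gam | (forall t, space (gam t)) /\ embedding (1 : R^o) setT gam].

Definition emb : Type := set_type knots.
HB.instance Definition _ := Choice.on emb.

Definition curve (gam : emb) : R^o -> coords := set_val gam.

Definition jet (gam : emb) :
    prod_topology (fun _ : nat => {uniform R^o -> coords}) :=
  fun k => derive1n k (curve gam).

(* The C^oo topology: uniform convergence of every derivative.  Declared on the
   alias emb, it replaces the topology that set_type would inherit from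
   pointwise convergence. *)
HB.instance Definition _ := Topological.copy emb (initial_topology jet).

Definition path_component (gam : emb) : set emb :=
  [set del | exists p : R -> emb,
     [/\ {within `[0, 1], continuous p}, p 0 = gam & p 1 = del]].

(* An oriented knot type is identified with the path component of emb formed by
   the embeddings of that type. *)
Definition knot_type (K : set emb) := exists gam, K = path_component gam.

Definition tensor := coords -> 'M[R]_(ambient_dim m).

Definition bilin (G : 'M[R]_(ambient_dim m)) (u v : coords) : R :=
  (u *m G *m v^T) 0 0.

(* A Riemannian metric on M: a smooth field of symmetric bilinear forms,
   positive definite on tangent spaces.  For S^3 a smooth tensor field along M is
   the restriction of a smooth one on a neighbourhood U of M; the metric on M
   is its restriction to tangent vectors, and nothing below depends on the
   choice of the extension. *)
Definition riemannian (g : tensor) :=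
  (exists U, [/\ open U, space `<=` U, smooth_on U g &
      forall x, U x -> (g x)^T = g x]) /\
  (forall x w, space x -> tangent x w -> w != 0 -> 0 < bilin (g x) w w).

Section Metric.
Variable g : tensor.

(* The bracket is g(nabla_{c'} c', w), with the Christoffel symbols of the first
   kind written out; testing only tangent w projects the ambient acceleration
   to TM, which for S^3 gives the Levi-Civita connection of g restricted to M
   (equivalently, the Euler-Lagrange equation of the energy of curves in M). *)
Definition geodesic (J : set R^o) (c : R^o -> coords) :=
  smooth_on J c /\ forall t, J t -> space (c t) /\
    forall w, tangent (c t) w ->
      bilin (g (c t)) (derive1n 2 c t) w
      + bilin ('D_(derive1 c t) g (c t)) (derive1 c t) w
      - 2^-1 * bilin ('D_w g (c t)) (derive1 c t) (derive1 c t) = 0.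

(* exp_p v = q; g is not assumed complete, so exp_p may be partial. *)
Definition exp_rel (p v q : coords) := exists (a b : R) (c : R^o -> coords),
  [/\ a < 0, 1 < b, geodesic `]a, b[ c &
      [/\ c 0 = p, derive1 c 0 = v & c 1 = q]].

Definition exp_map (p v : coords) : coords := xget 0 (exp_rel p v).

Definition curve_length (gam : emb) : R :=
  \int[lebesgue_measure]_(t in `[0, 1]%classic)
    Num.sqrt (bilin (g (curve gam t)) (derive1 (curve gam) t)
                                      (derive1 (curve gam) t)).

(* The open disc bundle of radius r in the normal bundle of gam, pulled back to
   the universal cover of the circle. *)
Definition normal_disc_bundle (gam : emb) (r : R) : set (R^o * coords)%type :=
  [set x | [/\ tangent (curve gam x.1) x.2,
     bilin (g (curve gam x.1)) (derive1 (curve gam) x.1) x.2 = 0 &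
     bilin (g (curve gam x.1)) x.2 x.2 < r ^+ 2]].

Definition normal_exp (gam : emb) (x : (R^o * coords)%type) : coords :=
  exp_map (curve gam x.1) x.2.

Definition normal_exp_embeds (gam : emb) (r : R) :=
  (forall x, normal_disc_bundle gam r x ->
     exists q, exp_rel (curve gam x.1) x.2 q) /\
  embedding ((1, 0) : (R^o * coords)%type)
    (normal_disc_bundle gam r) (normal_exp gam).

(* Radius 0 (empty disc bundle) is allowed only so that the supremum is never
   taken over the empty set. *)
Definition thickness (gam : emb) : \bar R :=
  ereal_sup [set r%:E | r in [set r | 0 <= r /\ normal_exp_embeds gam r]].

(* In \bar R, l / 0 = +oo for l > 0. *)
Definition ropelength (gam : emb) : \bar R :=
  ((curve_length gam)%:E / thickness gam)%E.

Definition sublevel (K : set emb) (L : R) : set emb :=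
  [set gam | K gam /\ (ropelength gam <= L%:E)%E].

Lemma sublevel_le K L L' : L <= L' -> sublevel K L `<=` sublevel K L'.
Proof.
by move=> LL' gam [Kg gL]; split=> //; apply: le_trans gL _; rewrite lee_fin.
Qed.

Lemma sublevel_sub K L : sublevel K L `<=` K.
Proof. by move=> gam []. Qed.

End Metric.
End Knots.

Section SublevelHomology.
Variables (R : realType) (m : ambient) (g : tensor R m) (K : set (emb R m)).
Variables (A : pzRingType) (j : nat).

Definition sublevel_homology (L : R) : lmodType A :=
  homology R A j (sublevel g K L).

Definition sublevel_map (L L' : R) (LL' : L <= L') :
    sublevel_homology L -> sublevel_homology L' :=
  @hmap R A _ _ (subset_incl (sublevel_le LL')) j.

Definition sublevel_to (L : R) : sublevel_homology L -> homology R A j K :=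
  @hmap R A _ _ (subset_incl (@sublevel_sub R m g K L)) j.

Definition sublevel_colim : lmodType A := colim sublevel_map.
End SublevelHomology.

(* Main.v *)
(* Ropelength is locally bounded on the space of embedded curves.  The exponential
   map of g is smooth near the zero section, and by compactness of the circle some k
   works uniformly for all curves C^2-close to gam: their speed is at most sqrt k,
   and exp is quantitatively injective on their normal discs of radius 1/k.  So their
   length is bounded above and their thickness below.  Hence the compact image of a
   singular simplex lies in a single sublevel, and so does every singular chain:
   cycles and boundaries of K both come from sublevels. *)
Require Import Defs.
From HB Require Import structures.
From mathcomp Require Import all_boot all_order all_algebra.
From mathcomp Require Import finmap.
From mathcomp Require Import all_classical all_reals all_analysis.
From mathcomp Require Import ring lra.
Import Order.TTheory GRing.Theory Num.Theory.
Import numFieldNormedType.Exports.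

Set Implicit Arguments.
Unset Strict Implicit.
Unset Printing Implicit Defensive.

Local Open Scope classical_set_scope.
Local Open Scope ring_scope.

(** * Calculus in finite dimension *)

(** [exp_map] merely selects an endpoint of some geodesic, and on the sphere geodesics are
    constrained to M and tested on tangent vectors only. The geodesic equation is therefore
    rewritten as an explicit vector field on an open set of ambient phase space whose flow preserves
    TM; smooth dependence on initial data gives a smooth map E that agrees with [exp_map] on tangent
    vectors near the zero section. In ambient coordinates the derivative of E at (p, 0) is (xi, eta)
    -> xi + eta, so injectivity on normal discs comes from linear estimates on chords, without an
    inverse function theorem. The outcome is an inequality |x - y| <= k |E x - E y|, modulo periods,
    for normal vectors whose images are less than 1/k apart; it yields injectivity, immersivity and
    openness at once. One constant k plays every role, as a bound and, through 1/k, as a radius.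
    Each property then weakens as k grows, which is what [compact_uniform] needs. Second derivatives
    enter because normal planes turn with the velocity. *)

Section RowVectorNorm.
Variables (R : realType) (m n : nat).
Implicit Types x y : 'M[R]_(m, n).

Lemma mx_norm_le x (e : R) : 0 <= e -> (forall i j, `|x i j| <= e) -> `|x| <= e.
Proof.
move=> e0 xe; rewrite /Num.norm /= mx_normrE; apply: bigmax_le => //= ij _; exact: xe.
Qed.

Lemma mx_norm_coord x i j : `|x i j| <= `|x|.
Proof.
rewrite [leRHS]/Num.norm /= mx_normrE.
by apply: (le_bigmax _ (fun ij : 'I_m * 'I_n => `|x ij.1 ij.2|) (i, j)).
Qed.

End RowVectorNorm.

Section CkBasics.
Variable R : realType.
Implicit Types V W : normedModType R.

Lemma CkS V W k (U : set V) (f : V -> W) : Ck k.+1 U f -> Ck k U f.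
Proof. by elim: k f => [|k IH] f [cf df]; split=> // v; have [? /IH] := df v. Qed.

Lemma Ck_le V W k l (U : set V) (f : V -> W) : (k <= l)%N -> Ck l U f -> Ck k U f.
Proof. by move=> /subnK <-; elim: (l - k)%N => // j IH /CkS. Qed.

Lemma Ck_sub V W k (U U' : set V) (f : V -> W) : U' `<=` U -> Ck k U f -> Ck k U' f.
Proof.
move=> UU'; elim: k f => [|k IH] f [cf df]; first by split=> // x /UU'; exact: cf.
split=> [x /UU'|v]; first exact: cf.
by have [dv cv] := df v; split=> [x /UU'|]; [exact: dv|exact: IH].
Qed.

(** Directional derivatives are total functions, so every clause of [Ck] is a condition at single
    points. Smoothness can thus be glued from local extensions, the form in which it is given for
    knots. *)
Lemma Ck_pt V W k (U : set V) (f : V -> W) :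
  (forall x, U x -> Ck k [set x] f) -> Ck k U f.
Proof.
elim: k f => [|k IH] f Uf; first by split=> // x Ux; have [+ _] := Uf x Ux; exact.
split=> [x Ux|v]; first by have [+ _] := Uf x Ux; exact.
split=> [x Ux|]; first by have [_ /(_ v)[+ _]] := Uf x Ux; exact.
by apply: IH => x Ux; have [_ /(_ v)[]] := Uf x Ux.
Qed.

Lemma near_eq_continuous V W (f g : V -> W) x :
  (\forall y \near x, f y = g y) -> {for x, continuous f} -> {for x, continuous g}.
Proof.
move=> fg cf; rewrite /prop_for /continuous_at -(nbhs_singleton fg).
by apply: cvg_trans cf; exact: near_eq_cvg.
Qed.

Lemma Ck_near_eq V W k (U : set V) (f g : V -> W) :
  (forall x, U x -> \forall y \near x, f y = g y) -> Ck k U f -> Ck k U g.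
Proof.
elim: k f g => [|k IH] f g fg [cf df].
  by split=> // x Ux; apply: near_eq_continuous (fg x Ux) (cf x Ux).
split=> [x Ux|v]; first exact: near_eq_continuous (fg x Ux) (cf x Ux).
have [dv cv] := df v; split=> [x Ux|].
  by apply: near_eq_derivable (dv x Ux); exact: fg.
(* Agreement near [x] also holds near each [y] close to [x], so the derivatives agree near [x]
   too. *)
apply: IH cv => x Ux; have := fg x Ux; rewrite -nbhs_nearE => /nbhs_interior.
by apply: filterS => y /near_eq_derive; exact.
Qed.

Lemma Ck_eq_in V W k (U : set V) (f g : V -> W) : open U ->
  (forall x, U x -> f x = g x) -> Ck k U f -> Ck k U g.
Proof.
move=> oU fg; apply: Ck_near_eq => x Ux.
by apply: filterS (open_nbhs_nbhs (conj oU Ux)) => y; exact: fg.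
Qed.

Lemma Ck_cst V W k (U : set V) (a : W) : Ck k U (fun _ : V => a).
Proof.
elim: k a => [|k IH] a; first by split=> // x _; exact: cst_continuous.
split=> [x _|v]; first exact: cst_continuous.
split=> [x _|]; first exact: derivable_cst.
have -> : (fun x : V => 'D_v (fun=> a) x) = fun=> 0.
  by apply/funext => x; exact: derive_cst.
exact: IH.
Qed.

Lemma CkD V W k (U : set V) (f g : V -> W) : open U -> Ck k U f -> Ck k U g ->
  Ck k U (fun x => f x + g x).
Proof.
move=> oU; elim: k f g => [|k IH] f g Cf Cg; have [cf df] := Cf; have [cg dg] := Cg.
  by split=> // x Ux; apply: cvgD; [exact: cf|exact: cg].
split=> [x Ux|v]; first by apply: cvgD; [exact: cf|exact: cg].
have [dfv cfv] := df v; have [dgv cgv] := dg v; split=> [x Ux|].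
  by apply: derivableD; [exact: dfv|exact: dgv].
apply: (@Ck_eq_in _ _ _ _ (fun x => 'D_v f x + 'D_v g x)) => //; last exact: IH.
by move=> x Ux; apply/esym/deriveD; [exact: dfv|exact: dgv].
Qed.

Lemma Ck_sum V W k (U : set V) I (r : seq I) (P : pred I) (f : I -> V -> W) :
  open U -> (forall i, P i -> Ck k U (f i)) -> Ck k U (fun x => \sum_(i <- r | P i) f i x).
Proof.
move=> oU Uf; elim: r => [|i r IH].
  by under eq_fun do rewrite big_nil; exact: Ck_cst.
have [Pi|Pi] := boolP (P i); last by under eq_fun do rewrite big_cons (negbTE Pi).
under eq_fun do rewrite big_cons Pi.
by apply: CkD => //; exact: Uf.
Qed.

Lemma CkZl V W k (U : set V) (f : V -> R^o) (g : V -> W) : open U ->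
  Ck k U f -> Ck k U g -> Ck k U (fun x => f x *: g x).
Proof.
move=> oU; elim: k f g => [|k IH] f g Cf Cg.
  by have [[cf _] [cg _]] := (Cf, Cg); split=> // x Ux; apply: cvgZ; [exact: cf|exact: cg].
have [[cf df] [cg dg]] := (Cf, Cg).
split=> [x Ux|v]; first by apply: cvgZ; [exact: cf|exact: cg].
have [dfv cfv] := df v; have [dgv cgv] := dg v.
have D x : U x -> is_derive x v (fun x => f x *: g x) (f x *: 'D_v g x + 'D_v f x *: g x).
  move=> Ux.
  suff H : h^-1 *: (((fun x => f x *: g x) \o shift x) (h *: v) - f x *: g x) @[h --> 0^'] -->
      f x *: 'D_v g x + 'D_v f x *: g x.
    by split; [apply/cvg_ex; eexists; exact: H|exact: cvg_lim H].
  have -> : (fun h => h^-1 *: (((fun x => f x *: g x) \o shift x) (h *: v) - f x *: g x)) =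
     (fun h => f (h *: v + x) *: (h^-1 *: ((g \o shift x) (h *: v) - g x)) +
               (h^-1 *: ((f \o shift x) (h *: v) - f x)) *: g x).
    apply/funext => h /=.
    rewrite !scalerBr scalerBl !scalerA addrA.
    rewrite [f _ * _]mulrC.
    by rewrite -[(h^-1 *: f (h *: v + x)) ]/(h^-1 * f (h *: v + x)) -[(h^-1 *: f x) ]/(h^-1 * f x) subrK.
  apply: cvgD; apply: cvgZ.
  - have fx : {for x, continuous f} by exact: cf.
    apply: (@cvg_comp _ _ _ (fun h : R => h *: v + x) f) fx.
    have -> : nbhs x = nbhs (0 *: v + x) by rewrite scale0r add0r.
    apply: cvgD; last exact: cvg_cst.
    apply: cvgZr_tmp; exact: nbhs_dnbhs.
  - exact: dgv.
  - exact: dfv.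
  - exact: cvg_cst.
split=> [x Ux|]; first by have [] := D x Ux.
apply: (@Ck_eq_in _ _ _ _ (fun x => f x *: 'D_v g x + 'D_v f x *: g x)) => //.
  by move=> x Ux; have [_ ->] := D x Ux.
by apply: CkD => //; apply: IH => //; exact: CkS.
Qed.

Lemma CkM V k (U : set V) (f g : V -> R^o) : open U ->
  Ck k U f -> Ck k U g -> Ck k U (fun x => f x * g x : R^o).
Proof. exact: CkZl. Qed.

Lemma CkN V W k (U : set V) (f : V -> W) : open U -> Ck k U f -> Ck k U (fun x => - f x).
Proof.
move=> oU Cf; under eq_fun do rewrite -scaleN1r.
by apply: CkZl => //; exact: Ck_cst.
Qed.

Lemma CkB V W k (U : set V) (f g : V -> W) : open U -> Ck k U f -> Ck k U g ->
  Ck k U (fun x => f x - g x).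
Proof. by move=> oU Cf Cg; apply: CkD => //; exact: CkN. Qed.

Lemma CkV V k (U : set V) (f : V -> R^o) : open U -> (forall x, U x -> f x != 0) ->
  Ck k U f -> Ck k U (fun x => (f x)^-1 : R^o).
Proof.
move=> oU f0; elim: k => [|k IH] Cf.
  by have [cf _] := Cf; split=> // x Ux; apply: cvgV; [exact: f0|exact: cf].
have [cf df] := Cf.
split=> [x Ux|v]; first by apply: cvgV; [exact: f0|exact: cf].
have [dfv cfv] := df v; split=> [x Ux|].
  by apply: derivableV; [exact: f0|exact: dfv].
apply: (@Ck_eq_in _ _ _ _ (fun x => - (f x)^-1 * (f x)^-1 * 'D_v f x : R^o)) => //.
  move=> x Ux; rewrite deriveV; [|exact: f0|exact: dfv].
  by rewrite /GRing.scale /= expr2 invfM !mulNr.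
apply: CkM => //; apply: CkM => //; last by apply: IH; exact: CkS.
by apply: CkN => //; apply: IH; exact: CkS.
Qed.

Lemma Ck_prod V k (U : set V) I (r : seq I) (P : pred I) (f : I -> V -> R^o) :
  open U -> (forall i, P i -> Ck k U (f i)) ->
  Ck k U (fun x => \prod_(i <- r | P i) f i x : R^o).
Proof.
move=> oU Uf; elim: r => [|i r IH].
  by under eq_fun do rewrite big_nil; exact: Ck_cst.
have [Pi|Pi] := boolP (P i); last by under eq_fun do rewrite big_cons (negbTE Pi).
under eq_fun do rewrite big_cons Pi.
by apply: CkM => //; exact: Uf.
Qed.

Lemma Ck_mx V m n k (U : set V) (f : V -> 'M[R]_(m, n)) : open U ->
  Ck k U f <-> forall i j, Ck k U (fun x => f x i j : R^o).
Proof.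
move=> oU; have cont (h : V -> 'M[R]_(m, n)) :
    (forall x, U x -> {for x, continuous h}) <->
    forall i j x, U x -> {for x, continuous (fun x => h x i j : R^o)}.
  split=> [ch i j x Ux|ch x Ux].
    apply: (@continuous_comp _ _ _ h (fun M : 'M[R]_(m, n) => M i j)); first exact: ch.
    exact: coord_continuous.
  apply/cvgrPdist_le => e e0.
  have : \forall y \near x, forall i j, `|h x i j - h y i j| <= e.
    apply: filter_forall => i; apply: filter_forall => j.
    by have /cvgrPdist_le/(_ e e0) := ch i j x Ux.
  by apply: filterS => y hy; apply: mx_norm_le (ltW e0) _ => i j; rewrite !mxE; exact: hy.
elim: k f => [|k IH] f.
  split=> [[+ _] i j|Cf]; first by move/cont => cf; split=> // x Ux; exact: cf.
  by split=> //; apply/cont => i j x Ux; have [+ _] := Cf i j; exact.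
split=> [[+ df] i j|Cf].
  move/cont => cf; split=> [x Ux|v]; first exact: cf.
  have [dv /IH/(_ i j) cv] := df v; split=> [x Ux|].
    by have /derivable_mxP := dv x Ux; exact.
  apply: Ck_eq_in cv => // x Ux.
  by rewrite derive_mx ?mxE //; exact: dv.
split=> [|v]; first by apply/cont => i j x Ux; have [+ _] := Cf i j; exact.
have dv x : U x -> derivable f x v.
  by move=> Ux; apply/derivable_mxP => i j; have [_ /(_ v)[+ _]] := Cf i j; exact.
split=> //; apply/IH => i j.
have [_ /(_ v)[_ cv]] := Cf i j.
apply: Ck_eq_in cv => // x Ux.
by rewrite derive_mx ?mxE //; exact: dv.
Qed.

End CkBasics.

Section StrictDifferentiability.
Variable R : realType.

Lemma is_derive_line (V W : normedModType R) (f : V -> W) (x v : V) (s : R) :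
  derivable f (s *: v + x) v ->
  is_derive s 1 (fun t : R => f (t *: v + x)) ('D_v f (s *: v + x)).
Proof.
have E : (fun h : R => h^-1 *: (((fun t : R => f (t *: v + x)) \o shift s) (h *: 1) - f (s *: v + x))) =
    (fun h : R => h^-1 *: ((f \o shift (s *: v + x)) (h *: v) - f (s *: v + x))).
  by apply/funext => h /=; rewrite [_%:A]mulr1 scalerDl addrA.
move=> df; split; first by rewrite /derivable E.
by rewrite /derive E.
Qed.

(** The endpoints are unordered because the lemma is applied to one coordinate of two arbitrary
    points. *)
Lemma MVT_approx (f : R -> R) (df : R -> R) (l e a b : R) :
  (forall t, Num.min a b <= t <= Num.max a b -> is_derive t 1 f (df t)) ->
  (forall t, Num.min a b <= t <= Num.max a b -> `|df t - l| <= e) ->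
  `|f b - f a - (b - a) * l| <= e * `|b - a|.
Proof.
wlog ab : a b / a <= b => [hw df_ dfl|].
  have [/hw|/ltW/hw] := leP a b; first exact.
  rewrite minC maxC => /(_ df_ dfl).
  have -> : f b - f a - (b - a) * l = - (f a - f b - (a - b) * l) by ring.
  by rewrite normrN (distrC b a).
rewrite min_l // max_r // => df_ dfl.
have [|c|c cab ->] := @MVT_segment R f df a b ab.
- by move=> x; rewrite in_itv /= => /andP[ax xb]; apply: df_; rewrite !ltW.
- apply: derivable_within_continuous => x; rewrite in_itv /= => xab.
  by have [] := df_ x xab.
have -> : df c * (b - a) - (b - a) * l = (df c - l) * (b - a) by ring.
by rewrite normrM ler_wpM2r // dfl.
Qed.

(** Moving from [z] to [y] one coordinate at a time, each step is estimated by the mean value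
    theorem. Both points vary: this strict form, unlike differentiability at [x], gives Lipschitz
    and injectivity bounds. *)
Lemma C1_strict n (U : set 'rV[R]_n) (h : 'rV[R]_n -> R^o) x : open U -> U x -> Ck 1 U h ->
  forall e : R, 0 < e -> exists2 r : R, 0 < r & forall y z, `|y - x| < r -> `|z - x| < r ->
    `|h y - h z - \sum_i (y - z) 0 i * 'D_(delta_mx 0 i) h x| <= e * `|y - z|.
Proof.
move=> oU Ux [_ dh] e e0.
(* [n.+1] rather than [n] also covers dimension 0; the spare summand is nonnegative. *)
pose e' := e / n.+1%:R.
have e'0 : 0 < e' by rewrite divr_gt0.
have : \forall y \near x, U y /\ forall i, `|'D_(delta_mx 0 i) h y - 'D_(delta_mx 0 i) h x| <= e'.
  have H1 : \forall y \near x, U y by exact: open_nbhs_nbhs.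
  have H2 : \forall y \near x, forall i,
      `|'D_(delta_mx 0 i) h y - 'D_(delta_mx 0 i) h x| <= e'.
    apply: (@filter_forall _ _ _ _ (nbhs_filter x)) => i.
    have [_ [cd _]] := dh (delta_mx 0 i).
    have /cvgrPdist_le/(_ e' e'0) := cd x Ux.
    by apply: filterS => y; rewrite distrC.
  by near=> y; split; near: y.
rewrite -nbhs_nearE => /nbhs_ballP[r /= r0 rP].
have {}rP y : `|y - x| < r -> U y /\ forall i, `|'D_(delta_mx 0 i) h y - 'D_(delta_mx 0 i) h x| <= e'.
  by move=> yr; apply: rP; rewrite -ball_normE /= distrC.
exists r => // y z yr zr.
(* The polygonal path from [z] to [y]: after [k] steps the first [k] coordinates are those of
   [y]. *)
pose w k : 'rV[R]_n := \row_j (if (j < k)%N then y 0 j else z 0 j).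
have -> : h y - h z = \sum_(i < n) (h (w i.+1) - h (w i)).
  rewrite -(big_mkord xpredT (fun i => h (w i.+1) - h (w i))) telescope_sumr //.
  congr (h _ - h _); apply/rowP => j; rewrite !mxE //.
  by rewrite ltn_ord.
rewrite -sumrB; apply: le_trans (ler_norm_sum _ _ _) _.
have -> : e * `|y - z| = \sum_(i < n.+1) e' * `|y - z|.
  by rewrite sumr_const card_ord -mulr_natl /e'; field.
rewrite big_ord_recr /= -[leLHS]addr0; apply: lerD; last by rewrite mulr_ge0 // ltW.
apply: ler_sum => i _.
(* With the moving coordinate erased, both ends of the step lie on the line through [w0] in
   direction [i]. *)
pose w0 : 'rV[R]_n := \row_j (if j == i then 0 else w i 0 j).
have wE t : t *: delta_mx 0 i + w0 = \row_j (if j == i then t else w i 0 j).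
  apply/rowP => j; rewrite !mxE eqxx /=.
  by case: eqP => _; rewrite ?mulr1 ?addr0 // mulr0 add0r.
have w1 : w i.+1 = y 0 i *: delta_mx 0 i + w0.
  rewrite wE; apply/rowP => j; rewrite !mxE ltnS leq_eqVlt -val_eqE /=.
  by case: eqP => //= /val_inj ->.
have w2 : w i = z 0 i *: delta_mx 0 i + w0.
  rewrite wE; apply/rowP => j; rewrite !mxE -val_eqE /=.
  by case: eqP => // /val_inj ->; rewrite ltnn.
have wr t : Num.min (z 0 i) (y 0 i) <= t <= Num.max (z 0 i) (y 0 i) ->
    `|t *: delta_mx 0 i + w0 - x| < r.
  move=> tzy; apply: (@le_lt_trans _ _ (Num.max `|y - x| `|z - x|)); last by rewrite gt_max yr zr.
  apply: mx_norm_le => [|a j]; first by rewrite le_max normr_ge0.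
  rewrite ord1 wE !mxE le_max.
  have cy : `|y 0 j - x 0 j| <= `|y - x| by have := mx_norm_coord (y - x) 0 j; rewrite !mxE.
  have cz : `|z 0 j - x 0 j| <= `|z - x| by have := mx_norm_coord (z - x) 0 j; rewrite !mxE.
  case: ifP => [/eqP ji|_]; last by case: ifP => _; rewrite ?cy ?cz ?orbT.
  move: cy cz; rewrite ji; move: tzy; rewrite ge_min le_max => /andP[].
  move: (y 0 i) (z 0 i) (x 0 i) `|y - x| `|z - x| => a1 a2 a3 N1 N2 p q c1 c2.
  apply/orP; move: c1 c2; rewrite !ler_norml => c1 c2.
  by case/orP: p => p; case/orP: q => q; lra.
rewrite w1 w2 -[X in `|_ - X|]/(_ * _) [(y - z) 0 i]mxE [(- z) 0 i]mxE.
apply: le_trans (@MVT_approx (fun t => h (t *: delta_mx 0 i + w0))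
   (fun t => 'D_(delta_mx 0 i) h (t *: delta_mx 0 i + w0)) ('D_(delta_mx 0 i) h x) e' _ _ _ _) _.
- move=> t /wr /rP[Ut _]; apply: is_derive_line.
  by have [+ _] := dh (delta_mx 0 i); exact.
- by move=> t /wr /rP[_]; exact.
apply: ler_wpM2l; first exact: ltW.
by have := mx_norm_coord (y - z) 0 i; rewrite !mxE.
Unshelve. all: by end_near.
Qed.

End StrictDifferentiability.

Section ChainRule.
Variable R : realType.
Implicit Types V W : normedModType R.

Lemma Ck_lin V W k (U : set V) (L : {linear V -> W}) : continuous L -> Ck k U L.
Proof.
move=> cL; case: k => [|k]; first by split=> // x _; exact: cL.
split=> [x _|v]; first exact: cL.
have dL x : differentiable L x by exact: linear_differentiable.
split=> [x _|]; first exact: diff_derivable.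
under eq_fun do rewrite deriveE // diff_lin //.
exact: Ck_cst.
Qed.

Lemma Ck_id V k (U : set V) : Ck k U (fun x : V => x).
Proof.
case: k => [|k]; first by split=> // x _; exact: cvg_id.
split=> [x _|v]; first exact: cvg_id.
split=> [x _|]; first exact: derivable_id.
under eq_fun do rewrite derive_id.
exact: Ck_cst.
Qed.

Lemma Ck_coord m n k (U : set 'M[R]_(m, n)) i j : open U -> Ck k U (fun x : 'M[R]_(m, n) => x i j : R^o).
Proof. by move=> oU; have /Ck_mx/(_ i j) := @Ck_id 'M[R]_(m, n) k U; exact. Qed.

Lemma lincomb_continuous n (c : 'I_n -> R) :
  continuous (fun u : 'rV[R]_n => \sum_i u 0 i * c i : R^o).
Proof.
have [+ _] : Ck 0 setT (fun u : 'rV[R]_n => \sum_i u 0 i * c i : R^o).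
  apply: Ck_sum openT _ => i _.
  by apply: CkM openT _ _; [apply: Ck_coord; exact: openT|exact: Ck_cst].
by move=> cf x; apply: cf.
Qed.

(** Only the direction [v] matters for [f]: its difference quotients [F s] converge, and the strict
    estimate for [h] at [f x] compares the quotients of the composite with [D (F s)]. *)
Lemma chain_rule V n (f : V -> 'rV[R]_n) (x v : V) (U : set 'rV[R]_n) (h : 'rV[R]_n -> R^o) :
  open U -> U (f x) -> Ck 1 U h -> derivable f x v ->
  is_derive x v (fun y => h (f y)) (\sum_i ('D_v f x) 0 i * 'D_(delta_mx 0 i) h (f x)).
Proof.
move=> oU Ufx Ch df.
set w := 'D_v f x; pose D (u : 'rV[R]_n) : R^o := \sum_i u 0 i * 'D_(delta_mx 0 i) h (f x).
pose F (s : R) := s^-1 *: (f (s *: v + x) - f x).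
have Fw : F s @[s --> 0^'] --> w by exact: df.
have fx0 : f (s *: v + x) - f x @[s --> 0^'] --> (0 : 'rV[R]_n).
  have : s *: F s @[s --> 0^'] --> 0 *: w.
    by apply: cvgZ => //; exact: nbhs_dnbhs.
  rewrite scale0r; apply: cvg_trans; apply: near_eq_cvg.
  near=> s; rewrite /F scalerA divff ?scale1r //; near: s; exact: nbhs_dnbhs_neq.
have DF : D (F s) @[s --> 0^'] --> D w.
  exact: (@cvg_comp _ _ _ F D _ _ _ Fw (@lincomb_continuous _ _ w)).
suff H : s^-1 *: (((fun y => h (f y)) \o shift x) (s *: v) - h (f x)) @[s --> 0^'] --> D w.
  by split; [apply/cvg_ex; eexists; exact: H|exact: cvg_lim H].
apply/cvgrPdist_le => e e0.
(* Near 0 the quotients satisfy |F s| <= |w| + 1, so an error [e1] relative to them costs at most e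
   / 2. *)
pose e1 := e / 2 / (`|w| + 1).
have w10 : 0 < `|w| + 1 by rewrite ltr_wpDl.
have e10 : 0 < e1 by rewrite !divr_gt0.
have [r r0 hr] := C1_strict oU Ufx Ch e10.
near=> s.
have s0 : s != 0 by near: s; exact: nbhs_dnbhs_neq.
have dr : `|f (s *: v + x) - f x| < r.
  near: s; have /cvgrPdist_lt/(_ r r0) := fx0.
  by apply: filterS => s; rewrite sub0r normrN.
have Fs1 : `|F s| <= `|w| + 1.
  near: s; have /cvgrPdist_le/(_ 1 ltr01) := Fw.
  apply: filterS => s ws; rewrite -[F s](subrK w) (le_trans (ler_normD _ _)) //.
  by rewrite addrC lerD2l distrC.
have Ds : `|D w - D (F s)| <= e / 2.
  near: s; have /cvgrPdist_le := DF; apply; exact: divr_gt0.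
rewrite -(subrKA (D (F s))) (le_trans (ler_normD _ _)) // (splitr e) lerD // distrC.
have -> : D (F s) = s^-1 *: D (f (s *: v + x) - f x).
  rewrite /D [RHS]/GRing.scale /= mulr_sumr; apply: eq_bigr => i _.
  by rewrite mulrA [in LHS]mxE.
rewrite -scalerBr normrZ.
apply: (@le_trans _ _ (`|s^-1| * (e1 * `|f (s *: v + x) - f x|))).
  apply: ler_wpM2l => //; apply: hr => //.
  by rewrite subrr normr0.
have -> : `|s^-1| * (e1 * `|f (s *: v + x) - f x|) = e1 * `|F s|.
  by rewrite /F normrZ mulrCA.
by rewrite (le_trans (ler_wpM2l (ltW e10) Fs1)) // /e1 divfK // gt_eqF.
Unshelve. all: by end_near.
Qed.

Lemma C1_derive_sum n (U : set 'rV[R]_n) (h : 'rV[R]_n -> R^o) (x v : 'rV[R]_n) :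
  open U -> U x -> Ck 1 U h ->
  'D_v h x = \sum_i v 0 i * 'D_(delta_mx 0 i) h x.
Proof.
move=> oU Ux Ch.
have [_ ->] := @chain_rule 'rV[R]_n n id x v U h oU Ux Ch (@derivable_id _ _ _ _).
by rewrite derive_id.
Qed.

(** A derivative of the composite is a sum of products of coordinates of the derivative of [f] with
    partial derivatives of [h] taken along [f]. The induction generalises over [h] to reach those
    partials. *)
Lemma Ck_comp V n k (U : set V) (U' : set 'rV[R]_n) (f : V -> 'rV[R]_n) (h : 'rV[R]_n -> R^o) :
  open U -> open U' -> (forall x, U x -> U' (f x)) -> Ck k U f -> Ck k U' h ->
  Ck k U (fun x => h (f x)).
Proof.
move=> oU oU' fU; elim: k h => [|k IH] h Cf Ch.
  split=> // x Ux; apply: (@continuous_comp _ _ _ f h).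
    by have [+ _] := Cf; exact.
  by have [+ _] := Ch; apply; exact: fU.
have cont x : U x -> {for x, continuous (fun x => h (f x))}.
  move=> Ux; apply: (@continuous_comp _ _ _ f h).
    by have [+ _] := Cf; exact.
  by have [+ _] := Ch; apply; exact: fU.
split=> // v; have [_ /(_ v)[dfv cfv]] := Cf.
have dh x : U x -> is_derive x v (fun y => h (f y)) (\sum_i ('D_v f x) 0 i * 'D_(delta_mx 0 i) h (f x)).
  move=> Ux; apply: (@chain_rule _ _ _ _ _ U') => //; [exact: fU| |exact: dfv].
  exact: Ck_le Ch.
split=> [x /dh[] //|].
apply: (@Ck_eq_in _ _ _ _ _ (fun x => \sum_i ('D_v f x) 0 i * 'D_(delta_mx 0 i) h (f x) : R^o)) => //.
  by move=> x /dh[].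
apply: Ck_sum => // i _; apply: CkM => //; first exact: (Ck_mx _ _ _).1.
apply: (IH (fun y => 'D_(delta_mx 0 i) h y)); first exact: CkS.
by have [_ /(_ (delta_mx 0 i))[]] := Ch.
Qed.

Lemma Ck_comp_mx V n p q k (U : set V) (U' : set 'rV[R]_n) (f : V -> 'rV[R]_n)
    (h : 'rV[R]_n -> 'M[R]_(p, q)) :
  open U -> open U' -> (forall x, U x -> U' (f x)) -> Ck k U f -> Ck k U' h ->
  Ck k U (fun x => h (f x)).
Proof.
move=> oU oU' fU Cf /(Ck_mx _ _ oU') Ch; apply/(Ck_mx _ _ oU) => i j.
exact: (Ck_comp oU oU' fU Cf (Ch i j)).
Qed.

(** The difference quotient of the composite in direction [v] is that of [f] in direction [L v], so
    [f] may live on any normed space, such as the parameter line of a knot. *)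
Lemma Ck_affine V V' W k (U : set V) (f : V -> W) (L : {linear V' -> V}) (a : V) :
  continuous L -> Ck k U f -> Ck k [set x | U (L x + a)] (fun x => f (L x + a)).
Proof.
move=> cL; elim: k f => [|k IH] f [cf df].
  split=> // x Ux; apply: (@continuous_comp _ _ _ (fun x => L x + a) f); last exact: cf.
  by apply: cvgD; [exact: cL|exact: cvg_cst].
split=> [x Ux|v].
  apply: (@continuous_comp _ _ _ (fun x => L x + a) f); last exact: cf.
  by apply: cvgD; [exact: cL|exact: cvg_cst].
have E x : (fun s : R => s^-1 *: (((fun x => f (L x + a)) \o shift x) (s *: v) - f (L x + a))) =
    (fun s : R => s^-1 *: ((f \o shift (L x + a)) (s *: L v) - f (L x + a))).
  by apply/funext => s /=; rewrite (linearP L) addrA.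
have [dv cv] := df (L v); split=> [x Ux|]; first by rewrite /derivable E; exact: dv.
have -> : (fun x => 'D_v (fun x => f (L x + a)) x) = (fun x => 'D_(L v) f (L x + a)).
  by apply/funext => x; rewrite /derive E.
exact: (IH (fun y => 'D_(L v) f y) cv).
Qed.

End ChainRule.

(** * Flows of smooth vector fields *)

Section VectorCalculus.
Variable R : realType.

Lemma is_derive_coord m n (y : R -> 'M[R]_(m, n)) t d i j :
  is_derive t (1 : R) y d -> is_derive t (1 : R) (fun s => y s i j) (d i j).
Proof.
move=> [dy <-]; split; first by move/derivable_mxP : dy; exact.
by rewrite derive_mx // mxE.
Qed.

Lemma is_derive_mx m n (y : R -> 'M[R]_(m, n)) t (d : 'M[R]_(m, n)) :
  (forall i j, is_derive t (1 : R) (fun s => y s i j) (d i j)) -> is_derive t (1 : R) y d.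
Proof.
move=> dy; have D : derivable y t 1 by apply/derivable_mxP => i j; have [] := dy i j.
by split=> //; rewrite derive_mx //; apply/matrixP => i j; rewrite mxE; have [] := dy i j.
Qed.

Lemma is_derive_continuous (V : normedModType R) (y : R -> V) t d :
  is_derive t (1 : R) y d -> {for t, continuous y}.
Proof. by move=> [/derivable1_diffP/differentiable_continuous]. Qed.

Lemma is_derive_affine (V : normedModType R) (y : R -> V) (a b t : R) d :
  is_derive (a * t + b) (1 : R) y d -> is_derive t (1 : R) (fun s => y (a * s + b)) (a *: d).
Proof.
move=> [dy <-].
have dd : differentiable y (a * t + b) by exact/derivable1_diffP.
have -> : (fun s => y (a * s + b)) = (fun s : R => y (s *: (a : R) + b)).
  by apply/funext => s; rewrite [s *: a]mulrC.
have E : a * t + b = t *: (a : R) + b by rewrite [t *: a]mulrC.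
have -> : a *: 'D_1 y (a * t + b) = 'D_a y (t *: (a : R) + b).
  rewrite -E !deriveE // -(linearZ_LR ('d y (a * t + b)) a (1 : R)).
  by rewrite [_ *: 1]mulr1.
apply: is_derive_line; rewrite -E; exact: diff_derivable.
Qed.

Lemma derive_ge0_le (f df : R -> R) (a b : R) : a <= b ->
  (forall t, a <= t <= b -> is_derive t 1 f (df t)) ->
  (forall t, a <= t <= b -> 0 <= df t) -> f a <= f b.
Proof.
move=> ab fd df0; have [||c] := @MVT_segment R f df a b ab.
- by move=> x; rewrite in_itv /= => /andP[ax xb]; apply: fd; rewrite !ltW.
- apply: derivable_within_continuous => x; rewrite in_itv /= => xab.
  by have [] := fd x xab.
rewrite in_itv /= => cab E; rewrite -subr_ge0 E mulr_ge0 ?df0 // subr_ge0 //.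
Qed.

(** For the maximum norm the inequality can be checked on entries: both [h] minus an entry of [y]
    and [h] plus that entry are nondecreasing. *)
Lemma derive_majorant m n (y dy : R -> 'M[R]_(m, n)) (h dh : R -> R) (a b : R) : a <= b ->
  (forall t, a <= t <= b -> is_derive t (1 : R) y (dy t)) ->
  (forall t, a <= t <= b -> is_derive t 1 h (dh t)) ->
  (forall t, a <= t <= b -> `|dy t| <= dh t) ->
  `|y b - y a| <= h b - h a.
Proof.
move=> ab yd hd dyh; apply: mx_norm_le => [|i j].
  rewrite subr_ge0; apply: (derive_ge0_le ab hd) => t tab.
  by apply: le_trans (dyh t tab).
have dij t : a <= t <= b -> `|dy t i j| <= dh t.
  by move=> tab; apply: le_trans (dyh t tab); exact: mx_norm_coord.
have H1 : h a - y a i j <= h b - y b i j.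
  apply: (derive_ge0_le (f := h - (fun s => y s i j)) (df := fun t => dh t - dy t i j) ab) => t tab.
    by apply: is_deriveB; [exact: hd|exact/is_derive_coord/yd].
  by have := dij t tab; rewrite ler_norml subr_ge0 => /andP[].
have H2 : h a + y a i j <= h b + y b i j.
  apply: (derive_ge0_le (f := h + (fun s => y s i j)) (df := fun t => dh t + dy t i j) ab) => t tab.
    by apply: is_deriveD; [exact: hd|exact/is_derive_coord/yd].
  by have := dij t tab; rewrite ler_norml => /andP[+ _]; lra.
by rewrite !mxE ler_norml; lra.
Qed.

Lemma is_derive_expM (k t : R) : is_derive t 1 (fun s => expR (k * s)) (k * expR (k * t)).
Proof.
have := @is_derive_affine R (expR : R -> R) k 0 t (expR (k * t + 0)) (is_derive_expR _).
by rewrite !addr0; under eq_fun do rewrite addr0.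
Qed.

(* With K the maximum of exp(-2 L t) |y t|, integrating |y'| gives K <= |y 0| + d T + K / 2. *)
Lemma gronwall m n (y dy : R -> 'M[R]_(m, n)) (L d T : R) : 0 < L -> 0 <= d -> 0 <= T ->
  (forall t, 0 <= t <= T -> is_derive t (1 : R) y (dy t)) ->
  (forall t, 0 <= t <= T -> `|dy t| <= L * `|y t| + d) ->
  `|y T| <= 2 * (`|y 0| + d * T) * expR (2 * L * T).
Proof.
move=> L0 d0 T0 yd dyL.
pose phi t := expR (- (2 * L) * t) * `|y t|.
have cphi : {within `[0, T], continuous phi}.
  apply: continuous_in_subspaceT => t; rewrite inE /= in_itv /= => tT.
  apply: cvgM.
    by apply: (is_derive_continuous (is_derive_expM _ _)).
  apply: cvg_norm; exact: (is_derive_continuous (yd t tT)).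
have [s sT maxs] := EVT_max T0 cphi.
move: sT; rewrite in_itv /= => /andP[s0 sT].
set K := phi s in maxs.
have yK t : 0 <= t <= T -> `|y t| <= K * expR (2 * L * t).
  move=> tT; have := maxs t; rewrite in_itv /= => /(_ tT).
  rewrite /phi mulNr expRN mulrC => H.
  by rewrite -ler_pdivrMr ?expR_gt0.
have /(_ s) : forall t, 0 <= t <= T -> `|y t - y 0| <= (d * t + K / 2 * expR (2 * L * t)) -
    (d * 0 + K / 2 * expR (2 * L * 0)).
  move=> t /andP[t0 tT].
  apply: (derive_majorant (y := y) (dy := dy) (h := fun s => d * s + K / 2 * expR (2 * L * s))
    (dh := fun s => d + K / 2 * (2 * L * expR (2 * L * s)))) => //.
  - by move=> r /andP[r0 rt]; apply: yd; rewrite r0 (le_trans rt).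
  - move=> r _; apply: is_deriveD.
      by have := is_deriveZ d (@is_derive_id _ _ r (1 : R)); rewrite [_ *: 1]mulr1; exact.
    have := is_deriveZ (K / 2) (is_derive_expM (2 * L) r); exact.
  - move=> r /andP[r0 rt]; have rT : 0 <= r <= T by rewrite r0 (le_trans rt).
    apply: le_trans (dyL r rT) _; rewrite addrC lerD2l.
    have -> : K / 2 * (2 * L * expR (2 * L * r)) = L * (K * expR (2 * L * r)) by field.
    by rewrite ler_pM2l // yK.
rewrite s0 sT !mulr0 expR0 mulr1 add0r => /(_ isT) ys.
have K0 : 0 <= K by rewrite mulr_ge0 // expR_ge0.
have {}ys : `|y s| <= `|y 0| + d * T + K / 2 * expR (2 * L * s).
  have := ler_normD (y s - y 0) (y 0); rewrite subrK => H.
  have : d * s <= d * T by rewrite ler_wpM2l.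
  by move: ys H; lra.
have e1 : 1 <= expR (2 * L * s) by rewrite -expR0 ler_expR !mulr_ge0 // ltW.
have KE : K * expR (2 * L * s) = `|y s|.
  by rewrite /K /phi mulNr expRN mulrAC mulVf ?mul1r // gt_eqF ?expR_gt0.
have K2 : K <= 2 * (`|y 0| + d * T).
  have ydT : 0 <= `|y 0| + d * T by rewrite addr_ge0 // mulr_ge0.
  have : (`|y 0| + d * T) * 1 <= (`|y 0| + d * T) * expR (2 * L * s) by rewrite ler_wpM2l.
  rewrite mulr1 => H; rewrite -(ler_pM2r (lt_le_trans ltr01 e1)).
  by move: KE ys H; lra.
apply: le_trans (yK T _) _; first by rewrite T0 lexx.
by rewrite ler_wpM2r ?expR_ge0.
Qed.

(** The condition on [J] describes the segment between 0 and [T] for either sign of [T]; negative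
    times are handled by reversing time. *)
Lemma gronwall_abs m n (y dy : R -> 'M[R]_(m, n)) (L d T : R) (J : set R) : 0 < L -> 0 <= d ->
  (forall t, `|t| <= `|T| -> 0 <= t * T -> J t) ->
  (forall t, J t -> is_derive t (1 : R) y (dy t)) ->
  (forall t, J t -> `|dy t| <= L * `|y t| + d) ->
  `|y T| <= 2 * (`|y 0| + d * `|T|) * expR (2 * L * `|T|).
Proof.
move=> L0 d0 JT yd dyL; have [T0|T0] := leP 0 T.
  have J0 t : 0 <= t <= T -> J t.
    by move=> /andP[t0 tT]; apply: JT; rewrite ?ger0_norm // mulr_ge0.
  rewrite ger0_norm //; apply: (gronwall (dy := dy)) => // t /J0; [exact: yd|exact: dyL].
have J0 t : 0 <= t <= - T -> J (- t).
  move=> /andP[t0 tT]; apply: JT; first by rewrite normrN ger0_norm // ltr0_norm.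
  by rewrite mulNr oppr_ge0 mulr_ge0_le0 // ltW.
have TE : `|T| = - T by rewrite ltr0_norm.
have H := @gronwall m n (fun s => y (- s)) (fun s => - dy (- s)) L d (- T) L0 d0.
rewrite opprK oppr0 in H; rewrite TE; apply: H; first by rewrite oppr_ge0 ltW.
- move=> t /J0 Jt; have := yd _ Jt.
  have {1}-> : - t = -1 * t + 0 by rewrite mulN1r addr0.
  move/is_derive_affine; rewrite scaleN1r.
  by under [X in is_derive _ _ X _ -> _]eq_fun do rewrite mulN1r addr0.
- by move=> t /J0 Jt; rewrite normrN; exact: dyL.
Qed.

(** Integrating K L exp(2 L s) gains a factor 1/2, which is the contraction rate of the Picard
    iteration. *)
Lemma exp_majorant_ge0 m n (y dy : R -> 'M[R]_(m, n)) (L K : R) : 0 < L -> y 0 = 0 ->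
  (forall t, is_derive t (1 : R) y (dy t)) ->
  (forall t, `|dy t| <= K * L * expR (2 * L * `|t|)) ->
  forall t, 0 <= t -> `|y t| <= K / 2 * expR (2 * L * `|t|).
Proof.
move=> L0 y0 yd dyK t t0.
have := @derive_majorant _ _ y dy (fun s => K / 2 * expR (2 * L * s))
    (fun s => K / 2 * (2 * L * expR (2 * L * s))) 0 t t0.
rewrite y0 subr0 mulr0 expR0 mulr1 ger0_norm // => H.
have K0 : 0 <= K.
  have := dyK 0; rewrite normr0 mulr0 expR0 mulr1 => /(le_trans (normr_ge0 _)).
  by rewrite pmulr_lge0.
apply: le_trans (H _ _ _) _.
- by move=> s _; have := is_deriveZ (K / 2) (is_derive_expM (2 * L) s); exact.
- move=> s /andP[s0 _]; have := dyK s; rewrite ger0_norm // => /le_trans; apply.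
  by rewrite (_ : K * L * _ = K / 2 * (2 * L * expR (2 * L * s))) //; field.
- by rewrite lerBlDr lerDl divr_ge0.
Qed.

Lemma exp_majorant m n (y dy : R -> 'M[R]_(m, n)) (L K : R) : 0 < L -> y 0 = 0 ->
  (forall t, is_derive t (1 : R) y (dy t)) ->
  (forall t, `|dy t| <= K * L * expR (2 * L * `|t|)) ->
  forall t, `|y t| <= K / 2 * expR (2 * L * `|t|).
Proof.
move=> L0 y0 yd dyK t; have [t0|t0] := leP 0 t.
  exact: exp_majorant_ge0 yd dyK _ t0.
have := @exp_majorant_ge0 _ _ (fun s => y (- s)) (fun s => - dy (- s)) L K L0 _ _ _ (- t).
rewrite oppr0 opprK normrN oppr_ge0; apply; [done| | |exact: ltW].
  move=> s; have := yd (- s).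
  have {1}-> : - s = -1 * s + 0 by rewrite mulN1r addr0.
  move/is_derive_affine; rewrite scaleN1r.
  by under [X in is_derive _ _ X _ -> _]eq_fun do rewrite mulN1r addr0.
by move=> s; rewrite normrN -(normrN s); exact: dyK.
Qed.

End VectorCalculus.

(** * Existence of solutions for globally Lipschitz fields *)

Section Picard.
Variable R : realType.

Lemma near_dist_lt (V : normedModType R) (x : V) (e : R) : 0 < e ->
  \forall y \near x, `|y - x| < e.
Proof.
move=> e0; apply/nbhs_ballP; exists e => //= y.
by rewrite -ball_normE /= distrC.
Qed.

Lemma is_derive_sub (V : normedModType R) (f g : R -> V) (t : R) df dg :
  is_derive t (1 : R) f df -> is_derive t (1 : R) g dg ->
  is_derive t (1 : R) (fun s => f s - g s) (df - dg).
Proof. exact: is_deriveB. Qed.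

Lemma is_derive_add (V : normedModType R) (f g : R -> V) (t : R) df dg :
  is_derive t (1 : R) f df -> is_derive t (1 : R) g dg ->
  is_derive t (1 : R) (fun s => f s + g s) (df + dg).
Proof. exact: is_deriveD. Qed.

(** The fundamental theorem works on each half-line t > -N. The primitives vanishing at 0 agree on
    common intervals and glue. *)
Lemma antiderivative (h : R -> R) : continuous h ->
  exists H : R -> R, H 0 = 0 /\ forall t : R, is_derive t 1 H (h t).
Proof.
move=> ch; pose P (N : nat) (t : R) : R := (\int[lebesgue_measure]_(s in `[(- N%:R)%R, t]) h s)%R.
have PD (N : nat) (t : R) : - N%:R < t -> is_derive t 1 (P N) (h t).
  move=> Nt; have := @continuous_FTC1 R h (BLeft (- N%:R)) t (t + 1).
  rewrite ltrDl => /(_ ltr01) [].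
  - apply: continuous_compact_integrable; first exact: segment_compact.
    by move=> x; apply: continuous_subspaceT => y; exact: ch.
  - by rewrite ?bnd_simp ?lte_fin. 
  - exact: ch. 
  - by move=> D E; split; [exact: D|rewrite -derive1E E].
pose G N (t : R) := P N t - P N 0.
have GD (N : nat) (t : R) : - N%:R < t -> is_derive t 1 (G N) (h t).
  by move=> Nt; rewrite -(subr0 (h t)); apply: is_deriveB; exact: PD.
have GE (N M : nat) (t : R) : `|t| < N%:R -> `|t| < M%:R -> G N t = G M t.
  move=> tN tM.
  (* The difference of two primitives, read as a 1 x 1 matrix, has zero derivative and vanishes at
     0. *)
  have := @gronwall_abs R 1 1 (fun s => (G N s - G M s)%:M) (fun=> 0) 1 0 t
    [set s | `|s| < N%:R /\ `|s| < M%:R] ltr01 (lexx 0).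
  rewrite /= mul0r addr0 /G !subrr raddf0 normr0 !mulr0 mul0r normr_le0.
  rewrite -/(G N t) -/(G M t).
  move=> H; apply/eqP; rewrite -subr_eq0; apply/eqP.
  suff /eqP/matrixP/(_ 0 0) : (G N t - G M t)%:M == 0 :> 'M[R]_1 by rewrite !mxE eqxx.
  apply: H => [s st _|s [sN sM]|s _].
  - by split; exact: le_lt_trans st _.
  - apply: is_derive_mx => i j; rewrite !ord1 mxE.
    under eq_fun do rewrite mxE eqxx mulr1n.
    move: sN sM; rewrite !ltr_norml => /andP[sN _] /andP[sM _].
    by have := is_deriveB (GD N s sN) (GD M s sM); rewrite subrr; exact.
  - by rewrite addr0 mul1r normr_ge0.
exists (fun t => G (Num.truncn `|t|).+1 t); split; first by rewrite /G subrr.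
(* One unit more than needed at [t], so that the same [G N] represents the glued function on a
   neighbourhood of [t]. *)
move=> t; set N := (Num.truncn `|t|).+2.
have tN : `|t| < N.-1%:R by rewrite /= truncnS_gt.
have tN' : `|t| + 1 < N%:R by rewrite /N -natr1 ltrD2r.
apply: (@near_eq_is_derive _ _ _ (G N)); last first.
  by apply: GD; move: tN'; have := ler_norm (- t); rewrite normrN; lra.
near=> s; apply: GE; last by rewrite truncnS_gt.
apply: le_lt_trans tN'.
have : `|s - t| <= 1.
  by apply: ltW; near: s; exact: (@near_dist_lt R^o t 1 ltr01).
have := ler_normD (s - t) t; rewrite subrK; lra.
Unshelve. all: by end_near.
Qed.

Lemma antiderivative_rV n (h : R -> 'rV[R]_n) (p : 'rV[R]_n) : continuous h ->
  exists H : R -> 'rV[R]_n, H 0 = p /\ forall t : R, is_derive t (1 : R) H (h t).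
Proof.
move=> ch.
have /choice[H Hh] j : exists H : R -> R, H 0 = 0 /\ forall t : R, is_derive t 1 H (h t 0 j).
  apply: antiderivative => t.
  apply: (@continuous_comp _ _ _ h (fun M : 'rV[R]_n => M 0 j)); first exact: ch.
  exact: coord_continuous.
exists (fun t => p + \row_j H j t); split.
  by apply/rowP => j; rewrite !mxE (Hh j).1 addr0.
move=> t; apply: is_derive_mx => i j; rewrite ord1.
under eq_fun do rewrite !mxE.
have := is_deriveD (is_derive_cst (p 0 j) t (1 : R)) ((Hh j).2 t).
by rewrite add0r.
Qed.

(* Picard iterates, with the weights exp(2 L |t|) that make the iteration contract by 1/2 on all of R. *)
Lemma picard n (f : R -> 'rV[R]_n -> 'rV[R]_n) (p : 'rV[R]_n) (L M : R) : 0 < L ->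
  (forall t x y, `|f t x - f t y| <= L * `|x - y|) ->
  (forall c : R -> 'rV[R]_n, continuous c -> continuous (fun t => f t (c t))) ->
  (forall t, `|f t p| <= M) ->
  exists c : R -> 'rV[R]_n, c 0 = p /\ forall t : R, is_derive t (1 : R) c (f t (c t)).
Proof.
move=> L0 lipf cf fM.
(* On a discontinuous [c] the value [c] is a dummy, making [Pic] total so that it can be
   iterated. *)
have /choice[Pic PicP] (c : R -> 'rV[R]_n) : exists d : R -> 'rV[R]_n, continuous c ->
    d 0 = p /\ forall t : R, is_derive t (1 : R) d (f t (c t)).
  have [cc|ncc] := pselect (continuous c); last by exists c.
  by have [d dP] := antiderivative_rV p (cf c cc); exists d.
have PicC c : continuous c -> continuous (Pic c).
  by move=> cc t; have [_ /(_ t)/is_derive_continuous] := PicP c cc.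
have Pic_contract c d K : continuous c -> continuous d ->
    (forall t, `|c t - d t| <= K * expR (2 * L * `|t|)) ->
    forall t, `|Pic c t - Pic d t| <= K / 2 * expR (2 * L * `|t|).
  move=> cc cd cdK; have [c0 dc] := PicP c cc; have [d0 dd] := PicP d cd.
  apply: (@exp_majorant R _ _ (fun t => Pic c t - Pic d t)
    (fun t => f t (c t) - f t (d t)) L K L0).
  - by rewrite c0 d0 subrr.
  - move=> t; apply: le_trans (lipf _ _ _) _.
    by rewrite mulrAC [leRHS]mulrC ler_pM2l.
pose u k := iter k Pic (fun=> p).
have uC k : continuous (u k).
  by elim: k => [|k IH]; [move=> t; exact: cvg_cst|exact: PicC].
pose B := M / L / 2.
have uS k t : `|u k.+1 t - u k t| <= B * (2^-1) ^+ k * expR (2 * L * `|t|).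
  elim: k t => [|k IH] t.
    rewrite expr0 mulr1; have [c0 dc] := PicP (fun=> p) (uC 0%N).
    apply: (@exp_majorant R _ _ (fun t => u 1%N t - p) (fun t => f t p) L (M / L) L0) => //.
    - by rewrite /= c0 subrr.
      - by move=> s; rewrite -(subr0 (f s p)); exact: is_derive_sub (dc s) (is_derive_cst _ _ _).
    - move=> s; rewrite divfK ?gt_eqF //; apply: le_trans (fM s) _.
      rewrite ler_peMr //; first by apply: le_trans (fM s).
      by rewrite -expR0 ler_expR !mulr_ge0 // ltW.
  rewrite (_ : B * _ * _ = (B * 2^-1 ^+ k) / 2 * expR (2 * L * `|t|)); last by rewrite exprS; field.
  exact: (Pic_contract (u k.+1) (u k) _ (uC k.+1) (uC k) IH).
have M0 : 0 <= M := le_trans (normr_ge0 _) (fM 0).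
have B0 : 0 <= B by rewrite !divr_ge0 // ltW.
have uD k m t : `|u (k + m)%N t - u k t| <= 2 * B * (2^-1) ^+ k * expR (2 * L * `|t|).
  suff : `|u (k + m)%N t - u k t| <= 2 * B * (2^-1) ^+ k * (1 - 2^-1 ^+ m) * expR (2 * L * `|t|).
    move/le_trans; apply; rewrite ler_wpM2r ?expR_ge0 // ler_piMr //.
    by apply: mulr_ge0; [exact: mulr_ge0|apply: exprn_ge0; rewrite invr_ge0].
  elim: m => [|m IH]; first by rewrite addn0 !subrr normr0 mulr0 mul0r.
  rewrite addnS -(subrKA (u (k + m)%N t)); apply: le_trans (ler_normD _ _) _.
  apply: le_trans (lerD (uS _ _) IH) _.
  rewrite exprD exprS -mulrDl ler_wpM2r ?expR_ge0 //.
  by move: (2^-1 ^+ k) (2^-1 ^+ m) => a b; rewrite (_ : _ + _ = 2 * B * a * (1 - 2^-1 * b)) //; field.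
have pow0 (C e : R) : 0 < e -> exists k, C * (2^-1) ^+ k < e.
  move=> e0; have : C * (2^-1) ^+ k @[k --> \oo] --> C * 0.
    by apply: cvgM; [exact: cvg_cst|apply: cvg_expr; rewrite ger0_norm // invf_lt1 // ltr1n].
  rewrite mulr0 => /cvgrPdist_lt/(_ e e0)[N _ /(_ N (leqnn _))] /=.
  by rewrite sub0r normrN => /(le_lt_trans (ler_norm _)); exists N.
have ucvg (s : R) : cvg (u k s @[k --> \oo]).
  apply/cauchy_cvgP/cauchy_exP => e e0.
  have [k ke] := pow0 (2 * B * expR (2 * L * `|s|)) e e0.
  exists (u k s); exists k => // m /= km; rewrite -ball_normE /= distrC -(subnKC km).
  by apply: le_lt_trans (uD _ _ _) _; rewrite mulrAC.
pose c t := lim (u k t @[k --> \oo]).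
have cu k t : `|c t - u k t| <= 2 * B * (2^-1) ^+ k * expR (2 * L * `|t|).
  have H : `|u m t - u k t| @[m --> \oo] --> `|c t - u k t|.
    by apply: cvg_norm; apply: cvgB; [exact: ucvg|exact: cvg_cst].
  rewrite -(cvg_lim _ H) //; apply: limr_le; first by apply/cvg_ex; eexists; exact: H.
  by exists k => // m /= km; rewrite -(subnKC km); exact: uD.
have cC : continuous c.
  move=> t; apply/cvgrPdist_le => e e0.
  have e30 : 0 < e / 3 by rewrite divr_gt0.
  have [k ke] := pow0 (2 * B * expR (2 * L * (`|t| + 1))) (e / 3) e30.
  have near_u s : `|s| <= `|t| + 1 -> `|c s - u k s| <= e / 3.
    move=> st; apply: le_trans (cu _ _) _; apply: le_trans (ltW ke).
    rewrite [leRHS]mulrAC; apply: ler_wpM2l.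
      by apply: mulr_ge0; [exact: mulr_ge0|apply: exprn_ge0; rewrite invr_ge0].
    by rewrite ler_expR ler_pM2l // mulr_gt0.
  near=> s.
  have st : `|s| <= `|t| + 1.
    have : `|s - t| <= 1 by apply: ltW; near: s; exact: (@near_dist_lt R^o t 1 ltr01).
    by have := ler_normD (s - t) t; rewrite subrK; lra.
  have uts : `|u k t - u k s| <= e / 3 by near: s; have /cvgrPdist_le := uC k t; exact.
  have -> : c t - c s = (c t - u k t) + (u k t - u k s) - (c s - u k s).
    by rewrite !opprB !addrA !subrK.
  apply: le_trans (ler_normB _ _) _; apply: le_trans (lerD (ler_normD _ _) (lexx _)) _.
  have := near_u s st; have := near_u t; rewrite lerDl ler01 => /(_ isT); lra.
exists c; have [c0 dc] := PicP c cC.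
(* [Pic c] and [c] are both within a multiple of 2^-k of [u k.+1], for every [k]. *)
suff E : Pic c = c by rewrite -{1 2}E.
apply/funext => t; apply/eqP; rewrite -subr_eq0 -normr_le0 leNgt; apply/negP => ct0.
have [k] := pow0 (2 * B * expR (2 * L * `|t|)) _ ct0; apply/negP; rewrite -leNgt.
have H := Pic_contract c (u k) _ cC (uC k) (cu k) t.
rewrite -(subrKA (u k.+1 t)); apply: le_trans (ler_normD _ _) _.
apply: le_trans (lerD H _) _; first by rewrite distrC; exact: cu.
rewrite exprS; move: (2^-1 ^+ k) (expR _) => a b.
by rewrite (_ : _ + _ = 2 * B * b * a) //; field.
Unshelve. all: by end_near.
Qed.

End Picard.

(** * Tubes around trajectories: uniqueness and dependence on the initial point *)

Section Tubes.
Variable R : realType.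

(** Compactness is used as a near-covering property for the filter of large [k]: monotonicity turns
    each local constant into all larger ones, and one constant then serves all of [K]. *)
Lemma compact_uniform (X : topologicalType) (K : set X) (P : R -> X -> Prop) : compact K ->
  (forall k k' x, k <= k' -> P k x -> P k' x) ->
  (forall x, K x -> exists k, \forall x' \near x, P k x') ->
  exists2 k, 0 < k & forall x, K x -> P k x.
Proof.
move=> cK mono loc.
have : \forall k \near +oo, K `<=` P k.
  apply: ((compact_near_coveringP K).1 cK R (pinfty_nbhs R) P) => x Kx.
  have [k xk] := loc x Kx.
  exists ([set x' | P k x'], [set k' | k <= k']); first by split=> //=; exact/nbhs_pinfty_ge/num_real.
  by move=> [x' k'] /= [Pkx' kk']; exact: mono Pkx'.
case=> M [Mr KM]; exists (`|M| + 1); first by rewrite ltr_wpDl.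
by apply: KM; rewrite ltr_pwDr // ler_norm.
Qed.

(** Bootstrap: at the first time at which [phi] reaches [r] it has stayed at most [r] so far, and
    [step] makes it smaller than [r] there. *)
Lemma continuation (phi : R -> R) (r T : R) : 0 <= T -> phi 0 < r ->
  (forall t, 0 <= t <= T -> {for t, continuous phi}) ->
  (forall t, 0 <= t <= T -> (forall s, 0 <= s <= t -> phi s <= r) -> phi t < r) ->
  forall t, 0 <= t <= T -> phi t < r.
Proof.
move=> T0 phi0 cphi step t tT; rewrite ltNge; apply/negP => rt.
pose A := [set s | 0 <= s <= T /\ r <= phi s].
pose s0 := inf A.
have A0 : A !=set0 by exists t.
have lbA : lbound A 0 by move=> s [/andP[]].
have s0ge : 0 <= s0 by apply: lb_le_inf.
have s0le s : A s -> s0 <= s.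
  by move=> As; apply: ge_inf => //; exists 0.
have below s : 0 <= s < s0 -> phi s < r.
  move=> /andP[sge slt]; rewrite ltNge; apply/negP => rs.
  have : s0 <= s.
    apply: (s0le s); split=> //; rewrite sge /= ltW //.
    by apply: lt_le_trans slt _; apply: le_trans (s0le t (conj tT rt)) _; case/andP: tT.
  by rewrite leNgt slt.
have s0T : 0 <= s0 <= T.
  by rewrite s0ge (le_trans (s0le t (conj tT rt))) //; case/andP: tT.
have cs0 : {within `[0, s0], continuous phi}.
  apply: continuous_in_subspaceT => s; rewrite inE /= in_itv /= => /andP[sge sle].
  by apply: cphi; rewrite sge (le_trans sle) //; case/andP: s0T.
have [lt0|rs0] := ltP (phi s0) r.
  have /nbhs_ballP[e /= e0 eP] : \forall s \near s0, phi s < r.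
    exact: (cvgr_lt _ (cphi s0 s0T)).
  have hA : has_inf A by split=> //; exists 0.
  have [s As se] := inf_adherent e0 hA.
  have := eP s; rewrite /ball /= distrC ger0_norm ?subr_ge0 ?s0le // ltrBlDl => /(_ se).
  by case: As => _; rewrite leNgt => /negbTE ->.
(* The value [r] is attained at or before [s0]; since [phi] is below [r] earlier, it is attained
   exactly at [s0]. *)
have [] := @IVT R phi 0 s0 r s0ge cs0.
  by rewrite ge_min le_max rs0 (ltW phi0) orbT.
move=> s; rewrite in_itv /= => /andP[s_ge s_le] phis.
have ss0 : s = s0.
  apply/eqP; rewrite eq_le s_le (s0le s) //; split; last by rewrite phis.
  by rewrite s_ge (le_trans s_le) //; case/andP: s0T.
have : phi s0 < r.
  apply: step => // u /andP[u0]; rewrite le_eqVlt => /orP[/eqP->|us]; first by rewrite -ss0 phis.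
  by apply/ltW/below; rewrite u0.
by rewrite -ss0 phis ltxx.
Qed.

End Tubes.

Section Jacobian.
Variable R : realType.

(** Built from partial derivatives, it is linear in [v] by construction, while directional
    derivatives are linear only for [Ck 1] maps, where both agree. *)
Definition jac n m (f : 'rV[R]_n -> 'rV[R]_m) (x v : 'rV[R]_n) : 'rV[R]_m :=
  \sum_j v 0 j *: 'D_(delta_mx 0 j) f x.

Lemma jacB n m (f : 'rV[R]_n -> 'rV[R]_m) x u v : jac f x (u - v) = jac f x u - jac f x v.
Proof. by rewrite /jac -sumrB; apply: eq_bigr => j _; rewrite !mxE scalerBl. Qed.

Lemma jacZ n m (f : 'rV[R]_n -> 'rV[R]_m) x a v : jac f x (a *: v) = a *: jac f x v.
Proof. by rewrite /jac scaler_sumr; apply: eq_bigr => j _; rewrite !mxE scalerA. Qed.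

Lemma jac_norm n m (f : 'rV[R]_n -> 'rV[R]_m) x v :
  `|jac f x v| <= (\sum_j `|'D_(delta_mx 0 j) f x|) * `|v|.
Proof.
apply: le_trans (ler_norm_sum _ _ _) _; rewrite mulr_suml; apply: ler_sum => j _.
by rewrite normrZ mulrC ler_wpM2l // mx_norm_coord.
Qed.

Lemma jac_strict n m (O : set 'rV[R]_n) (f : 'rV[R]_n -> 'rV[R]_m) x : open O -> O x -> Ck 1 O f ->
  forall e : R, 0 < e -> exists2 r : R, 0 < r & forall y z, `|y - x| < r -> `|z - x| < r ->
    `|f y - f z - jac f x (y - z)| <= e * `|y - z|.
Proof.
move=> oO Ox Cf e e0; have Ci := (Ck_mx 1 f oO).1 Cf.
have df v : derivable f x v by have [_ /(_ v)[+ _]] := Cf; exact.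
have /choice[r rP] i : exists r : R, 0 < r /\ forall y z, `|y - x| < r -> `|z - x| < r ->
    `|f y 0 i - f z 0 i - \sum_j (y - z) 0 j * ('D_(delta_mx 0 j) f x) 0 i| <= e * `|y - z|.
  have [r r0 rP] := C1_strict oO Ox (Ci 0 i) e0; exists r; split=> // y z yr zr.
  apply: le_trans (rP y z yr zr); rewrite le_eqVlt; apply/orP; left; apply/eqP; congr `|_ - _|.
  by apply: eq_bigr => j _; rewrite derive_mx ?mxE.
(* The unit 1 of the minimum keeps the radius positive even when there are no coordinates. *)
exists (\big[Num.min/1]_i r i); first by apply/bigmin_gtP; split=> // i _; exact: (rP i).1.
move=> y z yr zr; apply: mx_norm_le => [|a i]; first by rewrite mulr_ge0 // ltW.
have le_r w : w < \big[Num.min/1]_i r i -> w < r i by move/lt_le_trans; apply; exact: bigmin_le.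
apply: le_trans ((rP i).2 y z (le_r _ yr) (le_r _ zr)); rewrite ord1 !mxE.
rewrite (_ : jac f x (y - z) 0 i = \sum_j (y - z) 0 j * ('D_(delta_mx 0 j) f x) 0 i) //.
by rewrite /jac summxE; apply: eq_bigr => j _; rewrite mxE.
Qed.

End Jacobian.

Section FlowNear.
Variables (R : realType) (n : nat).
Implicit Types (O : set 'rV[R]_n) (f : 'rV[R]_n -> 'rV[R]_n) (c : R -> 'rV[R]_n).

Lemma lipschitz_continuous (V W : normedModType R) (g : V -> W) (k : R) :
  (forall x y, `|g x - g y| <= k * `|x - y|) -> continuous g.
Proof.
move=> lg x; apply/cvgrPdist_lt => e e0; near=> y.
apply: le_lt_trans (lg x y) _; apply: (@le_lt_trans _ _ (`|k| * `|x - y|)).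
  by rewrite ler_wpM2r // ler_norm.
have k1 : 0 < `|k| + 1 by rewrite ltr_wpDl.
apply: (@le_lt_trans _ _ ((`|k| + 1) * `|x - y|)); first by rewrite ler_wpM2r // lerDl.
rewrite mulrC -ltr_pdivlMr // distrC; near: y; apply: near_dist_lt; exact: divr_gt0.
Unshelve. all: by end_near.
Qed.

Definition clamp (a b x : R) := Num.max a (Num.min b x).

Lemma clamp_lip a b x y : `|clamp a b x - clamp a b y| <= `|x - y|.
Proof.
have := ler_norm (x - y); have := ler_norm (- (x - y)); rewrite normrN /clamp !minEle !maxEle.
by do 2?[case: (leP b x) => ?]; do 2?[case: (leP b y) => ?]; do 4?[case: ifPn; rewrite -?ltNge => ?];
  move=> ? ?; rewrite ?subrr ?normr0 // ler_norml; apply/andP; split; lra.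
Qed.

Lemma clamp_id a b x : a <= x <= b -> clamp a b x = x.
Proof. by move=> /andP[ax xb]; rewrite /clamp min_r // max_r. Qed.

Lemma clamp_itv a b x : a <= b -> a <= clamp a b x <= b.
Proof. by move=> ab; rewrite le_max lexx /= ge_max ab ge_min lexx. Qed.

Lemma clamp_norm r x : 0 <= r -> `|clamp (- r) r x| <= r.
Proof. by move=> r0; rewrite ler_norml; apply: clamp_itv; lra. Qed.

(** A retraction onto the ball of radius [r]; it is 1-Lipschitz because the norm is the maximum
    norm. *)
Definition clampv (r : R) (x : 'rV[R]_n) : 'rV[R]_n := \row_j clamp (- r) r (x 0 j).

Lemma clampv_lip r x y : `|clampv r x - clampv r y| <= `|x - y|.
Proof.
apply: mx_norm_le => // i j; rewrite ord1 !mxE; apply: le_trans (clamp_lip _ _ _ _) _.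
by have := mx_norm_coord (x - y) 0 j; rewrite !mxE.
Qed.

Lemma clampv_id r x : `|x| <= r -> clampv r x = x.
Proof.
move=> xr; apply/rowP => j; rewrite mxE; apply: clamp_id.
by rewrite -ler_norml (le_trans (mx_norm_coord _ _ _)).
Qed.

Lemma clampv_norm r x : 0 <= r -> `|clampv r x| <= r.
Proof. by move=> r0; apply: mx_norm_le => // i j; rewrite mxE; exact: clamp_norm. Qed.

(** A single [k] is a bound for the field along [c], a Lipschitz constant in the tube and the
    inverse of its radius. In this form the statement is monotone in [k] and becomes uniform by
    compactness. *)
Lemma flow_tube O f c (al be : R) : open O -> Ck 1 O f ->
  (forall t, al <= t <= be -> O (c t) /\ {for t, continuous c}) ->
  exists2 k, 0 < k & forall t, al <= t <= be -> `|f (c t)| <= k /\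
    forall y z, `|y - c t| <= k^-1 -> `|z - c t| <= k^-1 -> O y /\ `|f y - f z| <= k * `|y - z|.
Proof.
move=> oO Cf cO.
pose P (k t : R) := 0 < k /\ (`|f (c t)| <= k /\
    forall y z, `|y - c t| <= k^-1 -> `|z - c t| <= k^-1 -> O y /\ `|f y - f z| <= k * `|y - z|).
have [||k k0 kP] := @compact_uniform R R `[al, be] P (@segment_compact _ _ _).
- move=> k k' t kk' [k0 [fk lipf]]; have k'0 : 0 < k' by apply: lt_le_trans kk'.
  have kV : k'^-1 <= k^-1 by rewrite lef_pV2.
  split=> //; split=> [|y z yk zk]; first exact: le_trans kk'.
  have [||Oy fyz] := lipf y z; [exact: le_trans kV|exact: le_trans kV|].
  by split=> //; apply: le_trans fyz _; rewrite ler_wpM2r.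
- move=> t; rewrite /= in_itv /= => /cO [Ot ct].
  set x := c t in Ot.
  have [r r0 rP] := jac_strict oO Ot Cf ltr01.
  have /nbhs_ballP[r' /= r'0 r'O] := open_nbhs_nbhs (conj oO Ot).
  pose L := \sum_j `|'D_(delta_mx 0 j) f x|.
  have L0 : 0 <= L by apply: sumr_ge0.
  pose r2 := Num.min r r'; have r20 : 0 < r2 by rewrite lt_min r0.
  (* [L + 1] is the Lipschitz constant given by strict differentiability, [2 / r2] makes 1/k less
     than r2 / 2, and the last term bounds [f] near [x]. *)
  pose k := L + 1 + 2 / r2 + (`|f x| + 1).
  have r2k : 2 / r2 < k by rewrite /k; have := normr_ge0 (f x); move: L0; lra.
  have k0 : 0 < k by apply: lt_trans r2k; exact: divr_gt0.
  have kr : k^-1 < r2 / 2 by rewrite -(invrK (r2 / 2)) ltf_pV2 ?posrE ?invr_gt0 ?divr_gt0 // invf_div.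
  exists k.
  have H1 : \forall s \near t, `|c s - x| < r2 / 2.
    have /cvgrPdist_lt/(_ (r2 / 2)) := ct; rewrite divr_gt0 // => /(_ isT).
    by apply: filterS => s; rewrite distrC.
  have H2 : \forall s \near t, `|f (c s)| <= `|f x| + 1.
    have fx : {for c t, continuous f} by have [+ _] := Cf; exact.
    have /cvgrPdist_le/(_ 1 ltr01) := @continuous_comp _ _ _ c f t ct fx.
    apply: filterS => s /=; rewrite distrC => H.
    by rewrite -(subrK (f x) (f (c s))) (le_trans (ler_normD _ _)) // addrC lerD2l.
  apply: filterS2 H1 H2 => s cs fcs; split=> //.
  have near_x y : `|y - c s| <= k^-1 -> `|y - x| < r2.
    move=> yk; rewrite -(subrKA (c s)); apply: le_lt_trans (ler_normD _ _) _.
    by have := le_lt_trans yk kr; move: cs; lra.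
  have lt_r y : `|y - x| < r2 -> `|y - x| < r by rewrite lt_min => /andP[].
  have inO y : `|y - x| < r2 -> O y.
    by rewrite lt_min => /andP[_ yr']; apply: r'O; rewrite -ball_normE /= distrC.
  have lip y z : `|y - x| < r2 -> `|z - x| < r2 -> `|f y - f z| <= (L + 1) * `|y - z|.
    move=> /lt_r yr /lt_r zr; have := rP y z yr zr; rewrite mul1r mulrDl mul1r => H.
    rewrite -(subrK (jac f x (y - z)) (f y - f z)); apply: le_trans (ler_normD _ _) _.
    by rewrite addrC; apply: lerD => //; exact: jac_norm.
  split=> [|y z /near_x yx /near_x zx].
    by apply: le_trans fcs _; have := divr_gt0 (ltr0Sn R 1) r20; rewrite /k; move: L0; lra.
  split; first exact: inO.
  apply: le_trans (lip _ _ yx zx) _; rewrite ler_wpM2r // /k.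
  have := divr_gt0 (ltr0Sn R 1) r20; have := normr_ge0 (f x); lra.
by exists k => // t tab; apply: (kP t _).2; rewrite /= in_itv.
Qed.

End FlowNear.

Section Flow.
Variables (R : realType) (n : nat).
Implicit Types (O : set 'rV[R]_n) (f : 'rV[R]_n -> 'rV[R]_n) (c d : R -> 'rV[R]_n).

Definition integral_curve O f (a b : R) c :=
  forall t : R, a <= t <= b -> O (c t) /\ is_derive t (1 : R) c (f (c t)).

Lemma integral_curve_sub O f a b a' b' c : a <= a' -> b' <= b ->
  integral_curve O f a b c -> integral_curve O f a' b' c.
Proof.
by move=> aa bb Ic t /andP[at_ tb]; apply: Ic; rewrite (le_trans aa) //= (le_trans tb).
Qed.

(* Outside the tube of radius k^-1 around c the vector field is frozen, so that it
   becomes globally Lipschitz and picard applies; Gronwall keeps d inside the tube. *)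
Lemma flow_near O f c (a b : R) : open O -> Ck 1 O f -> a <= 0 <= b -> integral_curve O f a b c ->
  exists de C : R, [/\ 0 < de, 0 < C & forall q, `|q - c 0| < de -> exists d,
    [/\ d 0 = q, integral_curve O f a b d &
        forall t, a <= t <= b -> `|d t - c t| <= C * `|q - c 0|]].
Proof.
move=> oO Cf /andP[a0 b0] Ic; have ab := le_trans a0 b0.
have cc t : a <= t <= b -> {for t, continuous c} by move=> /Ic[_ /is_derive_continuous].
have [t tab|k k0 kP] := @flow_tube R n O f c a b oO Cf.
  by split; [exact: (Ic t tab).1|exact: cc].
(* [C] is the Gronwall constant over [a, b]; a start within k^-1 / C of [c 0] keeps [d] in the
   tube. *)
pose T := Num.max (- a) b; pose C := 2 * expR (2 * k * T).
have C0 : 0 < C by rewrite mulr_gt0 // expR_gt0.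
exists (k^-1 / C), C; split=> // [|q qc]; first by rewrite divr_gt0 ?invr_gt0.
have kV0 : 0 <= k^-1 by rewrite invr_ge0 ltW.
pose tau := clamp a b; have tauab t : a <= tau t <= b by exact: clamp_itv.
have ctau : continuous (fun t => c (tau t)).
  move=> t; apply: (@continuous_comp _ _ _ tau c); last exact: cc.
  by apply: (@lipschitz_continuous R R R tau 1) => x y; rewrite mul1r; exact: clamp_lip.
pose g t x := c (tau t) + clampv k^-1 (x - c (tau t)).
have gE t x : `|g t x - c (tau t)| <= k^-1 by rewrite /g addrC addKr; exact: clampv_norm.
have glip t x y : `|g t x - g t y| <= `|x - y|.
  rewrite /g opprD addrACA subrr add0r.
  by apply: le_trans (clampv_lip _ _ _) _; rewrite opprB addrA subrK.
have cg d : continuous d -> continuous (fun t => g t (d t)).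
  move=> cd t; apply: cvgD; first exact: ctau.
  apply: (@continuous_comp _ _ _ (fun t => d t - c (tau t)) (clampv k^-1)).
    by apply: cvgB; [exact: cd|exact: ctau].
  by apply: (@lipschitz_continuous _ _ _ _ 1) => x y; rewrite mul1r; exact: clampv_lip.
have cV0 : `|0 : 'rV[R]_n| <= k^-1 by rewrite normr0.
have [|d Od|t|d [d0 dd]] := @picard R n (fun t x => f (g t x)) q k (k + k * k^-1) k0.
- move=> t x y; have [_ /(_ _ _ (gE t x) (gE t y))[_ /le_trans]] := kP _ (tauab t).
  by apply; rewrite ler_pM2l.
- move=> t; apply: (@continuous_comp _ _ _ (fun t => g t (d t)) f); first exact: cg.
  have [_ /(_ _ _ (gE t (d t)) (gE t (d t)))[Og _]] := kP _ (tauab t).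
  by have [+ _] := Cf; exact.
- have [fk] := kP _ (tauab t); have cc0 : `|c (tau t) - c (tau t)| <= k^-1 by rewrite subrr normr0.
  move=> /(_ _ _ (gE t q) cc0)[_ fg].
  rewrite -(subrK (f (c (tau t))) (f _)); apply: le_trans (ler_normD _ _) _; rewrite addrC lerD //.
  by apply: le_trans fg _; rewrite ler_pM2l.
exists d; have dc t : a <= t <= b -> `|d t - c t| <= C * `|q - c 0|.
  move=> tab; have tT : `|t| <= T.
    by case/andP: tab => ? ?; rewrite le_max; have [t0|t0] := leP 0 t;
       [rewrite ger0_norm //; apply/orP; right|rewrite ltr0_norm //; apply/orP; left; lra].
  have := @gronwall_abs R _ _ (fun s => d s - c s) (fun s => f (g s (d s)) - f (c s)) k 0 t
    [set s | a <= s <= b] k0 (lexx 0).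
  rewrite mul0r addr0 d0 mulrAC => H.
  apply: le_trans (H _ _ _) _.
  - move=> s st sT; case/andP: tab => ta tb; apply/andP.
    have [s0|s0] := leP 0 s; have [t0|t0] := leP 0 t.
    + by split; [exact: le_trans s0|move: st; rewrite !ger0_norm // => /le_trans; apply].
    + by move: st sT; rewrite ger0_norm // ltr0_norm // => st sT; split; nra.
    + move: st sT; rewrite ltr0_norm // ger0_norm // => st sT; split; nra.
    + by split; [move: st; rewrite !ltr0_norm // lerN2; exact: le_trans|apply: le_trans (ltW s0) b0].
  - by move=> s /Ic[_ cs]; exact: is_derive_sub.
  - move=> s sab; rewrite addr0; have tauE : tau s = s by exact: clamp_id.
    have [_ /(_ (g s (d s)) (c s))] := kP _ (tauab s).
    rewrite tauE subrr normr0 => /(_ _ kV0)[|_ /le_trans]; first by rewrite -[X in _ - c X]tauE.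
    apply; rewrite ler_pM2l //;
    rewrite /g tauE addrC addKr.
    have := clampv_lip k^-1 (d s - c s) 0; rewrite subr0 (clampv_id cV0) subr0; exact.
  by rewrite /C ler_wpM2r // ler_pM2l // ler_expR ler_pM2l // mulr_gt0.
split=> // t tab; have tauE : tau t = t by exact: clamp_id.
have dck : `|d t - c t| <= k^-1.
  apply: le_trans (dc t tab) _; rewrite -ler_pdivlMl // mulrC; exact: ltW.
have gd : g t (d t) = d t by rewrite /g tauE clampv_id // addrC subrK.
split; last by have := dd t; rewrite gd.
have [_ /(_ (d t) (d t))] := kP t tab; case=> //.
Qed.

(** The field is Lipschitz only in a tube around [c]. While [d] stays there, Gronwall makes the
    difference 0, so by [continuation] [d] never leaves the tube. *)
Lemma flow_unique O f c d (T : R) : open O -> Ck 1 O f -> 0 <= T ->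
  integral_curve O f 0 T c -> integral_curve O f 0 T d -> c 0 = d 0 -> c T = d T.
Proof.
move=> oO Cf T0 Ic Id cd0.
have [t tab|k k0 kP] := @flow_tube R n O f c 0 T oO Cf.
  by have [? /is_derive_continuous] := Ic t tab.
have kV0 : 0 < k^-1 by rewrite invr_gt0.
have dcD t : 0 <= t <= T -> is_derive t (1 : R) (fun s => d s - c s) (f (d t) - f (c t)).
  by move=> tT; have [[_ ?] [_ ?]] := (Ic t tT, Id t tT); exact: is_derive_sub.
have small t : 0 <= t <= T -> (forall s, 0 <= s <= t -> `|d s - c s| <= k^-1) -> `|d t - c t| <= 0.
  move=> /andP[t0 tT] sk.
  have := @gronwall R _ _ (fun s => d s - c s) (fun s => f (d s) - f (c s)) k 0 t k0 (lexx 0) t0.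
  rewrite -cd0 subrr normr0 mul0r addr0 mulr0 mul0r; apply.
  - by move=> s /andP[s0 st]; apply: dcD; rewrite s0 (le_trans st).
  - move=> s /andP[s0 st]; rewrite addr0.
    have sT : 0 <= s <= T by rewrite s0 (le_trans st).
    have [_ H] := kP s sT; apply: (H (d s) (c s) _ _).2; first by apply: sk; rewrite s0.
    by rewrite subrr normr0 ltW.
have lt_k := @continuation R (fun t => `|d t - c t|) k^-1 T T0.
apply/eqP; rewrite eq_sym -subr_eq0 -normr_le0; apply: (small T); first by rewrite T0 lexx.
move=> s sT; apply/ltW/lt_k => //; first by rewrite -cd0 subrr normr0.
- by move=> t /dcD/is_derive_continuous; exact: cvg_norm.
- by move=> t tT /(small t tT)/le_lt_trans; apply.
Qed.

End Flow.

Lemma cvg_bigsum (R : numFieldType) (V : normedModType R) T (F : set_system T) (I : Type)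
    (r : seq I) (f : I -> T -> V) (l : I -> V) : Filter F ->
  (forall i, f i x @[x --> F] --> l i) ->
  \sum_(i <- r) f i x @[x --> F] --> \sum_(i <- r) l i.
Proof.
move=> FF fl; elim: r => [|i r IH].
  by under eq_fun do rewrite big_nil; rewrite big_nil; exact: cvg_cst.
by under eq_fun do rewrite big_cons; rewrite big_cons; exact: cvgD.
Qed.

Lemma continuous_bigsum (R : numFieldType) (V : normedModType R) (T : topologicalType) (I : Type)
    (r : seq I) (f : I -> T -> V) (x : T) :
  (forall i, {for x, continuous (f i)}) -> {for x, continuous (fun t => \sum_(i <- r) f i t)}.
Proof. by move=> fx; apply: (@cvg_bigsum _ _ _ _ _ r f (fun i => f i x)). Qed.

(** * Differentiability and smoothness of flows *)

Section FlowDerivative.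
Variables (R : realType) (n : nat).
Implicit Types (O : set 'rV[R]_n) (f : 'rV[R]_n -> 'rV[R]_n) (c d : R -> 'rV[R]_n).

(** The margins [a < 0] and [1 < b] match those in [exp_rel]. *)
Definition flow_dom O f : set 'rV[R]_n := [set p | exists (a b : R) c,
  [/\ a < 0, 1 < b, integral_curve O f a b c & c 0 = p]].

Definition flow_end O f (p : 'rV[R]_n) : 'rV[R]_n := xget 0 [set q | exists (a b : R) c,
  [/\ a < 0, 1 < b, integral_curve O f a b c & c 0 = p /\ c 1 = q]].

Lemma flow_endE O f a b c : open O -> Ck 1 O f -> a < 0 -> 1 < b ->
  integral_curve O f a b c -> flow_end O f (c 0) = c 1.
Proof.
move=> oO Cf a0 b1 Ic; rewrite /flow_end; case: xgetP => [q _|/(_ (c 1)) []]; last by exists a, b, c.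
move=> [a' [b' [d [a'0 b'1 Id [dc0 <-]]]]].
apply: (flow_unique oO Cf ler01) dc0; first exact: integral_curve_sub (ltW a'0) (ltW b'1) Id.
exact: integral_curve_sub (ltW a0) (ltW b1) Ic.
Qed.

Lemma flow_dom_open O f : open O -> Ck 1 O f -> open (flow_dom O f).
Proof.
move=> oO Cf; rewrite openE => p [a [b [c [a0 b1 Ic c0]]]].
have ab : a <= 0 <= b by rewrite (ltW a0) ltW // (lt_trans ltr01).
have [de [C [de0 C0 near_q]]] := flow_near oO Cf ab Ic.
apply/nbhs_ballP; exists de => //= q; rewrite -ball_normE /= distrC -c0 => /near_q[d [d0 Id _]].
by exists a, b, d.
Qed.

Lemma jac_continuous O f c : open O -> Ck 1 O f ->
  (forall t, O (c t)) -> continuous c -> forall d, continuous d -> continuous (fun t => jac f (c t) (d t)).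
Proof.
move=> oO Cf Oc cc d cd t; rewrite /jac.
apply: continuous_bigsum => j; apply: cvgZ.
  apply: (@continuous_comp _ _ _ d (fun M : 'rV[R]_n => M 0 j)); first exact: cd.
  exact: coord_continuous.
have [_ /(_ (delta_mx 0 j))[_ [+ _]]] := Cf => /(_ (c t) (Oc t)) Dc.
exact: (@continuous_comp _ _ _ c (fun x => 'D_(delta_mx 0 j) f x) t (cc t) Dc).
Qed.

(** Strict differentiability at [c t] also gives the expansion at nearby points [c s], with the
    Jacobian taken at [c t]; continuity of the partial derivatives replaces it by the one at [c s].
    Each costs e / 2. *)
Lemma jac_strict_along O f c (a b e : R) : open O -> Ck 1 O f ->
  (forall t, a <= t <= b -> O (c t) /\ {for t, continuous c}) -> 0 < e ->
  exists2 k, 0 < k & forall t, a <= t <= b -> forall y, `|y - c t| <= k^-1 ->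
    `|f y - f (c t) - jac f (c t) (y - c t)| <= e * `|y - c t|.
Proof.
move=> oO Cf cO e0.
pose P (k t : R) := 0 < k /\ forall y, `|y - c t| <= k^-1 ->
    `|f y - f (c t) - jac f (c t) (y - c t)| <= e * `|y - c t|.
have [||k k0 kP] := @compact_uniform R R `[a, b] P (@segment_compact _ _ _).
- move=> k k' t kk' [k0 kP]; have k'0 : 0 < k' by apply: lt_le_trans kk'.
  by split=> // y yk; apply/kP/(le_trans yk); rewrite lef_pV2.
- move=> t; rewrite /= in_itv /= => /cO [Ot ct]; set x := c t in Ot.
  have e20 : 0 < e / 2 by rewrite divr_gt0.
  have [r r0 rP] := jac_strict oO Ot Cf e20.
  have r20 : 0 < r / 2 by rewrite divr_gt0.
  exists (2 / r + 1).
  have k0 : 0 < 2 / r + 1 by rewrite ltr_wpDl // divr_ge0 // ltW.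
  have kr : (2 / r + 1)^-1 <= r / 2.
    by rewrite -(invrK (r / 2)) lef_pV2 ?posrE ?invr_gt0 // invf_div lerDl.
  have H1 : \forall s \near t, `|c s - x| < r / 2.
    by have /cvgrPdist_lt/(_ (r / 2) r20) := ct; apply: filterS => s; rewrite distrC.
  have H2 : \forall s \near t, (\sum_j `|'D_(delta_mx 0 j) f (c s) - 'D_(delta_mx 0 j) f x|) < e / 2.
    suff HS : (\sum_j `|'D_(delta_mx 0 j) f (c s) - 'D_(delta_mx 0 j) f x|) @[s --> t] --> (0 : R).
      exact: (cvgr_lt _ HS).
    have E0 : \sum_(j < n) (0 : R) = 0 by rewrite big1.
    rewrite -[X in _ --> X]E0.
    apply: (@cvg_bigsum R R) => j.
    have [_ /(_ (delta_mx 0 j))[_ [+ _]]] := Cf => /(_ x Ot) Dc.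
    have := @continuous_comp _ _ _ c (fun x => 'D_(delta_mx 0 j) f x) t ct Dc.
    move=> /cvgB/(_ (cvg_cst ('D_(delta_mx 0 j) f x)))/cvg_norm.
    by rewrite subrr normr0.
  apply: filterS2 H1 H2 => s cs Ds; split=> // y yk.
  have cr : `|c s - x| < r by apply: lt_trans cs _; move: r0; lra.
  have yr : `|y - x| < r.
    rewrite -(subrKA (c s)); apply: le_lt_trans (ler_normD _ _) _.
    by move: (le_trans yk kr) cs; lra.
  have -> : f y - f (c s) - jac f (c s) (y - c s) = (f y - f (c s) - jac f x (y - c s)) -
      (jac f (c s) (y - c s) - jac f x (y - c s)) by rewrite opprB addrA subrK.
  apply: le_trans (ler_normB _ _) _; rewrite (splitr e) mulrDl lerD //; first exact: rP.
  rewrite /jac -sumrB; apply: le_trans (ler_norm_sum _ _ _) _.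
  apply: (@le_trans _ _ ((\sum_j `|'D_(delta_mx 0 j) f (c s) - 'D_(delta_mx 0 j) f x|) * `|y - c s|)).
    rewrite mulr_suml; apply: ler_sum => j _; rewrite -scalerBr normrZ mulrC ler_wpM2l //.
    exact: mx_norm_coord.
  by rewrite ler_wpM2r // ltW.
by exists k => // t tab; apply: (kP t _).2; rewrite /= in_itv.
Qed.

(** [xi] solves the variational equation along [c]. If [d] starts at [c 0 + h u], then d - c - h xi
    satisfies a Gronwall inequality with zero initial value and a source that is small compared with
    [h]. *)
Lemma flow_derive O f a b c (u : 'rV[R]_n) : open O -> Ck 1 O f -> a < 0 -> 1 < b ->
  integral_curve O f a b c -> exists xi : R -> 'rV[R]_n,
  [/\ xi 0 = u, forall t, a <= t <= b -> is_derive t (1 : R) xi (jac f (c t) (xi t)) &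
      is_derive (c 0) u (flow_end O f) (xi 1)].
Proof.
move=> oO Cf a0 b1 Ic.
have a_b0 : a <= 0 <= b by rewrite (ltW a0) ltW // (lt_trans ltr01).
have ab : a <= b by case/andP: a_b0; exact: le_trans.
(* Freezing time outside [a, b] makes the variational equation a linear system on all of R with
   bounded coefficients, as [picard] requires. *)
pose tau := clamp a b; have tauab t : a <= tau t <= b by exact: clamp_itv.
have cc t : a <= t <= b -> {for t, continuous c} by move=> /Ic[_ /is_derive_continuous].
have Oc t : O (c (tau t)) by exact: (Ic _ (tauab t)).1.
have ctau : continuous (fun t => c (tau t)).
  move=> t; apply: (@continuous_comp _ _ _ tau c); last exact: cc.
  by apply: (@lipschitz_continuous R R R tau 1) => x y; rewrite mul1r; exact: clamp_lip.
have [L L0 LP] : exists2 L, 0 < L & forall t v, `|jac f (c (tau t)) v| <= L * `|v|.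
  pose N t := \sum_j `|'D_(delta_mx 0 j) f (c (tau t))|.
  have cN : continuous N.
    move=> t; apply: continuous_bigsum => j; apply: cvg_norm.
    have [_ /(_ (delta_mx 0 j))[_ [+ _]]] := Cf => /(_ _ (Oc t)) Dc.
    exact: (@continuous_comp _ _ _ (fun t => c (tau t)) (fun x => 'D_(delta_mx 0 j) f x) t (ctau t) Dc).
  have [|s sab maxs] := @EVT_max R N a b ab; first exact: continuous_subspaceT.
  exists (N s + 1); first by rewrite ltr_wpDl // sumr_ge0.
  move=> t v; apply: le_trans (jac_norm _ _ _) _; rewrite ler_wpM2r //.
  have := maxs (tau t); rewrite in_itv /= tauab => /(_ isT).
  rewrite {1}/N /tau clamp_id ?tauab // -/tau => /le_trans; apply; by rewrite lerDl.
have [|d cd|t|xi [xi0 dxi]] := @picard R n (fun t v => jac f (c (tau t)) v) u L (L * `|u|) L0.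
- by move=> t x y; rewrite -jacB; exact: LP.
- exact: (jac_continuous oO Cf Oc ctau cd).
- exact: LP.
have xiD t : a <= t <= b -> is_derive t (1 : R) xi (jac f (c t) (xi t)).
  by move=> tab; have := dxi t; rewrite /tau clamp_id.
exists xi; split=> //.
have [de [C [de0 C0 near_q]]] := flow_near oO Cf a_b0 Ic.
suff H : h^-1 *: ((flow_end O f \o shift (c 0)) (h *: u) - flow_end O f (c 0)) @[h --> 0^'] --> xi 1.
  by split; [apply/cvg_ex; eexists; exact: H|exact: cvg_lim H].
rewrite (flow_endE oO Cf a0 b1 Ic).
apply/cvgrPdist_le => e e0.
(* Gronwall over time 1 multiplies the source by 2 exp(2 L); with source factor e / K the final
   error is exactly |h| e. The summand 1 keeps [K] positive when [u = 0]. *)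
pose K := 2 * (C * (`|u| + 1)) * expR (2 * L).
have u1 : 0 < `|u| + 1 by rewrite ltr_wpDl.
have K0 : 0 < K by rewrite !mulr_gt0 ?expR_gt0.
have eK : 0 < e / K by rewrite divr_gt0.
have cO t : a <= t <= b -> O (c t) /\ {for t, continuous c}.
  by move=> tab; split; [exact: (Ic t tab).1|exact: cc].
have [k k0 kP] := jac_strict_along oO Cf cO eK.
have small (r : R) : 0 < r -> \forall h \near (0 : R)^', `|h| * (`|u| + 1) < r.
  move=> r0; have r1 : 0 < r / (`|u| + 1) by rewrite divr_gt0.
  near=> h; rewrite -ltr_pdivlMr //; near: h; exact: dnbhs0_lt.
near=> h.
have h0 : h != 0 by near: h; exact: nbhs_dnbhs_neq.
have hde : `|h| * (`|u| + 1) < de by near: h; exact: small.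
have hk : `|h| * (`|u| + 1) < k^-1 / C by near: h; apply: small; rewrite divr_gt0 // invr_gt0.
have hu : `|h *: u| <= `|h| * (`|u| + 1) by rewrite normrZ ler_wpM2l // lerDl.
have [|d [d0 Id dc]] := near_q (h *: u + c 0); first by rewrite addrK (le_lt_trans hu).
rewrite addrK in dc; rewrite /= -d0 (flow_endE oO Cf a0 b1 Id).
have sub01 t : 0 <= t <= 1 -> a <= t <= b.
  by move=> /andP[t0 t1]; rewrite (le_trans (ltW a0)) //= (le_trans t1) // ltW.
have dck t : 0 <= t <= 1 -> `|d t - c t| <= C * (`|h| * (`|u| + 1)).
  by move=> /sub01 /dc /le_trans; apply; rewrite ler_pM2l.
have := @gronwall R _ _ (fun t => d t - c t - h *: xi t)
  (fun t => f (d t) - f (c t) - h *: jac f (c t) (xi t)) L (e / K * (C * (`|h| * (`|u| + 1)))) 1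
  L0 _ ler01 _ _.
rewrite d0 xi0 addrK subrr normr0 add0r !mulr1 => H.
rewrite -[xi 1](scalerK h0) -scalerBr -opprB scalerN normrN normrZ normfV.
rewrite ler_pdivrMl ?normr_gt0 //.
apply: le_trans (H _ _ _) _.
- by rewrite (mulr_ge0 (ltW eK)) // (mulr_ge0 (ltW C0)) // mulr_ge0 // ltW.
- move=> t /sub01 tab; have [_ ?] := Ic t tab; have [_ ?] := Id t tab.
  apply: is_derive_sub; first exact: is_derive_sub.
  exact: (is_deriveZ h (xiD t tab)).
- move=> t t01; have tab := sub01 t t01.
  have -> : f (d t) - f (c t) - h *: jac f (c t) (xi t) =
     jac f (c t) (d t - c t - h *: xi t) + (f (d t) - f (c t) - jac f (c t) (d t - c t)).
    by rewrite jacB jacZ [RHS]addrC addrA subrK.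
  apply: le_trans (ler_normD _ _) _; apply: lerD.
    by have := LP t (d t - c t - h *: xi t); rewrite /tau clamp_id.
  apply: le_trans (kP t tab (d t) _) _.
    apply: le_trans (dck t t01) _; rewrite mulrC -ler_pdivlMr //; exact: ltW.
  by rewrite ler_pM2l // dck.
rewrite (_ : 2 * _ * _ = `|h| * e) //; rewrite /K; field.
by rewrite !gt_eqF ?expR_gt0.
Unshelve. all: by end_near.
Qed.

End FlowDerivative.

Section FlowSmooth.
Variable R : realType.

Lemma Ck_row_mx (V : normedModType R) n1 n2 k (U : set V) (f : V -> 'rV[R]_n1) (g : V -> 'rV[R]_n2) :
  open U -> Ck k U f -> Ck k U g -> Ck k U (fun x => row_mx (f x) (g x)).
Proof.
move=> oU /(Ck_mx _ _ oU) Cf /(Ck_mx _ _ oU) Cg; apply/(Ck_mx _ _ oU) => i j.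
case: (split_ordP j) => l ->.
  by under eq_fun do rewrite row_mxEl; exact: Cf.
by under eq_fun do rewrite row_mxEr; exact: Cg.
Qed.

Lemma Ck_lsubmx n1 n2 k (U : set 'rV[R]_(n1 + n2)) : Ck k U (fun z : 'rV[R]_(n1 + n2) => lsubmx z).
Proof. exact/Ck_lin/continuous_lsubmx. Qed.

Lemma Ck_rsubmx n1 n2 k (U : set 'rV[R]_(n1 + n2)) : Ck k U (fun z : 'rV[R]_(n1 + n2) => rsubmx z).
Proof. exact/Ck_lin/continuous_rsubmx. Qed.

Lemma open_lsubmx n1 n2 (O : set 'rV[R]_n1) : open O -> open [set z : 'rV[R]_(n1 + n2) | O (lsubmx z)].
Proof. by move=> oO; apply: open_comp oO => z _; exact: continuous_lsubmx. Qed.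

(* The tangent lift of f: its integral curves are the pairs (c, xi) with xi a solution of
   the variational equation along c, so the flow of the lift is the derivative of the flow. *)
Definition tangent_field n (f : 'rV[R]_n -> 'rV[R]_n) (z : 'rV[R]_(n + n)) : 'rV[R]_(n + n) :=
  row_mx (f (lsubmx z)) (jac f (lsubmx z) (rsubmx z)).

Lemma tangent_field_smooth n (O : set 'rV[R]_n) (f : 'rV[R]_n -> 'rV[R]_n) : open O ->
  smooth_on O f -> smooth_on [set z : 'rV[R]_(n + n) | O (lsubmx z)] (tangent_field f).
Proof.
move=> oO sf k; have oT := @open_lsubmx n n O oO.
have CL (m : nat) (h : 'rV[R]_n -> 'rV[R]_m) : Ck k O h ->
    Ck k [set z : 'rV[R]_(n + n) | O (lsubmx z)] (fun z : 'rV[R]_(n + n) => h (lsubmx z)).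
  by move=> Ch; apply: (Ck_comp_mx oT oO _ _ Ch) => //; exact: Ck_lsubmx.
apply: Ck_row_mx => //; first exact: CL.
apply: Ck_sum => // j _; apply: CkZl => //.
  by apply: (Ck_mx _ _ oT).1; exact: Ck_rsubmx.
by apply: (CL n (fun x => 'D_(delta_mx 0 j) f x)); have [_ /(_ (delta_mx 0 j))[]] := sf k.+1.
Qed.

Lemma is_derive_row_mx n1 n2 (c : R -> 'rV[R]_n1) (d : R -> 'rV[R]_n2) (t : R) dc dd :
  is_derive t (1 : R) c dc -> is_derive t (1 : R) d dd ->
  is_derive t (1 : R) (fun s => row_mx (c s) (d s)) (row_mx dc dd).
Proof.
move=> hc hd; apply: is_derive_mx => i j; case: (split_ordP j) => l ->.
  by under eq_fun do rewrite row_mxEl; rewrite row_mxEl; exact: is_derive_coord.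
by under eq_fun do rewrite row_mxEr; rewrite row_mxEr; exact: is_derive_coord.
Qed.

Lemma tangent_flow n (O : set 'rV[R]_n) (f : 'rV[R]_n -> 'rV[R]_n) (p u : 'rV[R]_n) : open O ->
  smooth_on O f -> flow_dom O f p ->
  flow_dom [set z : 'rV[R]_(n + n) | O (lsubmx z)] (tangent_field f) (row_mx p u) /\
  is_derive p u (flow_end O f)
    (rsubmx (flow_end [set z : 'rV[R]_(n + n) | O (lsubmx z)] (tangent_field f) (row_mx p u))).
Proof.
move=> oO sf [a [b [c [a0 b1 Ic c0]]]].
have [xi [xi0 dxi Dxi]] := flow_derive u oO (sf 1%N) a0 b1 Ic.
have Iz : integral_curve [set z : 'rV[R]_(n + n) | O (lsubmx z)] (tangent_field f) a b
    (fun t => row_mx (c t) (xi t)).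
  move=> t tab; have [Ot dc] := Ic t tab; rewrite /= /tangent_field row_mxKl row_mxKr; split=> //.
  by apply: is_derive_row_mx => //; exact: dxi.
split; first by exists a, b, (fun t => row_mx (c t) (xi t)); rewrite c0 xi0.
have := flow_endE (@open_lsubmx n n O oO) (tangent_field_smooth oO sf 1%N) a0 b1 Iz.
by rewrite c0 xi0 => ->; rewrite row_mxKr -c0.
Qed.

Lemma flow_continuous n (O : set 'rV[R]_n) (f : 'rV[R]_n -> 'rV[R]_n) (p : 'rV[R]_n) : open O ->
  Ck 1 O f -> flow_dom O f p -> {for p, continuous (flow_end O f)}.
Proof.
move=> oO Cf [a [b [c [a0 b1 Ic c0]]]].
have ab : a <= 0 <= b by rewrite (ltW a0) ltW // (lt_trans ltr01).
have [de [C [de0 C0 near_q]]] := flow_near oO Cf ab Ic.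
rewrite -c0; apply/(@cvgrPdist_le _ _ _ _ (nbhs_filter (c 0))) => e e0.
have r0 : 0 < Num.min de (e / C) by rewrite lt_min de0 divr_gt0.
apply: filterS (near_dist_lt (c 0) r0) => q; rewrite lt_min => /andP[qde qe].
have [d [d0 Id dc]] := near_q q qde.
rewrite distrC (flow_endE oO Cf a0 b1 Ic) -d0 (flow_endE oO Cf a0 b1 Id).
apply: le_trans (dc 1 _) _; first by rewrite (ltW b1) (le_trans (ltW a0)).
by rewrite -ler_pdivlMl // mulrC ltW.
Qed.

(** A directional derivative of the flow is a component of the flow of the tangent lift, another
    smooth field in dimension 2n. Hence the induction on [k] runs over all dimensions and fields at
    once. *)
Theorem flow_smooth n (O : set 'rV[R]_n) (f : 'rV[R]_n -> 'rV[R]_n) : open O -> smooth_on O f ->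
  smooth_on (flow_dom O f) (flow_end O f).
Proof.
move=> oO sf k; elim: k n O f oO sf => [|k IH] n O f oO sf.
  by split=> // p; exact: flow_continuous.
have oD := flow_dom_open oO (sf 1%N).
split=> [p|v]; first exact: flow_continuous.
split=> [p Dp|]; first by have [_ []] := tangent_flow v oO sf Dp.
set O' := [set z : 'rV[R]_(n + n) | O (lsubmx z)].
apply: (@Ck_eq_in _ _ _ _ _ (fun p => rsubmx (flow_end O' (tangent_field f) (row_mx p v)))) => //.
  by move=> p Dp; have [_ [_ ->]] := tangent_flow v oO sf Dp.
have oO' : open O' by exact: open_lsubmx.
have oD' := flow_dom_open oO' (tangent_field_smooth oO sf 1%N).
have Crow : Ck k (flow_dom O f) (fun p => flow_end O' (tangent_field f) (row_mx p v)).
  apply: (Ck_comp_mx oD oD' (f := fun p => row_mx p v)).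
  - by move=> p Dp; have [] := tangent_flow v oO sf Dp.
  - by apply: Ck_row_mx => //; [exact: Ck_id|exact: Ck_cst].
  - apply: IH => //; exact: tangent_field_smooth.
exact: (Ck_comp_mx oD openT _ Crow (Ck_rsubmx _ _)).
Qed.

End FlowSmooth.

(** * Geodesics and the exponential map *)

Section MatrixSmoothness.
Variables (R : realType) (V : normedModType R) (k : nat) (U : set V).
Hypothesis oU : open U.

Lemma Ck_mulmx m n p (A : V -> 'M[R]_(m, n)) (B : V -> 'M[R]_(n, p)) :
  Ck k U A -> Ck k U B -> Ck k U (fun x => A x *m B x).
Proof.
move=> /(Ck_mx _ _ oU) CA /(Ck_mx _ _ oU) CB; apply/(Ck_mx _ _ oU) => i j.
under eq_fun do rewrite mxE.
by apply: Ck_sum => // l _; apply: CkM.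
Qed.

Lemma Ck_trmx m n (A : V -> 'M[R]_(m, n)) : Ck k U A -> Ck k U (fun x => (A x)^T).
Proof.
move=> /(Ck_mx _ _ oU) CA; apply/(Ck_mx _ _ oU) => i j.
by under eq_fun do rewrite mxE; exact: CA.
Qed.

Lemma Ck_det n (A : V -> 'M[R]_n) : Ck k U A -> Ck k U (fun x => \det (A x) : R^o).
Proof.
move=> /(Ck_mx _ _ oU) CA; rewrite /determinant.
apply: Ck_sum => // s _; apply: CkM => //; first exact: Ck_cst.
by apply: Ck_prod.
Qed.

Lemma Ck_invmx n (A : V -> 'M[R]_n) : (forall x, U x -> A x \in unitmx) ->
  Ck k U A -> Ck k U (fun x => invmx (A x)).
Proof.
move=> uA CA.
apply: (@Ck_eq_in _ _ _ _ _ (fun x => (\det (A x))^-1 *: \adj (A x))) => //.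
  by move=> x /uA; rewrite /invmx => ->.
apply: CkZl => //.
  by apply: CkV => //; [move=> x /uA; rewrite unitmxE unitfE|exact: Ck_det].
apply/(Ck_mx _ _ oU) => i j; rewrite /adjugate.
under eq_fun do rewrite mxE; rewrite /cofactor.
apply: CkM => //;
  first exact: Ck_cst.
apply: Ck_det; apply/(Ck_mx _ _ oU) => a b.
under eq_fun do rewrite !mxE.
by move/(Ck_mx _ _ oU) : CA; exact.
Qed.

End MatrixSmoothness.

Section OpenNonzero.
Variables (R : realType).

Lemma open_nonzero (V : normedModType R) (U : set V) (h : V -> R^o) : open U -> Ck 0 U h ->
  open [set x | U x /\ h x != 0].
Proof.
move=> oU [ch _]; rewrite openE => x [Ux hx].
have H : \forall y \near x, h y != 0.
  by apply: (cvgr_neq0 (h x)) => //; exact: ch.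
by apply: filterS2 (open_nbhs_nbhs (conj oU Ux)) H => y.
Qed.

Lemma derive_mx_sum n p q (U : set 'rV[R]_n) (h : 'rV[R]_n -> 'M[R]_(p, q)) (x v : 'rV[R]_n) :
  open U -> U x -> Ck 1 U h ->
  'D_v h x = \sum_i v 0 i *: 'D_(delta_mx 0 i) h x.
Proof.
move=> oU Ux Ch; have dh w : derivable h x w by have [_ /(_ w)[+ _]] := Ch; exact.
apply/matrixP => a b; rewrite derive_mx // mxE summxE.
rewrite (C1_derive_sum v oU Ux ((Ck_mx _ _ oU).1 Ch a b)); apply: eq_bigr => i _.
by rewrite mxE derive_mx // mxE.
Qed.

Lemma posdef_unitmx n (A : 'M[R]_n) : (forall w : 'rV[R]_n, w != 0 -> 0 < (w *m A *m w^T) 0 0) ->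
  A \in unitmx.
Proof.
move=> pA; rewrite -row_free_unit -kermx_eq0; apply/eqP/row_matrixP => i; rewrite row0.
apply/eqP; apply: contraT => /pA.
by rewrite (_ : row i _ *m A = 0) ?mul0mx ?mxE ?ltxx // -row_mul mulmx_ker row0.
Qed.

(** Bootstrap: if [c] is of class C^k, so is its derivative f(c), and [c] is of class C^(k+1). *)
Lemma integral_curve_smooth n (O : set 'rV[R]_n) (f : 'rV[R]_n -> 'rV[R]_n) (J : set R^o)
    (c : R^o -> 'rV[R]_n) : open O -> smooth_on O f -> open J ->
  (forall t, J t -> O (c t) /\ is_derive t (1 : R) c (f (c t))) -> smooth_on J c.
Proof.
move=> oO sf oJ Ic; elim=> [|k IH].
  by split=> // t Jt; have [_ /is_derive_continuous] := Ic t Jt.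
split=> [t Jt|v]; first by have [_ /is_derive_continuous] := Ic t Jt.
have dc t : J t -> is_derive t v c (v *: f (c t)).
  move=> Jt; have [Ot [dct ec]] := Ic t Jt; have /derivable1_diffP dt := dct.
  split; first exact: diff_derivable.
  by rewrite -ec !deriveE // -(linearZ_LR ('d c t) v (1 : R)) [_ *: 1]mulr1.
split=> [t /dc[]//|].
apply: (@Ck_eq_in _ _ _ _ _ (fun t => v *: f (c t))) => //; first by move=> t /dc[].
apply: CkZl => //; first exact: Ck_cst.
by apply: (Ck_comp_mx oJ oO _ IH (sf k)) => t /Ic[].
Qed.

End OpenNonzero.

Section ConstrainedAcceleration.
Variables (R : realType) (n : nat).
Implicit Types (G : 'M[R]_n) (x v a b w : 'rV[R]_n).

Lemma mx11_eq (A B : 'M[R]_1) : A 0 0 = B 0 0 -> A = B.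
Proof. by move=> AB; apply/matrixP => i j; rewrite !ord1. Qed.

Lemma mulmx_trC x v : (x *m v^T) 0 0 = (v *m x^T) 0 0.
Proof. by rewrite !mxE; apply: eq_bigr => i _; rewrite !mxE mulrC. Qed.

Lemma row_dual_eq0 b : (forall w, (b *m w^T) 0 0 = 0) -> b = 0.
Proof.
move=> bw; apply/rowP => j; have := bw (delta_mx 0 j).
rewrite mxE (bigD1 j) //= !mxE !eqxx mulr1 big1 ?addr0 // => i /negbTE ij.
by rewrite !mxE ij andbF mulr0.
Qed.

(* On the sphere the geodesic equation only constrains the tangential part of a;
   the projector P = 1 - x^T x and the normal constraint turn it into one linear system. *)
Lemma sphere_system G x v a b : (x *m x^T) 0 0 = 1 ->
  let P := 1%:M - x^T *m x in
  a *m (P *m G *m P + x^T *m x) = (v *m v^T) 0 0 *: (x *m G *m P - x) - b *m P <->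
  (forall w, (x *m w^T) 0 0 = 0 -> ((a *m G + b) *m w^T) 0 0 = 0) /\
  (x *m a^T) 0 0 = - (v *m v^T) 0 0.
Proof.
move=> x1 P; set s := (v *m v^T) 0 0.
have xx : x *m x^T = 1%:M by apply: mx11_eq; rewrite x1 mxE eqxx.
have Px : P *m x^T = 0 by rewrite /P mulmxBl mul1mx -mulmxA xx mulmx1 subrr.
have PT : P^T = P by rewrite /P linearB /= trmx1 trmx_mul trmxK.
have ax : a *m x^T = ((x *m a^T) 0 0)%:M by apply: mx11_eq; rewrite mulmx_trC [RHS]mxE eqxx mulr1n.
have aP : a *m P = a - (x *m a^T) 0 0 *: x by rewrite /P mulmxBr mulmx1 mulmxA ax mul_scalar_mx.
have aH : a *m (P *m G *m P + x^T *m x) = a *m G *m P + (x *m a^T) 0 0 *: (x - x *m G *m P).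
  rewrite mulmxDr !mulmxA aP ax mul_scalar_mx !mulmxBl -!scalemxAl scalerBr.
  by rewrite -addrA [in LHS](addrC (- _)).
rewrite aH; split=> [E|[tan ->]].
  have as_ : (x *m a^T) 0 0 = - s.
    have := congr1 (fun M => (M *m x^T) 0 0) E.
    rewrite mulmxDl !mulmxBl -!scalemxAl !mulmxBl -!mulmxA Px !mulmx0 subr0 sub0r add0r xx.
    by rewrite scalerN !mxE eqxx !mulr1 => ->; rewrite subr0.
  split=> // w xw.
  have wP : w *m P = w.
    have -> : w *m P = w - (w *m x^T) *m x by rewrite /P mulmxBr mulmx1 mulmxA.
    suff -> : w *m x^T = 0 by rewrite mul0mx subr0.
    by apply: mx11_eq; rewrite mulmx_trC xw mxE.
  have : (a *m G + b) *m P = 0.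
    move: E; rewrite as_ scaleNr -scalerN opprB => /eqP.
    by rewrite addrC (inj_eq (addrI _)) -subr_eq0 opprK -mulmxDl => /eqP.
  by move=> E0; rewrite -wP trmx_mul PT mulmxA E0 mul0mx mxE.
rewrite scaleNr -scalerN opprB addrC; congr (_ + _).
apply/eqP; rewrite -subr_eq0 opprK -mulmxDl; apply/eqP; apply: row_dual_eq0 => w.
rewrite -mulmxA -{1}PT -trmx_mul; apply: tan.
have xP : x *m P = 0 by rewrite -[x *m P]trmxK trmx_mul PT Px trmx0.
by rewrite trmx_mul PT mulmxA xP mul0mx mxE.
Qed.

End ConstrainedAcceleration.

Section GeodesicField.
Variables (R : realType) (m : ambient).
Local Notation n := (ambient_dim m).
Local Notation coords := (coords R m).
Local Notation space := Defs.space.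
Implicit Types (g : tensor R m) (x v w a : coords).

(** A switch multiplying every term due to the constraint, so that one set of formulas serves both
    ambient spaces. *)
Definition sphere_sign : R := if m is Sphere3 then 1 else 0.

Lemma sphere_signP :
  (sphere_sign = 1 /\ forall x, ((@space R m x <-> dotp x x = 1) /\ forall w, tangent x w <-> dotp x w = 0)) \/
  (sphere_sign = 0 /\ forall x, (@space R m x /\ forall w, tangent x w)).
Proof. by rewrite /sphere_sign /space /tangent; case: m; [right|left]; split. Qed.

Lemma dotpE (u v : coords) : dotp u v = (u *m v^T) 0 0.
Proof. by rewrite mxE; apply: eq_bigr => i _; rewrite mxE. Qed.

Lemma dotp_subZ (u v w : coords) (s : R) : dotp u (v - s *: w) = dotp u v - s * dotp u w.
Proof. by rewrite /dotp mulr_sumr -sumrB; apply: eq_bigr => i _; rewrite !mxE; ring. Qed.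

(** |x|^2 for the sphere and |x|^2 + 1 for R^3. Dividing by it makes [tangent_proj] the orthogonal
    projector off the line of [x] at every nonzero [x], not only at unit vectors. *)
Definition rho x := dotp x x + (1 - sphere_sign).

Definition tangent_proj x : 'M[R]_n := 1%:M - (sphere_sign / rho x) *: (x^T *m x).

(** On the sphere [g] is positive only on tangent vectors; projecting it and adding the radial
    square gives a form that is positive definite on all ambient vectors at points of M. *)
Definition bordered_metric g x : 'M[R]_n :=
  tangent_proj x *m g x *m tangent_proj x + sphere_sign *: (x^T *m x).

(** The covector of the terms of the geodesic equation other than the acceleration, expanded in
    partial derivatives so that its smoothness in (x, v) can be read off. *)
Definition christoffel g x v : coords :=
  v *m (\sum_i v 0 i *: 'D_(delta_mx 0 i) g x)
  - 2^-1 *: \row_j (v *m 'D_(delta_mx 0 j) g x *m v^T) 0 0.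

(** On the unit sphere the radial part of the acceleration is -(v.v) x. The term in [x *m g x]
    compensates its [g]-pairing with tangent vectors. *)
Definition acc_rhs g x v : coords :=
  (sphere_sign * (v *m v^T) 0 0) *: (x *m g x *m tangent_proj x - x) - christoffel g x v *m tangent_proj x.

Definition acc g x v : coords := acc_rhs g x v *m invmx (bordered_metric g x).

Definition acc_dom g (U : set coords) : set coords :=
  [set x | (U x /\ rho x != 0) /\ \det (bordered_metric g x) != 0].

Lemma christoffelE g (U : set coords) x v w : open U -> Ck 1 U g -> U x ->
  (christoffel g x v *m w^T) 0 0 = bilin ('D_v g x) v w - 2^-1 * bilin ('D_w g x) v v.
Proof.
move=> oU Cg Ux; have mxB (A B : 'M[R]_1) : (A - B) 0 0 = A 0 0 - B 0 0 by rewrite !mxE.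
have mxZ (s : R) (A : 'M[R]_1) : (s *: A) 0 0 = s * A 0 0 by rewrite mxE.
rewrite /christoffel mulmxBl -scalemxAl mxB mxZ.
rewrite -(derive_mx_sum v oU Ux Cg) -/(bilin _ _ _); congr (_ - _ * _).
rewrite (derive_mx_sum w oU Ux Cg) /bilin mulmx_sumr mulmx_suml summxE mxE.
by apply: eq_bigr => j _; rewrite -scalemxAr -scalemxAl mxZ mulrC mxE; congr (_ * _); rewrite mxE.
Qed.

Lemma christoffelZ g x (s : R) v : christoffel g x (s *: v) = s ^+ 2 *: christoffel g x v.
Proof.
rewrite /christoffel scalerBr; congr (_ - _).
  rewrite -scalemxAl expr2 -scalerA; congr (_ *: _).
  rewrite scalemxAr; congr (_ *m _); rewrite scaler_sumr.
  by apply: eq_bigr => i _; rewrite mxE scalerA.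
rewrite scalerA mulrC -scalerA; congr (_ *: _); apply/rowP => j; rewrite [LHS]mxE [RHS]mxE [in RHS]mxE.
by rewrite linearZ /= -!scalemxAl -!scalemxAr scalerA [LHS]mxE expr2.
Qed.

Lemma accZ g x (s : R) v : acc g x (s *: v) = s ^+ 2 *: acc g x v.
Proof.
rewrite /acc scalemxAl; congr (_ *m _).
rewrite /acc_rhs christoffelZ [RHS]scalerBr; congr (_ - _); last by rewrite -scalemxAl.
have -> : ((s *: v) *m (s *: v)^T) 0 0 = s ^+ 2 * (v *m v^T) 0 0.
  by rewrite -!dotpE /dotp mulr_sumr; apply: eq_bigr => i _; rewrite !mxE; ring.
by rewrite scalerA; congr (_ *: _); rewrite mulrCA.
Qed.

(** It holds off the unit sphere as well, so (x.v)' = v.v + x.a = 0 along every solution; if x.v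
    vanishes initially, |x| is constant too. This keeps solutions in TM. *)
Lemma acc_radial g x v : sphere_sign = 1 -> rho x != 0 -> bordered_metric g x \in unitmx ->
  dotp x (acc g x v) = - dotp v v.
Proof.
move=> s1 r0 uH; have rE : rho x = dotp x x by rewrite /rho s1 subrr addr0.
have xx : x *m x^T = (rho x)%:M by apply: mx11_eq; rewrite -dotpE -rE mxE eqxx.
have Px : tangent_proj x *m x^T = 0.
  rewrite /tangent_proj s1 mulmxBl mul1mx -scalemxAl -mulmxA xx mul_mx_scalar scalerA.
  by rewrite divfK // scale1r subrr.
have Hx : bordered_metric g x *m x^T = rho x *: x^T.
  by rewrite mulmxDl s1 scale1r -!mulmxA Px !mulmx0 add0r xx mul_mx_scalar.
have aH : acc g x v *m bordered_metric g x = acc_rhs g x v by rewrite /acc mulmxKV.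
have rhsx : acc_rhs g x v *m x^T = - ((v *m v^T) 0 0 *: (rho x)%:M).
  rewrite /acc_rhs s1 mul1r mulmxBl -scalemxAl mulmxBl -!mulmxA Px !mulmx0.
  by rewrite subr0 sub0r xx scalerN.
have : rho x *: (acc g x v *m x^T) = - ((v *m v^T) 0 0 *: (rho x)%:M).
  by rewrite -rhsx -aH -mulmxA Hx -scalemxAr.
move=> /(congr1 (fun M : 'M[R]_1 => M 0 0)); rewrite [LHS]mxE mulmx_trC -!dotpE => E.
by apply: (mulfI r0); rewrite E !mxE eqxx mulr1n mulrN mulrC.
Qed.

Lemma bordered_metric_pos g x w : riemannian g -> space x -> w != 0 ->
  0 < (w *m bordered_metric g x *m w^T) 0 0.
Proof.
move=> [_ pos] Sx w0.
case: sphere_signP => [[s1 /(_ x)[sx tx]]|[s0 /(_ x)[_ tx]]]; last first.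
  rewrite /bordered_metric /tangent_proj s0 mul0r !scale0r subr0 addr0 mul1mx mulmx1.
  exact: pos.
have xx1 : dotp x x = 1 by apply/sx.
have r1 : rho x = 1 by rewrite /rho s1 subrr addr0.
have xx : x *m x^T = 1%:M by apply: mx11_eq; rewrite -dotpE xx1 mxE eqxx.
rewrite /bordered_metric s1 scale1r mulmxDr mulmxDl [ltRHS]mxE.
have PT : (tangent_proj x)^T = tangent_proj x.
  by rewrite /tangent_proj linearB /= trmx1 linearZ /= trmx_mul trmxK.
have wP : w *m tangent_proj x = w - (w *m x^T) 0 0 *: x.
  rewrite /tangent_proj s1 r1 divr1 scale1r mulmxBr mulmx1 mulmxA; congr (_ - _).
  by rewrite -mul_scalar_mx; congr (_ *m _); apply: mx11_eq; rewrite [RHS]mxE eqxx.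
have -> : w *m (tangent_proj x *m g x *m tangent_proj x) *m w^T =
    (w *m tangent_proj x) *m g x *m (w *m tangent_proj x)^T by rewrite trmx_mul PT !mulmxA.
have -> : (w *m (x^T *m x) *m w^T) 0 0 = (w *m x^T) 0 0 ^+ 2.
  rewrite mulmxA -mulmxA [LHS]mxE big_ord1 expr2; congr (_ * _); exact: mulmx_trC.
have [E|Pw0] := eqVneq (w *m tangent_proj x) 0.
  rewrite E !mul0mx mxE add0r exprn_even_gt0 //=.
  apply: contra_neq w0 => wx; move: E; rewrite wP wx scale0r subr0; exact.
apply: ltr_pwDl; last exact: sqr_ge0.
apply: pos => //; apply/tx; rewrite wP dotp_subZ xx1 mulr1 dotpE mulmx_trC subrr //.
Qed.

Lemma bordered_metric_unit g x : riemannian g -> space x -> bordered_metric g x \in unitmx.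
Proof. by move=> gr Sx; apply: posdef_unitmx => w; exact: bordered_metric_pos. Qed.

(** It transfers lower bounds for [bordered_metric], valid on a fixed vector space, to [g] on
    tangent spaces that move with [x]. *)
Lemma bordered_metric_tangent g x w : tangent x w ->
  (w *m bordered_metric g x *m w^T) 0 0 = bilin (g x) w w.
Proof.
case: sphere_signP => [[s1 /(_ x)[_ tx]]|[s0 _]] Tw; last first.
  by rewrite /bordered_metric /tangent_proj s0 mul0r !scale0r subr0 addr0 mul1mx mulmx1.
have wx : w *m x^T = 0 by apply: mx11_eq; rewrite mulmx_trC -dotpE (tx w).1 // mxE.
have xw : x *m w^T = 0 by apply: mx11_eq; rewrite -dotpE (tx w).1 // mxE.
have wP : w *m tangent_proj x = w.
  by rewrite /tangent_proj mulmxBr mulmx1 -scalemxAr mulmxA wx mul0mx scaler0 subr0.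
have Pw : tangent_proj x *m w^T = w^T.
  by rewrite /tangent_proj mulmxBl mul1mx -scalemxAl -mulmxA xw mulmx0 scaler0 subr0.
rewrite /bordered_metric mulmxDr mulmxDl s1 scale1r !mulmxA wx !mul0mx addr0.
by rewrite -!mulmxA Pw !mulmxA wP.
Qed.

(** Tested on tangent vectors only, the geodesic equation leaves the normal part of [a] free on the
    sphere; the second derivative of |c|^2 = 1 supplies it. *)
Lemma acc_char g (U : set coords) x v a : riemannian g -> open U -> Ck 1 U g -> U x ->
  space x ->
  a = acc g x v <->
  (forall w, tangent x w ->
     bilin (g x) a w + bilin ('D_v g x) v w - 2^-1 * bilin ('D_w g x) v v = 0) /\
  (sphere_sign = 1 -> dotp x a = - dotp v v).
Proof.
move=> gr oU Cg Ux Sx; have uH := bordered_metric_unit gr Sx.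
have stuff w : bilin (g x) a w + bilin ('D_v g x) v w - 2^-1 * bilin ('D_w g x) v v =
    ((a *m g x + christoffel g x v) *m w^T) 0 0.
  by rewrite -addrA -(christoffelE v w oU Cg Ux) mulmxDl [RHS]mxE.
have -> : a = acc g x v <-> a *m bordered_metric g x = acc_rhs g x v.
  by rewrite /acc; split=> [->|<-]; rewrite ?mulmxKV ?mulmxK.
case: sphere_signP => [[s1 /(_ x)[sx tx]]|[s0 /(_ x)[_ tx]]].
  have xx1 : dotp x x = 1 by apply/sx.
  have r1 : rho x = 1 by rewrite /rho s1 subrr addr0.
  rewrite /bordered_metric /acc_rhs /tangent_proj s1 r1 divr1 !scale1r mul1r.
  rewrite dotpE in xx1; have := sphere_system (g x) v a (christoffel g x v) xx1.
  move=> /= ->; split=> -[H1 H2]; split.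
  - by move=> w /tx; rewrite stuff dotpE => /H1.
  - by rewrite !dotpE.
  - by move=> w xw; rewrite -stuff; apply: H1; apply/tx; rewrite dotpE.
  - by rewrite -!dotpE; exact: H2.
rewrite /bordered_metric /acc_rhs /tangent_proj s0 !mul0r !scale0r subr0 addr0 sub0r mul1mx !mulmx1.
split=> [E|[H _]].
  by split=> [w _|/eqP]; [rewrite stuff E addNr mul0mx mxE|rewrite eq_sym oner_eq0].
apply/eqP; rewrite -subr_eq0 opprK; apply/eqP/row_dual_eq0 => w.
by rewrite -stuff; apply: H.
Qed.

End GeodesicField.

(** * The geodesic flow and its linearization at rest *)

Section GeodesicFlow.
Variables (R : realType) (m : ambient).
Local Notation n := (ambient_dim m).
Local Notation coords := (coords R m).
Local Notation space := Defs.space.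
Implicit Types (g : tensor R m) (U : set coords).

Definition geo_dom g U : set 'rV[R]_(n + n) := [set z | acc_dom g U (lsubmx z)].

Definition geo_field g (z : 'rV[R]_(n + n)) : 'rV[R]_(n + n) :=
  row_mx (rsubmx z) (acc g (lsubmx z) (rsubmx z)).

Lemma Ck_rho k U : open U -> Ck k U (fun x : coords => rho x : R^o).
Proof.
move=> oU; apply: CkD => //; last exact: Ck_cst.
by apply: Ck_sum => // i _; apply: CkM => //; exact: Ck_coord.
Qed.

Lemma Ck_tangent_proj k U : open U -> (forall x, U x -> rho x != 0) ->
  Ck k U (fun x : coords => tangent_proj x).
Proof.
move=> oU r0; apply: CkB => //; first exact: Ck_cst.
apply: CkZl => //.
  apply: CkM => //; first exact: Ck_cst.
  by apply: CkV => //; exact: Ck_rho.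
by apply: Ck_mulmx => //; [apply: Ck_trmx => //|]; exact: Ck_id.
Qed.

Lemma Ck_bordered_metric g k U : open U -> (forall x, U x -> rho x != 0) -> Ck k U g ->
  Ck k U (bordered_metric g).
Proof.
move=> oU r0 Cg; apply: CkD => //.
  by do 2?apply: Ck_mulmx => //; exact: Ck_tangent_proj.
apply: CkZl => //; first exact: Ck_cst.
by apply: Ck_mulmx => //; [apply: Ck_trmx => //|]; exact: Ck_id.
Qed.

Lemma open_rho U : open U -> open [set x : coords | U x /\ rho x != 0].
Proof. by move=> oU; apply: open_nonzero (Ck_rho 0 oU). Qed.

Lemma open_acc_dom g U : open U -> Ck 0 U g -> open (acc_dom g U).
Proof.
move=> oU Cg; apply: (open_nonzero (open_rho oU)) => //.
apply: Ck_det; first exact: open_rho.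
apply: Ck_bordered_metric; [exact: open_rho|by move=> x []|].
by apply: Ck_sub Cg => x [].
Qed.

Lemma open_geo_dom g U : open U -> Ck 0 U g -> open (geo_dom g U).
Proof. by move=> oU Cg; apply: open_lsubmx; exact: open_acc_dom. Qed.

Lemma geo_field_smooth g U : open U -> smooth_on U g -> smooth_on (geo_dom g U) (geo_field g).
Proof.
move=> oU sg k; have oA := open_acc_dom oU (sg 0%N); have oG := open_geo_dom oU (sg 0%N).
have AU x : acc_dom g U x -> U x by move=> [[]].
have CL p q (h : coords -> 'M[R]_(p, q)) : Ck k (acc_dom g U) h ->
    Ck k (geo_dom g U) (fun z : 'rV[R]_(n + n) => h (lsubmx z)).
  by move=> Ch; apply: (Ck_comp_mx oG oA _ _ Ch) => //; exact: Ck_lsubmx.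
have Cr : Ck k (geo_dom g U) (fun z : 'rV[R]_(n + n) => rsubmx z) by exact: Ck_rsubmx.
have CrT : Ck k (geo_dom g U) (fun z : 'rV[R]_(n + n) => (rsubmx z)^T) by exact: Ck_trmx.
have Ci (i : 'I_1) (j : 'I_n) : Ck k (geo_dom g U) (fun z : 'rV[R]_(n + n) => rsubmx z i j : R^o).
  exact: (Ck_mx _ _ oG).1 Cr i j.
have Cg : Ck k (acc_dom g U) g by apply: Ck_sub (sg k).
have CDg i : Ck k (acc_dom g U) (fun x => 'D_(delta_mx 0 i) g x).
  by apply: Ck_sub AU _; have [_ /(_ (delta_mx 0 i))[]] := sg k.+1.
have CP : Ck k (acc_dom g U) (fun x : coords => tangent_proj x).
  by apply: Ck_tangent_proj => // x [[]].
have Cid : Ck k (acc_dom g U) (fun x : coords => x) by exact: Ck_id.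
apply: Ck_row_mx => //; apply: Ck_mulmx => //; last first.
  apply: (CL _ _ (fun x => invmx (bordered_metric g x))); apply: Ck_invmx => //.
    by move=> x [_]; rewrite unitmxE unitfE.
  by apply: Ck_bordered_metric => // x [[]].
have Cv2 : Ck k (geo_dom g U) (fun z : 'rV[R]_(n + n) => (rsubmx z *m (rsubmx z)^T) 0 0 : R^o).
  by apply: (Ck_mx _ _ oG).1; exact: Ck_mulmx.
apply: CkB => //.
  apply: CkZl => //; first by apply: CkM => //; exact: Ck_cst.
  apply: (CL _ _ (fun x => x *m g x *m tangent_proj x - x)).
  by apply: CkB => //; do 2?apply: Ck_mulmx.
apply: Ck_mulmx => //; last exact: (CL _ _ (fun x => tangent_proj x)).
apply: CkB => //.
  apply: Ck_mulmx => //; apply: Ck_sum => // i _; apply: CkZl => //.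
  exact: (CL _ _ (fun x => 'D_(delta_mx 0 i) g x)).
apply: CkZl => //; first exact: Ck_cst.
apply/(Ck_mx _ _ oG) => i j; under eq_fun do rewrite mxE.
apply: (Ck_mx _ _ oG).1; apply: Ck_mulmx => //; apply: Ck_mulmx => //.
exact: (CL _ _ (fun x => 'D_(delta_mx 0 j) g x)).
Qed.

Lemma geo_field0 g (p : coords) : geo_field g (row_mx p 0) = 0.
Proof.
rewrite /geo_field row_mxKl row_mxKr -(scale0r (0 : coords)) accZ expr0n /= !scale0r.
exact: row_mx0.
Qed.

(* acc is quadratic in the velocity, so it does not contribute to the linearization at rest. *)
Lemma jac_geo_field0 g U (p xi eta : coords) : open U -> smooth_on U g -> acc_dom g U p ->
  jac (geo_field g) (row_mx p 0) (row_mx xi eta) = row_mx eta 0.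
Proof.
move=> oU sg Ap; have oG := open_geo_dom oU (sg 0%N); have sG := geo_field_smooth oU sg.
have Gp (v : coords) : geo_dom g U (row_mx p v) by rewrite /geo_dom /= row_mxKl.
rewrite /jac -(derive_mx_sum _ oG (Gp 0) (sG 1%N)).
apply: (cvg_lim (@norm_hausdorff _ _)).
pose q (h : R) : 'rV[R]_(n + n) := h *: row_mx xi 0 + row_mx p eta.
have cq : q h @[h --> 0^'] --> row_mx p eta.
  have : q h @[h --> (0 : R)^'] --> 0 *: row_mx xi (0 : coords) + row_mx p eta.
    apply: cvgD; last exact: cvg_cst.
    apply: cvgZr_tmp; exact: nbhs_dnbhs.
  by rewrite scale0r add0r.
have [cG _] := sG 0%N.
have cGq : geo_field g (q h) @[h --> 0^'] --> geo_field g (row_mx p eta).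
  exact: (cvg_comp _ _ cq (cG _ (Gp eta))).
have H : row_mx eta 0 + h *: (geo_field g (q h) - row_mx eta 0) @[h --> 0^'] -->
    row_mx eta (0 : coords) + 0 *: (geo_field g (row_mx p eta) - row_mx eta 0).
  apply: cvgD; first exact: cvg_cst.
  apply: cvgZ; first exact: nbhs_dnbhs.
  by apply: cvgB => //; exact: cvg_cst.
rewrite scale0r addr0 in H.
apply: cvg_trans H; apply: near_eq_cvg; near=> h.
have h0 : h != 0 by near: h; exact: nbhs_dnbhs_neq.
rewrite /= geo_field0 subr0 /q !scale_row_mx !add_row_mx scaler0 !add0r addr0 /geo_field.
rewrite !row_mxKl !row_mxKr opp_row_mx add_row_mx subrr oppr0 addr0 !scale_row_mx add_row_mx.
by rewrite scaler0 addr0 add0r accZ !scalerA mulVf // scale1r expr2 mulrA mulVf // mul1r.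
Unshelve. all: by end_near.
Qed.

Lemma is_derive_lsubmx (V : normedModType R) n1 n2 (f : V -> 'rV[R]_(n1 + n2)) x v df :
  is_derive x v f df -> is_derive x v (fun y => lsubmx (f y)) (lsubmx df).
Proof.
move=> [dfx <-].
have D : derivable (fun y => lsubmx (f y)) x v.
  apply/derivable_mxP => i j; under eq_fun do rewrite mxE.
  by move/derivable_mxP : dfx; exact.
split=> //; rewrite derive_mx //; apply/matrixP => i j; rewrite mxE mxE derive_mx // mxE.
by under eq_fun do rewrite mxE.
Qed.

(** At rest the variational equation reads xi' = eta, eta' = 0. Its solution xi + t eta equals xi +
    eta at time 1. *)
Lemma derive_flow_rest g U (p xi eta : coords) : open U -> smooth_on U g -> acc_dom g U p ->
  [/\ flow_dom (geo_dom g U) (geo_field g) (row_mx p 0),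
      flow_end (geo_dom g U) (geo_field g) (row_mx p 0) = row_mx p 0 &
      is_derive (row_mx p 0) (row_mx xi eta)
        (fun z => lsubmx (flow_end (geo_dom g U) (geo_field g) z)) (xi + eta)].
Proof.
move=> oU sg Ap; have oG := open_geo_dom oU (sg 0%N); have sG := geo_field_smooth oU sg.
have I0 : integral_curve (geo_dom g U) (geo_field g) (-1) 2 (fun=> row_mx p 0).
  move=> t _; split; first by rewrite /geo_dom /= row_mxKl.
  by rewrite geo_field0; exact: is_derive_cst.
have a0 : -1 < 0 :> R by exact: ltrN10.
have b1 : 1 < 2 :> R by rewrite ltr1n.
have D0 : flow_dom (geo_dom g U) (geo_field g) (row_mx p 0).
  by exists (-1), 2, (fun=> row_mx p 0).
have IT : integral_curve [set z : 'rV[R]_((n + n) + (n + n)) | geo_dom g U (lsubmx z)]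
    (tangent_field (geo_field g)) (-1) 2
    (fun t => row_mx (row_mx p 0) (row_mx (xi + t *: eta) eta)).
  move=> t _; split; first by rewrite /geo_dom /= !row_mxKl.
  rewrite /tangent_field row_mxKl row_mxKr geo_field0 (jac_geo_field0 _ _ oU sg Ap).
  have De : is_derive t (1 : R) (fun s : R => s *: eta) eta.
    apply: is_derive_mx => i j; under eq_fun do rewrite mxE mulrC.
    by have := is_deriveZ (eta i j) (@is_derive_id _ _ t (1 : R)); rewrite [_ *: 1]mulr1; exact.
  have := is_derive_add (is_derive_cst xi t (1 : R)) De; rewrite add0r => De'.
  exact: (is_derive_row_mx (is_derive_cst (row_mx p 0) t (1 : R))
    (is_derive_row_mx De' (is_derive_cst eta t (1 : R)))).
split=> //; first exact: (flow_endE oG (sG 1%N) a0 b1 I0).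
have [_] := tangent_flow (row_mx xi eta) oG sG D0.
have := flow_endE (@open_lsubmx _ _ _ (geo_dom g U) oG) (tangent_field_smooth oG sG 1%N) a0 b1 IT.
by rewrite scale0r addr0 scale1r => ->; rewrite row_mxKr => /is_derive_lsubmx; rewrite row_mxKl.
Qed.

End GeodesicFlow.

Section ExponentialMap.
Variables (R : realType) (m : ambient).
Local Notation n := (ambient_dim m).
Local Notation coords := (coords R m).
Local Notation space := (@Defs.space R m).
Implicit Types (g : tensor R m) (U : set coords).

Lemma is_derive_bigsum (I : Type) (r : seq I) (f : I -> R -> R) (df : I -> R) (t : R) :
  (forall i, is_derive t 1 (f i) (df i)) ->
  is_derive t 1 (fun s => \sum_(i <- r) f i s) (\sum_(i <- r) df i).
Proof.
move=> fd; elim: r => [|i r IH].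
  by under eq_fun do rewrite big_nil; rewrite big_nil; exact: is_derive_cst.
by under eq_fun do rewrite big_cons; rewrite big_cons; exact: is_derive_add.
Qed.

Lemma dotpC (u v : coords) : dotp u v = dotp v u.
Proof. by apply: eq_bigr => i _; rewrite mulrC. Qed.

Lemma is_derive_dotp (f h : R -> coords) (t : R) (df dh : coords) :
  is_derive t (1 : R) f df -> is_derive t (1 : R) h dh ->
  is_derive t (1 : R) (fun s => dotp (f s) (h s)) (dotp df (h t) + dotp (f t) dh).
Proof.
move=> fd hd; rewrite /dotp -big_split /=; apply: is_derive_bigsum => i.
apply: (is_derive_eq (is_deriveM (is_derive_coord 0 i fd) (is_derive_coord 0 i hd))).
by rewrite /GRing.scale /= addrC; congr (_ + _); rewrite mulrC.
Qed.

Lemma derive0_const (f : R -> R) (a b s t : R) : (forall u, a <= u <= b -> is_derive u 1 f 0) ->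
  a <= s <= b -> a <= t <= b -> f s = f t.
Proof.
move=> fd; wlog st : s t / s <= t => [hw|sab tab].
  by have [/hw//|/ltW/hw H sab tab] := leP s t; rewrite H.
have D u : s <= u <= t -> is_derive u 1 f 0.
  case/andP: sab tab => as_ _ /andP[_ tb] /andP[su ut].
  by apply: fd; rewrite (le_trans as_) // (le_trans ut).
apply/eqP; rewrite eq_le (derive_ge0_le st D) //= -lerN2.
apply: (@derive_ge0_le R (fun u => - f u) (fun=> 0) s t st) => // u /D fu.
by have := is_deriveN fu; rewrite oppr0.
Qed.

Lemma space_acc_dom g U x : riemannian g -> space `<=` U -> space x -> acc_dom g U x.
Proof.
move=> gr SU Sx; split; last by rewrite -unitfE -unitmxE bordered_metric_unit.
split; first exact: SU.
case: (@sphere_signP R m) => [[s1 /(_ x)[sx _]]|[s0 _]].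
  by rewrite /rho s1 subrr addr0 sx.1 // oner_neq0.
by rewrite /rho s0 subr0 gt_eqF // ltr_wpDl // sumr_ge0 // => i _; rewrite -expr2 sqr_ge0.
Qed.

(** Solutions of the ambient system that start in TM remain there by [acc_radial], and on TM
    [acc_char] gives back the geodesic equation. *)
Lemma integral_exp_rel g U (a b : R) (z : R -> 'rV[R]_(n + n)) : riemannian g -> open U ->
  smooth_on U g -> a < 0 -> 1 < b ->
  integral_curve (geo_dom g U) (geo_field g) a b z ->
  space (lsubmx (z 0)) -> tangent (lsubmx (z 0)) (rsubmx (z 0)) ->
  exp_rel g (lsubmx (z 0)) (rsubmx (z 0)) (lsubmx (z 1)).
Proof.
move=> gr oU sg a0 b1 Iz S0 T0.
have oG := open_geo_dom oU (sg 0%N); have sG := geo_field_smooth oU sg.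
pose x t : coords := lsubmx (z t); pose y t : coords := rsubmx (z t).
have xyD t : a <= t <= b -> is_derive t (1 : R) x (y t) /\ is_derive t (1 : R) y (acc g (x t) (y t)).
  move=> /Iz[_ dz]; split.
    by have := is_derive_lsubmx dz; rewrite /geo_field row_mxKl.
  apply: is_derive_mx => i j; under eq_fun do rewrite mxE.
  by have := is_derive_coord i (rshift n j) dz; rewrite /geo_field row_mxEr.
have zero_itv : a <= 0 <= b by rewrite (ltW a0) ltW // (lt_trans ltr01).
have inS t : a <= t <= b -> space (x t) /\ tangent (x t) (y t).
  case: (@sphere_signP R m) => [[s1 sx]|[s0 sx]] tab; last by split; have [] := sx (x t).
  (* Orthogonality is conserved on its own; the conservation of |x|^2 relies on it. *)
  have orth u : a <= u <= b -> dotp (x u) (y u) = 0.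
    move=> uab; rewrite -((sx (x 0)).2 (y 0)).1 //.
    apply: (@derive0_const (fun u => dotp (x u) (y u)) a b) uab zero_itv => s sab.
    have [dx dy] := xyD s sab; have [[[Us r0] Hs] _] := Iz s sab.
    have := is_derive_dotp dx dy.
    by rewrite acc_radial ?subrr // unitmxE unitfE.
  split; last by apply/(sx (x t)).2; exact: orth.
  apply/(sx (x t)).1; rewrite -((sx (x 0)).1).1 //.
  apply: (@derive0_const (fun u => dotp (x u) (x u)) a b) tab zero_itv => s sab.
  have [dx _] := xyD s sab; have := is_derive_dotp dx dx.
  by rewrite dotpC orth // addr0.
have sub t : t \in `]a, b[%R -> a <= t <= b.
  by rewrite in_itv /= => /andP[ta tb]; rewrite !ltW.
have oJ : open `]a, b[%classic by exact: interval_open.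
have sz : smooth_on `]a, b[ z.
  by apply: (integral_curve_smooth oG sG oJ) => t /sub; exact: Iz.
have d1x t : t \in `]a, b[%R -> derive1 x t = y t.
  by move=> /sub /xyD[[_ <-] _]; rewrite derive1E.
have d2x t : t \in `]a, b[%R -> derive1n 2 x t = acc g (x t) (y t).
  move=> tJ; rewrite derive1nS derive1n1 derive1E.
  have [_ [_ <-]] := xyD t (sub t tJ).
  apply: near_eq_derive; have : nbhs t `]a, b[%classic by exact: open_nbhs_nbhs.
  by apply: filterS => s; exact: d1x.
exists a, b, x; split=> //; last by split=> //; apply: d1x; rewrite in_itv /= a0 (lt_trans ltr01).
split.
  by move=> k; apply: (Ck_comp_mx oJ openT _ (sz k) (Ck_lsubmx _ _)).
move=> t tJ; have tab := sub t tJ; have [St Tt] := inS t tab; split=> //.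
rewrite d2x // d1x //; have [[[Us _] _] _] := Iz t tab.
by have [+ _] := (acc_char (y t) (acc g (x t) (y t)) gr oU (sg 1%N) Us St).1 erefl; apply.
Qed.

(** Differentiating |c|^2 = 1 once shows that the velocity is tangent, and twice gives the normal
    acceleration required by [acc_char]. The interval [0, 1] suffices for uniqueness of the
    endpoint. *)
Lemma geodesic_integral g U (a b : R) (c : R^o -> coords) : riemannian g -> open U ->
  space `<=` U -> smooth_on U g -> a < 0 -> 1 < b -> geodesic g `]a, b[ c ->
  integral_curve (geo_dom g U) (geo_field g) 0 1 (fun t => row_mx (c t) (derive1 c t)).
Proof.
move=> gr oU SU sg a0 b1 [sc geo].
have oJ : open `]a, b[%classic by exact: interval_open.
have J01 t : 0 <= t <= 1 -> `]a, b[%classic t.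
  by move=> /andP[t0 t1]; rewrite /= in_itv /= (lt_le_trans a0) // (le_lt_trans t1).
have Jnear t : `]a, b[%classic t -> nbhs t `]a, b[%classic by move=> tJ; exact: open_nbhs_nbhs.
have dc t : `]a, b[%classic t -> is_derive t (1 : R) c (derive1 c t).
  move=> tJ; rewrite derive1E; apply: derivableP.
  by have [_ /(_ 1)[+ _]] := sc 1%N; exact.
have d1c : derive1 c = (fun t => 'D_1 c t) by apply/funext => t; rewrite derive1E.
have ddc t : `]a, b[%classic t -> is_derive t (1 : R) (derive1 c) (derive1n 2 c t).
  move=> tJ; rewrite derive1nS derive1n1 derive1E; apply: derivableP; rewrite d1c.
  by have [_ /(_ 1)[_ [_ /(_ 1)[+ _]]]] := sc 2%N; exact.
have locconst (f : R -> R) (e : R) t df : `]a, b[%classic t -> (forall s, `]a, b[%classic s -> f s = e) ->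
    is_derive t 1 f df -> df = 0.
  move=> tJ fe [_ <-]; rewrite -(derive_cst e t (1 : R)).
  by apply: near_eq_derive; apply: filterS (Jnear t tJ) => s /fe.
have vel t : `]a, b[%classic t -> tangent (c t) (derive1 c t) /\
    (sphere_sign R m = 1 -> dotp (c t) (derive1n 2 c t) = - dotp (derive1 c t) (derive1 c t)).
  case: (@sphere_signP R m) => [[s1 sx]|[s0 sx]] tJ; last first.
    by split; [have [] := sx (c t)|rewrite s0 => /eqP; rewrite eq_sym oner_eq0].
  have orth s : `]a, b[%classic s -> dotp (c s) (derive1 c s) = 0.
    move=> sJ; have := is_derive_dotp (dc s sJ) (dc s sJ).
    have sphere u : `]a, b[%classic u -> dotp (c u) (c u) = 1.
      by move=> uJ; apply/(sx (c u)).1; have [] := geo u uJ.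
    move/(locconst _ 1 _ _ sJ sphere); rewrite dotpC => /eqP.
    by rewrite -mulr2n mulrn_eq0 /= => /eqP.
  split; first by apply/(sx (c t)).2; exact: orth.
  move=> _; have := is_derive_dotp (dc t tJ) (ddc t tJ).
  by move/(locconst _ 0 _ _ tJ orth) => E; apply/eqP; rewrite -addr_eq0 addrC; apply/eqP.
move=> t /J01 tJ; have [St geot] := geo t tJ; have [Tt rad] := vel t tJ.
split; first by rewrite /geo_dom /= row_mxKl; exact: space_acc_dom.
rewrite /geo_field row_mxKl row_mxKr; apply: is_derive_row_mx; first exact: dc.
have <- : derive1n 2 c t = acc g (c t) (derive1 c t); last exact: ddc.
by apply/(acc_char _ _ gr oU (sg 1%N) (SU _ St) St); split.
Qed.

(** [exp_map] picks the endpoint of an arbitrary admissible geodesic through [xget]. By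
    [geodesic_integral] and [flow_unique] every choice ends where the smooth flow does. *)
Theorem exp_local g : riemannian g -> exists (D : set 'rV[R]_(n + n)) (E : 'rV[R]_(n + n) -> coords),
  [/\ open D, smooth_on D E,
      forall p : coords, space p -> [/\ D (row_mx p 0), E (row_mx p 0) = p &
        forall xi eta, is_derive (row_mx p 0) (row_mx xi eta) E (xi + eta)] &
      forall p v : coords, space p -> tangent p v -> D (row_mx p v) ->
        exp_rel g p v (E (row_mx p v)) /\ exp_map g p v = E (row_mx p v)].
Proof.
move=> gr; have [[U [oU SU sg _]] _] := gr.
have oG := open_geo_dom oU (sg 0%N); have sG := geo_field_smooth oU sg.
have oD := flow_dom_open oG (sG 1%N).
exists (flow_dom (geo_dom g U) (geo_field g)), (fun z => lsubmx (flow_end (geo_dom g U) (geo_field g) z)).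
split=> //.
- by move=> k; apply: (Ck_comp_mx oD openT _ (flow_smooth oG sG k) (Ck_lsubmx _ _)).
- move=> p /(space_acc_dom gr SU) Ap.
  split; try by move=> *; have [] := derive_flow_rest 0 0 oU sg Ap.
    by have [_ -> _] := derive_flow_rest 0 0 oU sg Ap; rewrite row_mxKl.
  by move=> xi eta; have [] := derive_flow_rest xi eta oU sg Ap.
- move=> p v Sp Tv [a [b [z [a0 b1 Iz z0]]]].
  rewrite -z0 (flow_endE oG (sG 1%N) a0 b1 Iz).
  have H : exp_rel g p v (lsubmx (z 1)).
    by have := integral_exp_rel gr oU sg a0 b1 Iz; rewrite z0 row_mxKl row_mxKr; exact.
  split=> //; rewrite /exp_map; case: xgetP => [q _|/(_ _ H)//].
  move=> [a' [b' [c [a'0 b'1 geo [c0 dc0 c1]]]]].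
  have Iw := geodesic_integral gr oU SU sg a'0 b'1 geo.
  have I01 : integral_curve (geo_dom g U) (geo_field g) 0 1 z.
    exact: integral_curve_sub (ltW a0) (ltW b1) Iz.
  have := flow_unique oG (sG 1%N) ler01 Iw I01.
  by rewrite c0 dc0 z0 => /(_ erefl) <-; rewrite row_mxKl.
Qed.

End ExponentialMap.

(** * Uniform tubular neighbourhoods *)

Section BilinearBounds.
Variables (R : realType).

Lemma bilin_norm n (G : 'M[R]_n) (u v : 'rV[R]_n) :
  `|(u *m G *m v^T) 0 0| <= (n * n)%:R * `|G| * `|u| * `|v|.
Proof.
rewrite mxE; apply: le_trans (ler_norm_sum _ _ _) _.
have -> : (n * n)%:R * `|G| * `|u| * `|v| = \sum_(j < n) (n%:R * `|G| * `|u| * `|v|).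
  by rewrite sumr_const card_ord -[RHS]mulr_natl natrM !mulrA.
apply: ler_sum => j _; rewrite normrM; apply: ler_pM => //; last first.
  by rewrite mxE mx_norm_coord.
rewrite mxE; apply: le_trans (ler_norm_sum _ _ _) _.
have -> : n%:R * `|G| * `|u| = \sum_(i < n) (`|u| * `|G|).
  by rewrite sumr_const card_ord -[RHS]mulr_natl mulrAC mulrA.
by apply: ler_sum => i _; rewrite normrM ler_pM // mx_norm_coord.
Qed.

Lemma C1_lipschitz n p q (U : set 'rV[R]_n) (h : 'rV[R]_n -> 'M[R]_(p, q)) x : open U -> U x ->
  Ck 1 U h -> exists L r : R, [/\ 0 < L, 0 < r & forall y z, `|y - x| < r -> `|z - x| < r ->
    `|h y - h z| <= L * `|y - z|].
Proof.
move=> oU Ux Ch.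
(* Matrices are flattened to row vectors so that [jac_strict] applies. *)
have Cv : Ck 1 U (fun y => mxvec (h y)).
  apply/(Ck_mx _ _ oU) => i j; case/mxvec_indexP: j => a b; rewrite ord1.
  by under eq_fun do rewrite mxvecE; exact: (Ck_mx _ _ oU).1 Ch a b.
have [r r0 rP] := jac_strict oU Ux Cv ltr01.
pose S := \sum_j `|'D_(delta_mx 0 j) (fun y => mxvec (h y)) x|.
have S0 : 0 <= S by exact: sumr_ge0.
exists (S + 1), r; split=> //; first by rewrite ltr_wpDl.
move=> y z yr zr; apply: mx_norm_le => [|i j]; first by rewrite mulr_ge0 // addr_ge0.
have -> : (h y - h z) i j = (mxvec (h y) - mxvec (h z)) 0 (mxvec_index i j).
  by rewrite !mxE !mxvecE.
apply: le_trans (mx_norm_coord _ _ _) _.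
rewrite -(subrK (jac (fun y => mxvec (h y)) x (y - z)) (mxvec (h y) - _)).
apply: le_trans (ler_normD _ _) _; rewrite addrC mulrDl; apply: lerD; first exact: jac_norm.
exact: rP.
Qed.

(** The form has a positive minimum on the compact unit sphere of the norm, and homogeneity extends
    the bound. *)
Lemma posdef_bound n (A : 'M[R]_n) : (forall w : 'rV[R]_n, w != 0 -> 0 < (w *m A *m w^T) 0 0) ->
  exists2 c : R, 0 < c & forall w : 'rV[R]_n, c * `|w| ^+ 2 <= (w *m A *m w^T) 0 0.
Proof.
move=> pA; pose q (w : 'rV[R]_n) : R := (w *m A *m w^T) 0 0.
have cq : continuous q.
  have [+ _] : Ck 0 setT (q : 'rV[R]_n -> R^o).
    apply: (Ck_mx 0 _ openT).1; apply: Ck_mulmx; [exact: openT| |].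
      by apply: Ck_mulmx; [exact: openT|exact: Ck_id|exact: Ck_cst].
    by apply: Ck_trmx; [exact: openT|exact: Ck_id].
  by move=> c w; exact: c.
pose S := [set w : 'rV[R]_n | `|w| = 1].
have scale w : w != 0 -> S (`|w|^-1 *: w).
  by move=> w0; rewrite /S /= normrZ normfV normr_id mulVf // normr_eq0.
have qZ (s : R) w : q (s *: w) = s ^+ 2 * q w.
  by rewrite /q -!scalemxAl linearZ /= -scalemxAr scalerA mxE expr2.
(* In dimension 0 the unit sphere is empty and every vector is 0. *)
have [[w1 Sw1]|nS] := pselect (S !=set0); last first.
  exists 1 => // w; have [->|/scale Sw] := eqVneq w 0; last by exfalso; apply: nS; eexists; exact: Sw.
  by rewrite normr0 expr0n /= mulr0 !mul0mx mxE.
have cS : compact S.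
  apply: bounded_closed_compact.
    by exists 1; split=> // M M1 w /= ->; exact: ltW.
  have -> : S = (fun w : 'rV[R]_n => `|w|) @^-1` [set 1] by [].
  apply: closed_comp; last exact: closed_eq.
  by move=> w _; exact: norm_continuous.
have [|w0 Sw0 minq] := @EVT_min_rV R n q S (ex_intro _ w1 Sw1) cS; first exact: continuous_subspaceT.
rewrite inE in Sw0.
exists (q w0); first by apply: pA; apply: contraPneq Sw0 => ->; rewrite /S /= normr0 => /eqP; rewrite eq_sym oner_eq0.
move=> w; have [->|w_n0] := eqVneq w 0; first by rewrite normr0 expr0n /= mulr0 !mul0mx mxE.
have nw : `|w| != 0 by rewrite normr_eq0.
have := minq (`|w|^-1 *: w); rewrite inE qZ => /(_ (scale w w_n0)) H.
by move: H; rewrite exprVn [leRHS]mulrC ler_pdivlMr // exprn_gt0 // normr_gt0.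
Qed.

Lemma row_mx_norm_le n1 n2 (a : 'rV[R]_n1) (b : 'rV[R]_n2) e : `|a| <= e -> `|b| <= e -> `|row_mx a b| <= e.
Proof.
move=> ae be; apply: mx_norm_le => [|i j]; first exact: le_trans ae.
by case: (split_ordP j) => l ->; rewrite ?row_mxEl ?row_mxEr; apply: le_trans (mx_norm_coord _ _ _) _.
Qed.

End BilinearBounds.

Section CurveFacts.
Variables (R : realType) (m : ambient).
Local Notation n := (ambient_dim m).
Local Notation coords := (coords R m).
Local Notation space := (@Defs.space R m).
Implicit Types gam del : emb R m.

Lemma curve_space gam t : space (curve gam t).
Proof. by have [+ _] := set_valP gam; exact. Qed.

Lemma curve_smooth gam : smooth_on setT (curve gam).
Proof.
move=> k; apply: Ck_pt => t _.
have [_ [[sm _] _ _ _]] := set_valP gam.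
have [U [F [oU Ut sF E]]] := sm t I.
apply: (@Ck_near_eq _ _ _ _ _ F); last by apply: Ck_sub (sF k) => _ ->.
move=> _ ->; apply: filterS (open_nbhs_nbhs (conj oU Ut)) => s Us.
by rewrite -E // inE.
Qed.

Lemma curve_period gam t : curve gam (t + 1) = curve gam t.
Proof. by have [_ [[_ +] _ _ _]] := set_valP gam; apply. Qed.

Lemma periodic_int (T : Type) (f : R -> T) : (forall t, f (t + 1) = f t) ->
  forall t (k : int), f (t + k%:~R) = f t.
Proof.
move=> f1 t k; have fn (j : nat) s : f (s + j%:R) = f s.
  by elim: j => [|j IH]; rewrite ?addr0 // mulrSr addrA f1.
case: k => k; first by rewrite -pmulrn fn.
by rewrite NegzE mulrNz -pmulrn -[LHS](fn k.+1) subrK.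
Qed.

Lemma curve_period_int gam t (k : int) : curve gam (t + k%:~R) = curve gam t.
Proof. exact: periodic_int (curve_period gam) t k. Qed.

Lemma curve_is_derive gam t : is_derive t (1 : R) (curve gam) (derive1 (curve gam) t).
Proof. by rewrite derive1E; apply: derivableP; have [_ /(_ 1)[+ _]] := curve_smooth gam 1%N; exact. Qed.

Lemma derive1_smooth gam : smooth_on setT (derive1 (curve gam)).
Proof.
have -> : derive1 (curve gam) = (fun t => 'D_1 (curve gam) t) by apply/funext => t; rewrite derive1E.
by move=> k; have [_ /(_ 1)[_]] := curve_smooth gam k.+1.
Qed.

Lemma derive1_is_derive gam t :
  is_derive t (1 : R) (derive1 (curve gam)) (derive1n 2 (curve gam) t).
Proof.
rewrite derive1nS derive1n1 derive1E; apply: derivableP.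
by have [_ /(_ 1)[+ _]] := derive1_smooth gam 1%N; exact.
Qed.

Lemma derive2_continuous gam : continuous (derive1n 2 (curve gam)).
Proof.
have -> : derive1n 2 (curve gam) = (fun t => 'D_1 (derive1 (curve gam)) t).
  by apply/funext => t; rewrite derive1nS derive1n1 derive1E.
by move=> t; have [_ /(_ 1)[_ [+ _]]] := derive1_smooth gam 1%N; exact.
Qed.

Lemma curve_velocity_period gam t (k : int) : derive1 (curve gam) (t + k%:~R) = derive1 (curve gam) t.
Proof.
have := curve_is_derive gam (t + k%:~R).
rewrite -[X in is_derive (X + _)]mul1r => /is_derive_affine; rewrite scale1r => -[_ <-].
by rewrite derive1E; congr ('D_(1 : R) _ t); apply/funext => s; rewrite mul1r curve_period_int.
Qed.

Lemma curve_inj gam s t : curve gam s = curve gam t -> exists k : int, t = s + k%:~R.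
Proof.
have [_ [_ inj _ _]] := set_valP gam; move/inj => /(_ I I)[k ->]; by exists k.
Qed.

(** The immersion clause of [embedding] concerns curves in the parameter space; the translation s ->
    s + t turns it into a statement at [t]. *)
Lemma curve_velocity_neq0 gam t : derive1 (curve gam) t != 0.
Proof.
have [_ [_ _ imm _]] := set_valP gam.
have dc : is_derive (0 : R) (1 : R) (fun s : R => s + t) 1.
  by have := is_derive_add (@is_derive_id _ _ (0 : R) (1 : R)) (is_derive_cst t (0 : R) (1 : R)); rewrite addr0.
have := imm (fun s : R => s + t : R^o) _ (fun=> I).
rewrite derive1E (derive_val (is_derive := dc)) oner_neq0 => H.
have sc : smooth_on setT (fun s : R^o => s + t : R^o).
  by move=> k; apply: CkD; [exact: openT|exact: Ck_id|exact: Ck_cst].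
have := H sc isT; apply: contraNN => /eqP d0.
have := curve_is_derive gam (1 * 0 + t); rewrite mul1r add0r d0.
have := @is_derive_affine R _ (curve gam) 1 t 0 0; rewrite mul1r add0r scaler0 => K /K [_ e].
rewrite derive1E -e; apply/eqP; congr ('D_(1 : R) _ (0 : R)); apply/funext => s /=; by rewrite mul1r.
Qed.

Lemma curve_tangent gam t : tangent (curve gam t) (derive1 (curve gam) t).
Proof.
case: (@sphere_signP R m) => [[s1 sx]|[s0 sx]]; last by have [] := sx (curve gam t).
apply/(sx (curve gam t)).2.
have := is_derive_dotp (curve_is_derive gam t) (curve_is_derive gam t).
have -> : (fun s => dotp (curve gam s) (curve gam s)) = cst 1.
  by apply/funext => s; apply/(sx (curve gam s)).1/curve_space.
move=> [_]; rewrite derive_cst dotpC => /esym/eqP.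
by rewrite -mulr2n mulrn_eq0 /= => /eqP.
Qed.

(** Bounded second derivatives make the velocity Lipschitz in time, which controls how fast normal
    planes turn. *)
Definition C2_ball gam (e : R) : set (emb R m) := [set del | forall t,
  [/\ `|curve del t - curve gam t| < e, `|derive1 (curve del) t - derive1 (curve gam) t| < e
    & `|derive1n 2 (curve del) t - derive1n 2 (curve gam) t| < e]].

Lemma C2_ball_sub gam e e' : e <= e' -> C2_ball gam e `<=` C2_ball gam e'.
Proof.
move=> ee del H t; have [a b c] := H t.
by split; [exact: (lt_le_trans a ee)|exact: (lt_le_trans b ee)|exact: (lt_le_trans c ee)].
Qed.

Lemma C2_ball_nbhs gam e : 0 < e -> nbhs gam (C2_ball gam e).
Proof.
move=> e0.
have near_k k : nbhs gam [set del | forall t,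
    `|derive1n k (curve del) t - derive1n k (curve gam) t| < e].
  pose A : set {uniform R^o -> coords} := [set h | forall t, `|h t - derive1n k (curve gam) t| < e].
  have cj : {for gam, continuous (fun del => jet del k : {uniform R^o -> coords})}.
    apply: (@continuous_comp _ _ _ (@jet R m) (@proj nat (fun=> {uniform R^o -> coords}) k)).
      exact: initial_continuous.
    exact: proj_continuous.
  apply: (cj A); apply/uniform_nbhs.
  exists [set xy | ball xy.1 e xy.2]; split; first exact: (entourage_ball _ (PosNum e0)).
  by move=> h H t; have := H t I; rewrite -ball_normE /= distrC.
have H := @filterI _ _ (nbhs_filter gam) _ _ (near_k 0%N) (@filterI _ _ (nbhs_filter gam) _ _ (near_k 1%N) (near_k 2%N)).
apply: (@filterS _ _ (nbhs_filter gam) _ _ _ H) => del [a [b c]] t.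
by have := b t; rewrite !derive1n1 => bt; split; [exact: a| |exact: c].
Qed.

End CurveFacts.

Section ChordEstimate.
Variables (R : realType) (n : nat).

(* dg is a chord of the curve, v and w are normal vectors at its ends and De is the chord
   joining the two tips; pairing De with the velocity (the covector x) controls |dt|. *)
Lemma chord_estimate (x tau dg v w De : 'rV[R]_n) (dt La q e : R) :
  let lam (u : 'rV[R]_n) := (x *m u^T) 0 0 in let T := `|tau| + 1 in
  0 < q -> 0 < La -> 0 < e -> e <= 2^-1 -> La * e * (1 + 4 * T) <= q / 8 ->
  (forall u, `|lam u| <= La * `|u|) -> q / 2 <= lam tau ->
  `|dg - dt *: tau| <= e * `|dt| -> lam v = 0 -> `|lam w| <= q / 8 * `|dt| ->
  `|De - (dg + (v - w))| <= e * (`|dg| + `|v - w|) ->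
  `|dt| + `|v - w| <= (8 * La / q + (2 + 24 * T * La / q)) * `|De|.
Proof.
move=> lam T q0 La0 e0 e2 eT lamle lamtau dgt lamv lamw DeE.
have lamB a b : lam (a - b) = lam a - lam b by rewrite /lam linearB mulmxBr /= !mxE.
have lamD a b : lam (a + b) = lam a + lam b by rewrite /lam linearD mulmxDr /= mxE.
have lamZ s a : lam (s *: a) = s * lam a by rewrite /lam linearZ -scalemxAr /= mxE.
have T1 : 1 <= T by rewrite /T lerDr.
have c_le : `|dg| <= T * `|dt|.
  rewrite -(subrK (dt *: tau) dg); apply: le_trans (ler_normD _ _) _.
  apply: le_trans (lerD dgt (lexx _)) _; rewrite normrZ /T mulrDl mul1r addrC (mulrC `|tau|) lerD2l.
  by rewrite ler_piMl //; move: e2; lra.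
have b_le : `|v - w| <= 2 * `|De| + 3 * T * `|dt|.
  have : `|v - w| <= `|De| + e * (`|dg| + `|v - w|) + `|dg|.
    have E : v - w = De - (De - (dg + (v - w))) - dg.
      by rewrite opprB [De + _]addrC subrK [dg + _]addrC addrK.
    rewrite {1}E; apply: le_trans (ler_normB _ _) _; rewrite lerD2r.
    by apply: le_trans (ler_normB _ _) _; rewrite lerD2l.
  have : e * (`|dg| + `|v - w|) <= 2^-1 * (`|dg| + `|v - w|) by rewrite ler_wpM2r // addr_ge0.
  by move: c_le; rewrite -mulrA; move: (T * `|dt|) => Tdt; lra.
(* [lam dg] is bounded below because [dg] is nearly [dt *: tau], and above because [lam] kills [v]
   and is small on [w]. With the bound on |v - w| above, the smallness of [e] absorbs all terms in
   |dt| but q / 4 of it. *)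
have lo : `|dt| * (q / 2) - La * (e * `|dt|) <= `|lam dg|.
  have -> : lam dg = dt * lam tau + lam (dg - dt *: tau) by rewrite lamB lamZ addrC subrK.
  have := ler_normB (dt * lam tau + lam (dg - dt *: tau)) (lam (dg - dt *: tau)).
  rewrite addrK normrM (ger0_norm (x := lam tau)); last by apply: le_trans lamtau; rewrite divr_ge0 // ltW.
  have : `|lam (dg - dt *: tau)| <= La * (e * `|dt|).
    by apply: le_trans (lamle _) _; rewrite ler_wpM2l // ltW.
  have : `|dt| * (q / 2) <= `|dt| * lam tau by rewrite ler_wpM2l.
  lra.
have hi : `|lam dg| <= La * `|De| + La * (e * (`|dg| + `|v - w|)) + q / 8 * `|dt|.
  have -> : lam dg = lam De - lam (De - (dg + (v - w))) + lam w.
    by rewrite (lamB De) (lamD dg) (lamB v) lamv; ring.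
  apply: le_trans (ler_normD _ _) _; apply: lerD => //.
  apply: le_trans (ler_normB _ _) _; apply: lerD; first exact: lamle.
  by apply: le_trans (lamle _) _; rewrite ler_wpM2l // ltW.
have D0 := normr_ge0 De; have a0 := normr_ge0 dt.
have a_le : `|dt| <= 8 * La / q * `|De|.
  have cb : La * (e * (`|dg| + `|v - w|)) <= La * e * (4 * T * `|dt| + 2 * `|De|).
    rewrite mulrA ler_wpM2l ?(mulr_ge0 (ltW La0) (ltW e0)) //; move: c_le b_le; rewrite -!mulrA.
    by move: (T * `|dt|) => Tdt; lra.
  have : La * e * (1 + 4 * T) * `|dt| <= q / 8 * `|dt| by rewrite ler_wpM2r.
  have : La * e * `|De| <= La * 2^-1 * `|De| by rewrite ler_wpM2r // ler_wpM2l // ltW.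
  move: lo hi cb; set a := `|dt|; set D := `|De| => lo hi cb h1 h2.
  have H : q / 4 * a <= 2 * La * D.
    have E1 : La * e * (1 + 4 * T) * a = La * e * a + 4 * (La * e * T * a) by ring.
    have E2 : La * e * (4 * T * a + 2 * D) = 4 * (La * e * T * a) + 2 * (La * e * D) by ring.
    have E3 : La * (e * a) = La * e * a by rewrite mulrA.
    rewrite E1 in h2; rewrite E2 in cb; rewrite E3 in lo.
    have E4 : La * 2^-1 * D = 2^-1 * (La * D) by ring.
    have E5 : 2 * La * D = 2 * (La * D) by ring.
    rewrite E4 in h1; rewrite E5.
    have E6 : q / 4 * a = 2 * (q / 8 * a) by field.
    have E7 : a * (q / 2) = 4 * (q / 8 * a) by field.
    rewrite E6; rewrite E7 in lo; lra.
  rewrite (_ : 8 * La / q * D = (2 * La * D) * (4 / q)); last by field; rewrite gt_eqF.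
  by rewrite -ler_pdivrMr ?divr_gt0 // (_ : a / (4 / q) = q / 4 * a) //; field; rewrite gt_eqF.
have : 3 * T * `|dt| <= 3 * T * (8 * La / q * `|De|) by rewrite ler_wpM2l // mulr_ge0 //; lra.
rewrite (_ : (8 * La / q + (2 + 24 * T * La / q)) * `|De| =
  8 * La / q * `|De| + (2 * `|De| + 3 * T * (8 * La / q * `|De|))); last by ring.
by move: a_le b_le; lra.
Qed.

End ChordEstimate.

Section MeanValue.
Variable R : realType.

Lemma mean_value_ball n (y dy : R -> 'rV[R]_n) (t0 ka B s t : R) :
  (forall u, `|u - t0| <= ka -> is_derive u (1 : R) y (dy u)) ->
  (forall u, `|u - t0| <= ka -> `|dy u| <= B) ->
  `|s - t0| <= ka -> `|t - t0| <= ka -> `|y t - y s| <= B * `|t - s|.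
Proof.
move=> yd dyB; wlog st : s t / s <= t => [hw sk tk|sk tk].
  by have [/hw|/ltW/hw H] := leP s t; [exact|rewrite distrC (distrC t); exact: H].
have inb u : s <= u <= t -> `|u - t0| <= ka.
  by move: sk tk; rewrite !ler_norml; lra.
rewrite (@ger0_norm _ (t - s)) ?subr_ge0 // mulrBr.
apply: (derive_majorant (dy := dy) (h := fun u => B * u) (dh := fun=> B)) => //.
- by move=> u /inb /yd.
- by move=> u _; have := is_deriveZ B (@is_derive_id _ _ u (1 : R)); rewrite [_ *: 1]mulr1; exact.
- by move=> u /inb /dyB.
Qed.

Lemma near_mul_le (K e : R) : 0 < e -> \forall rho \near 0^'+, K * rho <= e.
Proof.
move=> e0; have K1 : 0 < `|K| + 1 by rewrite ltr_wpDl.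
near=> rho; have r0 : 0 < rho by near: rho; exact: nbhs_right_gt.
apply: (@le_trans _ _ ((`|K| + 1) * rho)).
  by rewrite ler_pM2r // ler_wpDr // ler_norm.
rewrite mulrC -ler_pdivlMr //; near: rho; apply: nbhs_right_le; exact: divr_gt0.
Unshelve. all: by end_near.
Qed.

End MeanValue.

Section LocalTube.
Variables (R : realType) (m : ambient).
Local Notation n := (ambient_dim m).
Local Notation coords := (coords R m).
Local Notation space := (@Defs.space R m).
Implicit Types (gam del : emb R m) (g : tensor R m).

Lemma C2_ball_near gam (t0 rho : R) : 0 < rho -> exists2 k : R, 0 < k &
  forall del, C2_ball gam k^-1 del -> forall t, `|t - t0| <= k^-1 ->
  [/\ `|curve del t - curve gam t0| <= rho, `|derive1 (curve del) t - derive1 (curve gam) t0| <= rho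
    & `|derive1n 2 (curve del) t - derive1n 2 (curve gam) t0| <= rho].
Proof.
move=> rho0; have r2 : 0 < rho / 2 by rewrite divr_gt0.
have near_t (h : R -> coords) : continuous h -> exists2 d, 0 < d & forall t, `|t - t0| < d -> `|h t - h t0| < rho / 2.
  move=> ch; have /cvgrPdist_lt/(_ _ r2)/nbhs_ballP[d /= d0 dP] := ch t0.
  by exists d => // t td; rewrite distrC; apply: dP; rewrite -ball_normE /= distrC.
have c0 : continuous (curve gam) by move=> t; have [+ _] := curve_smooth gam 0%N; exact.
have c1 : continuous (derive1 (curve gam)) by move=> t; have [+ _] := derive1_smooth gam 0%N; exact.
have [d0 d00 d0P] := near_t _ c0; have [d1 d10 d1P] := near_t _ c1.
have [d2 d20 d2P] := near_t _ (@derive2_continuous R m gam).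
(* Half of [rho] is spent on passing from [del] to [gam] and half on passing from [t] to [t0]. *)
exists (2 / rho + (d0^-1 + d1^-1 + d2^-1)).
  by rewrite addr_gt0 ?divr_gt0 // !addr_gt0 // invr_gt0.
set k := _ + _; have sm d : 0 < d -> d^-1 < k -> k^-1 < d.
  by move=> d0' dk; rewrite -(invrK d) ltf_pV2 // posrE ?invr_gt0 //; apply: lt_trans dk; rewrite invr_gt0.
have p0 := divr_gt0 (ltr0Sn R 1) rho0.
have [q0 [q1 q2]] : 0 < d0^-1 /\ 0 < d1^-1 /\ 0 < d2^-1 by rewrite !invr_gt0.
have kr : k^-1 <= rho / 2.
  rewrite -(invrK (rho / 2)) lef_pV2 ?posrE ?invr_gt0 //; first by rewrite invf_div /k; lra.
  by rewrite /k; lra.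
have kd : d0^-1 < k /\ d1^-1 < k /\ d2^-1 < k.
  rewrite /k; move: (2 / rho) (d0^-1) (d1^-1) (d2^-1) p0 q0 q1 q2; clear.
  by move=> a b c d ? ? ? ?; lra.
move=> del Hdel t tk; have [a b c] := Hdel t.
have tri (x y z : coords) : `|x - y| < k^-1 -> `|y - z| < rho / 2 -> `|x - z| <= rho.
  move=> xy yz; rewrite -(subrKA y); apply: le_trans (ler_normD _ _) _.
  by rewrite [leRHS]splitr (lerD (le_trans (ltW xy) kr) (ltW yz)).
split; [apply: tri a _; apply: d0P|apply: tri b _; apply: d1P|apply: tri c _; apply: d2P];
  apply: le_lt_trans tk _; apply: sm.
- exact: d00.
- exact: kd.1.
- exact: d10.
- exact: kd.2.1.
- exact: d20.
- exact: kd.2.2.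
Qed.

(** The constants for speed, norm comparison and separation are merged with the inverses of the
    radii in C^2 distance, time and normal direction, so that the statement is monotone in [k]. It
    ranges over all [del] near [gam]. *)
Definition tube_ok g (D : set 'rV[R]_(n + n)) (E : 'rV[R]_(n + n) -> coords) gam (k t0 : R) :=
  0 < k /\ forall del, C2_ball gam k^-1 del ->
  (forall t, `|t - t0| <= k^-1 ->
    [/\ bilin (g (curve del t)) (derive1 (curve del) t) (derive1 (curve del) t) <= k,
        forall v, tangent (curve del t) v -> `|v| ^+ 2 <= k * bilin (g (curve del t)) v v &
        forall v : coords, `|v| <= k^-1 -> D (row_mx (curve del t) v)]) /\
  (forall t s (v w : coords), `|t - t0| <= k^-1 -> `|s - t0| <= k^-1 -> `|v| <= k^-1 -> `|w| <= k^-1 ->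
    bilin (g (curve del t)) (derive1 (curve del) t) v = 0 ->
    bilin (g (curve del s)) (derive1 (curve del) s) w = 0 ->
    `|t - s| + `|v - w| <= k * `|E (row_mx (curve del t) v) - E (row_mx (curve del s) w)|).

Lemma tube_ok_le g D E gam k k' t0 : k <= k' -> tube_ok g D E gam k t0 -> tube_ok g D E gam k' t0.
Proof.
move=> kk [k0 ok]; have k'0 : 0 < k' by apply: lt_le_trans kk.
have kV : k'^-1 <= k^-1 by rewrite lef_pV2.
split=> // del /(C2_ball_sub kV)/ok[H1 H2]; split=> [t tk|t s v w tk sk vk wk tv sw].
  have [a b c] := H1 t (le_trans tk kV); split=> [|v Tv|v vk]; first exact: le_trans kk.
    (* Enlarging the constant needs [bilin] to be nonnegative, which the bound with the smaller
       constant implies. *)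
    apply: le_trans (b v Tv) _; have [->|v0] := eqVneq v 0; first by rewrite /bilin mul0mx mul0mx mxE !mulr0.
    rewrite ler_wpM2r //; have : 0 < k * bilin (g (curve del t)) v v.
      by apply: lt_le_trans (b v Tv); rewrite exprn_gt0 // normr_gt0.
    by rewrite pmulr_rgt0 // => /ltW.
  by apply: c; exact: le_trans kV.
apply: le_trans (H2 t s v w _ _ _ _ tv sw) _; try exact: le_trans kV.
by rewrite ler_wpM2r.
Qed.

(** Halving the radius leaves room to move the centre; this opens the pointwise statement for the
    compactness argument. *)
Lemma tube_ok_near g D E gam k t0 : tube_ok g D E gam k t0 ->
  \forall t \near t0, tube_ok g D E gam (2 * k) t.
Proof.
move=> [k0 ok]; have k20 : 0 < (2 * k)^-1 by rewrite invr_gt0 mulr_gt0.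
have kk : k <= 2 * k by rewrite ler_peMl // ?ler1n // ltW.
have half : (2 * k)^-1 + (2 * k)^-1 = k^-1 by rewrite invfM; field; rewrite gt_eqF.
apply: filterS (@near_dist_lt R R t0 _ k20) => t1 t1k.
have [_ ok2] := tube_ok_le kk (conj k0 ok).
have tri t : `|t - t1| <= (2 * k)^-1 -> `|t - t0| <= k^-1.
  by move=> tt1; rewrite -(subrKA t1) (le_trans (ler_normD _ _)) // -half lerD // ltW.
have kV : (2 * k)^-1 <= k^-1 by rewrite -half lerDl ltW.
split; first by rewrite mulr_gt0.
move=> del dk; have [H1 H2] := ok del (C2_ball_sub kV dk).
split=> [t /tri tk|t s v w /tri tk /tri sk vk wk tv sw].
  have [a b c] := H1 t tk; split=> [|v Tv|v vk]; first exact: le_trans kk.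
    apply: le_trans (b v Tv) _; have [->|v0] := eqVneq v 0; first by rewrite /bilin mul0mx mul0mx mxE !mulr0.
    rewrite ler_wpM2r //; have : 0 < k * bilin (g (curve del t)) v v.
      by apply: lt_le_trans (b v Tv); rewrite exprn_gt0 // normr_gt0.
    by rewrite pmulr_rgt0 // => /ltW.
  by apply: c; exact: le_trans kV.
apply: le_trans (H2 t s v w tk sk _ _ tv sw) _; try exact: le_trans kV.
by rewrite ler_wpM2r.
Qed.

End LocalTube.

Section PairingBounds.
Variables (R : realType) (n : nat).
Implicit Types (G A : 'M[R]_n) (u v w tau : 'rV[R]_n).
Local Notation N := ((n * n)%:R : R).
Local Notation pair G u v := ((u *m G *m v^T) 0 0).

Lemma pair_le G u v (Gn T : R) : `|G| <= Gn -> `|u| <= T -> `|pair G u v| <= N * Gn * T * `|v|.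
Proof.
move=> GG uu; apply: le_trans (bilin_norm _ _ _) _; rewrite ler_wpM2r //.
by rewrite ler_pM ?mulr_ge0 // ler_wpM2l.
Qed.

Lemma pairB G G' u u' v : pair G u v - pair G' u' v = pair (G - G') u v + pair G' (u - u') v.
Proof. by rewrite mulmxBr !mulmxBl !mxE; ring. Qed.

(** At the base point the pairing is the squared speed [q]; small changes of metric and velocity
    leave at least half of it. *)
Lemma pair_lower G0 G tau u (Lg Gn T r q : R) : 0 <= Lg -> 0 <= r -> q = pair G0 tau tau ->
  `|G - G0| <= Lg * r -> `|G0| <= Gn -> `|u| <= T -> `|u - tau| <= r -> `|tau| <= T ->
  N * (Lg * T * T + Gn * T) * r <= q / 2 -> q / 2 <= pair G u tau.
Proof.
move=> Lg0 r0 qE GG G0n uT ur tT small.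
have h1 := pair_le tau GG uT; have h2 := pair_le tau (lexx `|G0|) ur.
have T0 : 0 <= T := le_trans (normr_ge0 _) tT.
have h3 : N * (Lg * r) * T * `|tau| + N * `|G0| * r * `|tau| <= N * (Lg * T * T + Gn * T) * r.
  have -> : N * (Lg * T * T + Gn * T) * r = N * (Lg * r) * T * T + N * Gn * r * T by ring.
  apply: lerD; first by rewrite ler_wpM2l // !mulr_ge0.
  apply: ler_pM => //; first by rewrite !mulr_ge0.
  by rewrite ler_wpM2r // ler_wpM2l.
have E := pairB G G0 u tau tau; rewrite -qE in E.
move: h1 h2; rewrite !ler_norml => /andP[h1 _] /andP[h2 _].
by move: E h1 h2 h3 small; move: (pair G u tau) (pair (G - G0) u tau) (pair G0 (u - tau) tau) => ? ? ?; lra.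
Qed.

(** Here [a] is a time difference. A vector normal at one time is nearly normal at the other, with
    an error proportional to [a] since metric and velocity are Lipschitz; the factor is small
    because [w] is short. *)
Lemma pair_normal G G' u u' w (Lg Gn T B r q a : R) : 0 <= Lg -> 0 <= Gn -> 0 <= B -> 0 <= a ->
  `|G - G'| <= Lg * (T * a) -> `|G'| <= Gn -> `|u| <= T -> `|u - u'| <= B * a ->
  pair G' u' w = 0 -> `|w| <= r -> N * (Lg * T * T + Gn * B) * r <= q ->
  `|pair G u w| <= q * a.
Proof.
move=> Lg0 Gn0 B0 a0 GG Gn' uT uu w0 wr small.
have -> : pair G u w = pair G u w - pair G' u' w by rewrite w0 subr0.
rewrite pairB; apply: le_trans (ler_normD _ _) _.
apply: le_trans (lerD (pair_le w GG uT) (pair_le w Gn' uu)) _.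
have -> : N * (Lg * (T * a)) * T * `|w| + N * Gn * (B * a) * `|w| =
  N * (Lg * T * T + Gn * B) * `|w| * a by ring.
rewrite ler_wpM2r //; apply: le_trans small; rewrite ler_wpM2l // mulr_ge0 // addr_ge0 //.
  by rewrite !mulr_ge0 // (le_trans _ uT).
exact: mulr_ge0.
Qed.

Lemma pair_posdef A A0 v (c Lr : R) : c * `|v| ^+ 2 <= pair A0 v v -> `|A - A0| <= Lr ->
  N * Lr <= c / 2 -> c / 2 * `|v| ^+ 2 <= pair A v v.
Proof.
move=> cA AA small.
have H1 := le_trans (bilin_norm (A - A0) v v) (lexx _).
have H2 : N * `|A - A0| * `|v| * `|v| <= c / 2 * `|v| ^+ 2.
  by rewrite expr2 -mulrA ler_wpM2r ?mulr_ge0 //; apply: le_trans small; rewrite ler_wpM2l.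
have H3 : pair A v v = pair A0 v v + pair (A - A0) v v by rewrite mulmxBr mulmxBl !mxE; ring.
move: cA (le_trans H1 H2); rewrite ler_norml H3 => cA /andP[].
by move: cA; move: (`|v| ^+ 2) (pair A0 v v) (pair (A - A0) v v) => ? ? ?; lra.
Qed.

(** Each of these finitely many conditions holds for all sufficiently small positive [r]. *)
Lemma small_radius (e rg rD rE rh Lg K1 C NL q1 q2 q3 : R) :
  0 < e -> 0 < rg -> 0 < rD -> 0 < rE -> 0 < rh -> 0 < q1 -> 0 < q2 -> 0 < q3 ->
  exists r : R, [/\ [/\ 0 < r, r <= 1 & r <= e], [/\ r < rg, r < rD, r + r < rE & r < rh] &
    [/\ Lg * r <= 1, K1 * r <= q1, C * r <= q2 & NL * r <= q3]].
Proof.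
move=> e0 rg0 rD0 rE0 rh0 q10 q20 q30.
have rE2 : 0 < rE / 2 by rewrite divr_gt0.
suff : \forall r \near (0 : R)^'+, [/\ [/\ 0 < r, r <= 1 & r <= e], [/\ r < rg, r < rD, r < rE / 2 & r < rh] &
  [/\ Lg * r <= 1, K1 * r <= q1, C * r <= q2 & NL * r <= q3]].
  move=> H; have [r [a [b b' d f] c]] := filter_ex H; exists r; split=> //; split=> //.
  by rewrite [ltRHS](splitr rE) ltrD.
have h1 := @nbhs_right_gt R 0; have h2 := @nbhs_right_le R 0 1 ltr01.
have h3 := nbhs_right_le e0; have h4 := nbhs_right_lt rg0; have h5 := nbhs_right_lt rD0.
have h6 := nbhs_right_lt rE2; have h7 := nbhs_right_lt rh0.
have h8 := near_mul_le Lg (@ltr01 R); have h9 := near_mul_le K1 q10.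
have h10 := near_mul_le C q20; have h11 := near_mul_le NL q30.
by near=> r; split; split; near: r.
Unshelve. all: by end_near.
Qed.

Lemma sum5_ge (a b c d e : R) : 0 <= a -> 0 <= b -> 0 <= c -> 0 <= d -> 0 <= e ->
  let s := a + b + c + d + e in [/\ a <= s, b <= s, c <= s, d <= s & e <= s].
Proof. by move=> a0 b0 c0 d0 e0 /=; split; lra. Qed.

End PairingBounds.

Section TubeLocal.
Variables (R : realType) (m : ambient).
Local Notation n := (ambient_dim m).
Local Notation coords := (coords R m).
Local Notation space := (@Defs.space R m).
Implicit Types (gam del : emb R m) (g : tensor R m).

Definition exp_chart g (D : set 'rV[R]_(n + n)) (E : 'rV[R]_(n + n) -> coords) :=
  [/\ open D, smooth_on D E,
      forall p : coords, space p -> [/\ D (row_mx p 0), E (row_mx p 0) = p &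
        forall xi eta, is_derive (row_mx p 0) (row_mx xi eta) E (xi + eta)] &
      forall p v : coords, space p -> tangent p v -> D (row_mx p v) ->
        exp_rel g p v (E (row_mx p v)) /\ exp_map g p v = E (row_mx p v)].

Lemma row_mx_norm_add (a b : coords) : `|row_mx a b : 'rV[R]_(n + n)| <= `|a| + `|b|.
Proof. by apply: row_mx_norm_le; rewrite ?lerDl ?lerDr. Qed.

Lemma chord_bounds del (tau : coords) (t0 ka e T B s t : R) :
  (forall u, `|u - t0| <= ka -> `|derive1 (curve del) u - tau| <= e) ->
  (forall u, `|u - t0| <= ka -> `|derive1 (curve del) u| <= T) ->
  (forall u, `|u - t0| <= ka -> `|derive1n 2 (curve del) u| <= B) ->
  `|t - t0| <= ka -> `|s - t0| <= ka ->
  [/\ `|curve del t - curve del s - (t - s) *: tau| <= e * `|t - s|,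
      `|curve del t - curve del s| <= T * `|t - s| &
      `|derive1 (curve del) t - derive1 (curve del) s| <= B * `|t - s|].
Proof.
move=> de dT dB tk sk; split.
- have := @mean_value_ball R _ (fun z => curve del z - z *: tau)
    (fun z => derive1 (curve del) z - tau) t0 ka e s t.
  have -> : curve del t - curve del s - (t - s) *: tau =
      curve del t - t *: tau - (curve del s - s *: tau).
    by rewrite scalerBl; apply/rowP => i; rewrite !mxE; ring.
  apply=> // z zk; apply: is_derive_sub; first exact: curve_is_derive.
  apply: is_derive_mx => i j; under eq_fun do rewrite mxE mulrC.
  by have := is_deriveZ (tau i j) (@is_derive_id _ _ z (1 : R)); rewrite [_ *: 1]mulr1; exact.
- exact: (@mean_value_ball R _ (curve del) (derive1 (curve del)) t0 ka T s t
    (fun z _ => curve_is_derive del z) dT sk tk).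
- exact: (@mean_value_ball R _ (derive1 (curve del)) (derive1n 2 (curve del)) t0 ka B s t
    (fun z _ => derive1_is_derive del z) dB sk tk).
Qed.

(** As the derivative of [E] at (p, 0) is xi + eta, the tips of two normal vectors differ by nearly
    the chord of the curve plus v - w. [chord_estimate] recovers both summands from it. *)
Lemma tube_local g D E gam t0 : riemannian g -> exp_chart g D E -> exists k, tube_ok g D E gam k t0.
Proof.
move=> gr [oD sE rest _].
have [[U [oU SU sg _]] pos] := gr.
pose p := curve gam t0; pose tau := derive1 (curve gam) t0.
have Sp : space p by exact: curve_space.
have [D0 _ DE] := rest p Sp.
have q0 : 0 < bilin (g p) tau tau by apply: pos; [done|exact: curve_tangent|exact: curve_velocity_neq0].
set q := bilin (g p) tau tau in q0.
have Up : U p by exact: SU.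
have [Lg [rg [Lg0 rg0 lipg]]] := C1_lipschitz oU Up (sg 1%N).
have rho_p : rho p != 0 by have [[_ ?] _] := space_acc_dom gr SU Sp.
have oU' := open_rho oU.
have Up' : [set x : coords | U x /\ rho x != 0] p by split.
have CH : Ck 1 [set x : coords | U x /\ rho x != 0] (bordered_metric g).
  by apply: Ck_bordered_metric => //; [move=> x []|apply: Ck_sub (sg 1%N) => x []].
have [Lh [rh [Lh0 rh0 liph]]] := C1_lipschitz oU' Up' CH.
have [c c0 Hc] := posdef_bound (fun w w0 => bordered_metric_pos gr Sp w0).
have /nbhs_ballP[rD /= rD0 inD] := open_nbhs_nbhs (conj oD D0).
pose N : R := (n * n)%:R; have N0 : 0 <= N by rewrite ler0n.
pose T := `|tau| + 1; have T1 : 1 <= T by rewrite lerDr.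
pose Gn := `|g p| + 1; have Gn1 : 1 <= Gn by rewrite lerDr.
(* A bound for the covector [u *m g x], made positive by the summand 1. *)
pose La := N * Gn * T + 1.
have NGT : 0 <= N * Gn * T by rewrite !mulr_ge0 // (le_trans ler01).
have La0 : 0 < La by rewrite ltr_wpDl.
(* The two smallness conditions of [chord_estimate]. *)
pose e := Num.min 2^-1 (q / 8 / (La * (1 + 4 * T))).
have LaT : 0 < La * (1 + 4 * T) by rewrite mulr_gt0 // addr_gt0 // mulr_gt0 // (lt_le_trans ltr01).
have e0 : 0 < e by rewrite lt_min invr_gt0 ltr0n /= !divr_gt0.
have e2 : e <= 2^-1 by rewrite ge_min lexx.
have eT : La * e * (1 + 4 * T) <= q / 8.
  rewrite mulrAC mulrC -ler_pdivlMr //; by rewrite /e ge_min lexx orbT.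
have [rE rE0 strE] := jac_strict oD D0 (sE 1%N) e0.
have jacE xi eta : jac E (row_mx p 0) (row_mx xi eta) = xi + eta.
  by rewrite /jac -(derive_mx_sum _ oD D0 (sE 1%N)); have [_] := DE xi eta.
pose B2 := `|derive1n 2 (curve gam) t0| + 1.
pose C := N * (Lg * T * T + Gn * B2).
pose K1 := N * (Lg * T * T + Gn * T).
have q8 : 0 < q / 8 by rewrite divr_gt0.
have q2 : 0 < q / 2 by rewrite divr_gt0.
have c2 : 0 < c / 2 by rewrite divr_gt0.
have [r [[r0 r1 re] [rrg rrD rrE rrh] [hLg hK1 hC hLh]]] :=
  small_radius Lg K1 C (N * Lh) e0 rg0 rD0 rE0 rh0 q2 q8 c2.
have [k0 k00 k0P] := C2_ball_near gam t0 r0.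
pose M := 8 * La / q + (2 + 24 * T * La / q).
have T0 : 0 <= T := le_trans ler01 T1.
have Gn0 : 0 <= Gn := le_trans ler01 Gn1.
have M0 : 0 <= M by rewrite /M !addr_ge0 // divr_ge0 ?(ltW q0) // ?mulr_ge0 // ltW.
pose W := N * Gn * T * T; have W0 : 0 <= W by rewrite mulr_ge0.
have rV0 : 0 < r^-1 by rewrite invr_gt0.
have c20 : 0 < 2 / c by rewrite divr_gt0.
(* In order: C^2-closeness, the radius [r], the separation constant of [chord_estimate], the squared
   speed, and the comparison of norms on tangent vectors. *)
pose k := k0 + r^-1 + M + W + 2 / c.
have [kk0 krV kM kW kc] := sum5_ge (ltW k00) (ltW rV0) M0 W0 (ltW c20); rewrite -/k in kk0 krV kM kW kc.
have kp : 0 < k by exact: lt_le_trans kk0.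
have kr : k^-1 <= r by rewrite -(invrK r) lef_pV2 // posrE.
have kVk0 : k^-1 <= k0^-1 by rewrite lef_pV2.
exists k; split=> // del /(C2_ball_sub kVk0) Hdel.
have near_t t : `|t - t0| <= k^-1 -> [/\ `|curve del t - p| <= r,
   `|derive1 (curve del) t - tau| <= r & `|derive1n 2 (curve del) t| <= B2].
  move=> tk; have [a b d] := k0P del Hdel t (le_trans tk kVk0).
  split; [exact: a|exact: b|].
  rewrite -(subrK (derive1n 2 (curve gam) t0) (derive1n 2 _ t)); apply: le_trans (ler_normD _ _) _.
  by rewrite /B2 addrC lerD2l; exact: le_trans d r1.
have g_t x : `|x - p| <= r -> `|g x - g p| <= Lg * r /\ `|g x| <= Gn.
  move=> xr; have pp : `|p - p| < rg by rewrite subrr normr0.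
  have H : `|g x - g p| <= Lg * r.
    apply: le_trans (lipg x p (le_lt_trans xr rrg) pp) _.
    by apply: ler_wpM2l; [exact: ltW|exact: xr].
  split; first exact: H.
  rewrite -(subrK (g p) (g x)); apply: le_trans (ler_normD _ _) _; rewrite /Gn addrC lerD2l.
  exact: le_trans H hLg.
have v_t t : `|t - t0| <= k^-1 -> `|derive1 (curve del) t| <= T.
  move=> /near_t[_ b _]; rewrite -(subrK tau (derive1 _ t)); apply: le_trans (ler_normD _ _) _.
  by rewrite /T addrC lerD2l; exact: le_trans b r1.
split=> [t tk|t s v w tk sk vk wk tv sw].
  have [a b d] := near_t t tk; have [ga gb] := g_t _ a; split.
  - apply: le_trans kW; apply: le_trans (ler_norm _) _.
    apply: le_trans (pair_le _ gb (v_t t tk)) _.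
    by apply: ler_wpM2l; [exact: NGT|exact: v_t].
  - move=> v Tv; rewrite -(bordered_metric_tangent g Tv).
    have pp : `|p - p| < rh by rewrite subrr normr0.
    have Hx := liph (curve del t) p (le_lt_trans a rrh) pp.
    have Hr : Lh * `|curve del t - p| <= Lh * r.
      by apply: ler_wpM2l; [exact: ltW|exact: a].
    have NLr : N * (Lh * r) <= c / 2 by rewrite mulrA.
    have H4 := pair_posdef (Hc v) (le_trans Hx Hr) NLr.
    have -> : `|v| ^+ 2 = 2 / c * (c / 2 * `|v| ^+ 2) by field; rewrite gt_eqF.
    apply: ler_pM; [exact: ltW| |exact: kc|exact: H4].
    by apply: mulr_ge0; [exact: ltW|exact: sqr_ge0].
  - move=> v vk; apply: inD; rewrite -ball_normE /= distrC opp_row_mx add_row_mx oppr0 addr0.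
    by apply: le_lt_trans rrD; apply: row_mx_norm_le; [exact: a|exact: le_trans vk kr].
have [a b d] := near_t t tk; have [ga gb] := g_t _ a.
have [a' b' d'] := near_t s sk; have [ga' gb'] := g_t _ a'.
have uT := v_t t tk; have u'T := v_t s sk.
have d_e z : `|z - t0| <= k^-1 -> `|derive1 (curve del) z - tau| <= e.
  by move=> /near_t[_ H _]; exact: le_trans H re.
have d_B z : `|z - t0| <= k^-1 -> `|derive1n 2 (curve del) z| <= B2 by move=> /near_t[].
have [chord xy uu] := chord_bounds d_e v_t d_B tk sk.
set x := curve del t in a ga gb tv chord xy *; set y := curve del s in a' ga' gb' sw chord xy *.
set u := derive1 (curve del) t in b tv uT uu *; set u' := derive1 (curve del) s in b' sw u'T uu *.
have vr := le_trans vk kr; have wr := le_trans wk kr.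
pose De := E (row_mx x v) - E (row_mx y w).
have DeE : `|De - (x - y + (v - w))| <= e * (`|x - y| + `|v - w|).
  have := strE (row_mx x v) (row_mx y w).
  rewrite !opp_row_mx !add_row_mx !oppr0 !addr0 jacE => H.
  have zr z1 (z2 : coords) : `|z1 - p| <= r -> `|z2| <= r -> `|row_mx (z1 - p) z2 : 'rV[R]_(n + n)| < rE.
    by move=> h1 h2; apply: le_lt_trans (row_mx_norm_add _ _) _; apply: le_lt_trans (lerD h1 h2) rrE.
  apply: le_trans (H (zr _ _ a vr) (zr _ _ a' wr)) _.
  by rewrite ler_pM2l // row_mx_norm_add.
(* The covector is the [g]-pairing with the velocity at [t], which vanishes on [v] exactly and on
   [w] approximately. *)
apply: le_trans (@chord_estimate R n (u *m g x) tau (x - y) v w De (t - s) La q e q0 La0 e0 e2 eT _ _ chord tv _ DeE) _.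
- move=> z; apply: le_trans (pair_le _ gb uT) _.
  by apply: ler_wpM2r; [exact: normr_ge0|rewrite lerDl; exact: ler01].
- have tT : `|tau| <= T by rewrite lerDl; exact: ler01.
  have G0n : `|g p| <= Gn by rewrite lerDl; exact: ler01.
  exact: (pair_lower (ltW Lg0) (ltW r0) (erefl q) ga G0n uT b tT hK1).
- have xg : `|x - p| < rg := le_lt_trans a rrg; have yg : `|y - p| < rg := le_lt_trans a' rrg.
  have gxy : `|g x - g y| <= Lg * (T * `|t - s|).
    apply: le_trans (lipg x y xg yg) _.
    by apply: ler_wpM2l; [exact: ltW|exact: xy].
  have B20 : 0 <= B2 by apply: addr_ge0; [exact: normr_ge0|exact: ler01].
  exact: (pair_normal (ltW Lg0) Gn0 B20 (normr_ge0 (t - s)) gxy gb' uT uu sw wr hC).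
- by apply: ler_wpM2r; [exact: normr_ge0|exact: kM].
Qed.

End TubeLocal.

(** * Separation of normal discs along the whole circle *)

Section TubeGlobal.
Variables (R : realType) (m : ambient).
Local Notation n := (ambient_dim m).
Local Notation coords := (coords R m).
Local Notation space := (@Defs.space R m).
Implicit Types (gam del : emb R m) (g : tensor R m).

Lemma tube_uniform g D E gam : riemannian g -> exp_chart g D E ->
  exists2 k, 0 < k & forall t0, 0 <= t0 <= 1 -> tube_ok g D E gam k t0.
Proof.
move=> gr ch; have [k k' t0||k k0 kP] := @compact_uniform R R `[0, 1] (tube_ok g D E gam) (@segment_compact _ _ _).
- exact: tube_ok_le.
- move=> t0 _; have [k ok] := tube_local gam t0 gr ch.
  by exists (2 * k); exact: tube_ok_near.
- by exists k => // t0 t01; apply: kP; rewrite /= in_itv.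
Qed.

(** The second entry of [x] is an offset. Pairs of parameters that are apart on the circle then form
    the compact rectangle [0, 1] x [d, 1 - d]. *)
Definition far_ok (E : 'rV[R]_(n + n) -> coords) gam (k : R) (x : R * R) :=
  0 < k /\ forall del, C2_ball gam k^-1 del -> forall v w : coords, `|v| <= k^-1 -> `|w| <= k^-1 ->
  k^-1 <= `|E (row_mx (curve del x.1) v) - E (row_mx (curve del (x.1 + x.2)) w)|.

Lemma far_ok_le E gam k k' x : k <= k' -> far_ok E gam k x -> far_ok E gam k' x.
Proof.
move=> kk [k0 ok]; have k'0 : 0 < k' := lt_le_trans k0 kk.
have kV : k'^-1 <= k^-1 by rewrite lef_pV2.
split=> // del /(C2_ball_sub kV) dk v w vk wk.
exact: le_trans kV (ok del dk v w (le_trans vk kV) (le_trans wk kV)).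
Qed.

Lemma exp_chart_near g D E gam t0 (e : R) : exp_chart g D E -> 0 < e ->
  exists2 k : R, 0 < k & forall del, C2_ball gam k^-1 del -> forall t, `|t - t0| <= k^-1 ->
  forall v : coords, `|v| <= k^-1 -> `|E (row_mx (curve del t) v) - curve gam t0| <= e.
Proof.
move=> [oD sE rest _] e0.
have [D0 E0 _] := rest _ (curve_space gam t0).
have cE : {for row_mx (curve gam t0) 0, continuous E} by have [+ _] := sE 0%N; exact.
have /cvgrPdist_le/(_ e e0)/nbhs_ballP[r /= r0 rP] := cE.
have r20 : 0 < r / 2 by rewrite divr_gt0.
have [k k0 kP] := C2_ball_near gam t0 r20.
have kp : 0 < k + 2 / r by rewrite addr_gt0 // divr_gt0.
have V1 : (k + 2 / r)^-1 <= k^-1 by rewrite lef_pV2 // lerDl divr_ge0 // ltW.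
have V2 : (k + 2 / r)^-1 <= r / 2.
  by rewrite -(invrK (r / 2)) lef_pV2 ?posrE ?invr_gt0 // invf_div lerDr ltW.
exists (k + 2 / r) => // del /(C2_ball_sub V1) dk t tk v vk.
have [a _ _] := kP del dk t (le_trans tk V1).
rewrite distrC -[X in `|X - _|]E0; apply: rP.
rewrite -ball_normE /= distrC opp_row_mx add_row_mx oppr0 addr0.
apply: (@le_lt_trans _ _ (r / 2)); last by rewrite ltr_pdivrMr // ltr_pMr // ltr1n.
by apply: row_mx_norm_le; [exact: a|exact: le_trans vk V2].
Qed.

Lemma far_uniform g D E gam (d : R) : exp_chart g D E -> 0 < d ->
  exists2 k, 0 < k & forall t u, 0 <= t <= 1 -> d <= u <= 1 - d -> far_ok E gam k (t, u).
Proof.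
move=> ch d0.
have cK : compact (`[0, 1]%classic `*` `[d, 1 - d]%classic : set (R * R)).
  by apply: compact_setX; exact: segment_compact.
have [k k' x||k k0 kP] := @compact_uniform R _ _ (far_ok E gam) cK.
- exact: far_ok_le.
- move=> [t0 u0] [/= _]; rewrite in_itv /= => /andP[du ud].
  have u01 : 0 < u0 < 1 by apply/andP; split; lra.
  have pq : curve gam t0 != curve gam (t0 + u0).
    apply/eqP => /curve_inj[j /eqP]; rewrite (inj_eq (addrI t0)) => /eqP uj.
    by move: u01; rewrite uj ltr0z ltrz1; case: j {uj} => [[|j]|j].
  set eta := `|curve gam t0 - curve gam (t0 + u0)|.
  have eta0 : 0 < eta by rewrite normr_gt0 subr_eq0.
  have eta4 : 0 < eta / 4 by rewrite divr_gt0.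
  have [k1 k10 k1P] := exp_chart_near gam t0 ch eta4.
  have [k2 k20 k2P] := exp_chart_near gam (t0 + u0) ch eta4.
  (* Both tips lie within eta / 4 of their base points on [gam], hence eta / 2 apart, and [2 / eta]
     brings 1/k below that. The parameter balls are halved because [t + u] collects two
     displacements. *)
  pose k := 2 * (k1 + k2) + 2 / eta.
  have p2 : 0 < 2 / eta by rewrite divr_gt0.
  have kp : 0 < k by rewrite addr_gt0 // mulr_gt0 // addr_gt0.
  have hV : k^-1 <= (k1 + k2)^-1 / 2.
    rewrite -invfM lef_pV2 ?posrE ?mulr_gt0 // ?addr_gt0 // mulrC /k lerDl; exact: ltW.
  have le12 (a b : R) : 0 < a -> 0 < b -> (a + b)^-1 <= a^-1.
    by move=> a0 b0; rewrite lef_pV2 ?posrE ?addr_gt0 // lerDl ltW.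
  have V1 := le12 k1 k2 k10 k20; have V2 : (k1 + k2)^-1 <= k2^-1 by rewrite addrC le12.
  have Vh : 0 < (k1 + k2)^-1 by rewrite invr_gt0 addr_gt0.
  have keta : k^-1 <= eta / 2.
    by rewrite -(invrK (eta / 2)) lef_pV2 ?posrE ?invr_gt0 ?divr_gt0 // invf_div /k lerDr ltW // mulr_gt0 // addr_gt0.
  have kV1 : k^-1 <= k1^-1 by move: hV V1 Vh; clear; lra.
  have kV2 : k^-1 <= k2^-1 by move: hV V2 Vh; clear; lra.
  exists k; apply/nbhs_ballP; exists ((k1 + k2)^-1 / 2); first by rewrite /= divr_gt0.
  move=> [t u] [] /=; rewrite -!ball_normE /= distrC (distrC u0) => tt uu.
  have tk1 : `|t - t0| <= k1^-1 by move: tt V1 Vh; clear; lra.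
  have tk2 : `|t + u - (t0 + u0)| <= k2^-1.
    rewrite opprD addrACA; apply: le_trans (ler_normD _ _) _; move: tt uu V2; clear; lra.
  split=> // del dk v w vk wk /=.
  have h1 := k1P del (C2_ball_sub kV1 dk) t tk1 v (le_trans vk kV1).
  have h2 := k2P del (C2_ball_sub kV2 dk) (t + u) tk2 w (le_trans wk kV2).
  move: h1 h2; set A := E _; set B := E _ => h1 h2; apply: le_trans keta _.
  have : eta <= `|A - curve gam t0| + `|A - B| + `|B - curve gam (t0 + u0)|.
    have -> : eta = `|- (A - curve gam t0) + (A - B) + (B - curve gam (t0 + u0))|.
      congr `|_|; rewrite opprB; apply/rowP => i; rewrite !mxE; ring.
    apply: le_trans (ler_normD _ _) _; rewrite lerD2r; apply: le_trans (ler_normD _ _) _.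
    by rewrite normrN.
  by move: h1 h2; clear; lra.
- exists k => // t u tt uu; apply: kP; split; rewrite /= in_itv //=.
Qed.

(** The alternative says that [E] on normal vectors has a Lipschitz inverse, modulo periods, at all
    scales below 1/k. *)
Definition tubular g (D : set 'rV[R]_(n + n)) (E : 'rV[R]_(n + n) -> coords) del (k : R) :=
  (forall t, [/\ bilin (g (curve del t)) (derive1 (curve del) t) (derive1 (curve del) t) <= k,
        forall v, tangent (curve del t) v -> `|v| ^+ 2 <= k * bilin (g (curve del t)) v v &
        forall v : coords, `|v| <= k^-1 -> D (row_mx (curve del t) v)]) /\
  (forall t s (v w : coords), `|v| <= k^-1 -> `|w| <= k^-1 ->
    bilin (g (curve del t)) (derive1 (curve del) t) v = 0 ->
    bilin (g (curve del s)) (derive1 (curve del) s) w = 0 ->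
    (exists j : int, `|t - (s + j%:~R)| + `|v - w| <=
      k * `|E (row_mx (curve del t) v) - E (row_mx (curve del s) w)|) \/
    k^-1 <= `|E (row_mx (curve del t) v) - E (row_mx (curve del s) w)|).

(** By periodicity [t] moves into [0, 1] and [s] to [t' + u] with [u] in [0, 1]. If [u] is close to
    0, or to 1 after shifting by one period, the local estimate applies; otherwise the points are
    far apart. *)
Lemma tube_global g D E gam : riemannian g -> exp_chart g D E ->
  exists2 k, 0 < k & forall del, C2_ball gam k^-1 del -> tubular g D E del k.
Proof.
move=> gr ch; have [k1 k10 near_ok] := tube_uniform gam gr ch.
have d0 : 0 < k1^-1 by rewrite invr_gt0.
have [k2 k20 far] := far_uniform gam ch d0.
have kk1 : k1 <= k1 + k2 by rewrite lerDl ltW.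
have kk2 : k2 <= k1 + k2 by rewrite lerDr ltW.
exists (k1 + k2); first by rewrite addr_gt0.
set k := k1 + k2 in kk1 kk2 *; move=> del dk.
have frac (x : R) : exists j : int, 0 <= x + j%:~R <= 1.
  exists (- Num.floor x); rewrite rmorphN /=.
  have := floor_itv x; rewrite intrD1 => /andP[h1 h2].
  by rewrite subr_ge0 h1 /= lerBlDl ltW.
have kV1 : k^-1 <= k1^-1 by rewrite lef_pV2 // posrE (lt_le_trans k10).
have per t (j : int) := (curve_period_int del t j, curve_velocity_period del t j).
split=> [t|t s v w vk wk].
  have [j t01] := frac t; have [_ /(_ del dk)[ok _]] := tube_ok_le kk1 (near_ok _ t01).
  have := ok (t + j%:~R); rewrite subrr normr0 !per invr_ge0 => /(_ (ltW (lt_le_trans k10 kk1))).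
  exact.
have [i t01] := frac t; set t' := t + i%:~R in t01.
have [i2 u01] := frac (s - t'); set u := s - t' + i2%:~R in u01.
have tE : t = t' + (- i)%:~R by rewrite rmorphN addrK.
have Et : curve del t = curve del t' by rewrite /t' per.
have Dt : derive1 (curve del) t = derive1 (curve del) t' by rewrite /t' per.
have Es (s' : R) (j : int) : s' = s + j%:~R -> curve del s = curve del s' /\
    derive1 (curve del) s = derive1 (curve del) s' by move=> ->; rewrite !per.
have [_ /(_ del dk)[_ ok]] := tube_ok_le kk1 (near_ok _ t01).
have [_ ok1] := near_ok _ t01; have dk1 := C2_ball_sub kV1 dk.
have near_case (s' : R) (j : int) : s' = s + j%:~R -> `|s' - t'| <= k1^-1 ->
    bilin (g (curve del t)) (derive1 (curve del) t) v = 0 ->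
    bilin (g (curve del s)) (derive1 (curve del) s) w = 0 ->
    exists j : int, `|t - (s + j%:~R)| + `|v - w| <=
      k * `|E (row_mx (curve del t) v) - E (row_mx (curve del s) w)|.
  move=> s'E s't; have [Es1 Es2] := Es s' j s'E; rewrite Et Dt Es1 Es2 => tv sw.
  exists (j - i); have -> : t - (s + (j - i)%:~R) = t' - s'.
    by rewrite s'E /t' rmorphB /=; ring.
  have [_ H] := ok1 del dk1.
  apply: le_trans (H t' s' v w _ s't (le_trans vk kV1) (le_trans wk kV1) tv sw) _.
    by rewrite subrr normr0 ltW.
  exact: ler_wpM2r.
have [ud|ud] := leP u k1^-1.
  move=> tv sw; left; apply: (near_case (t' + u) i2) => //.
    by rewrite /u; ring.
  by rewrite addrC addKr ger0_norm //; case/andP: u01.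
have [du|du] := ltP (1 - k1^-1) u.
  move=> tv sw; left; apply: (near_case (t' + u - 1) (i2 - 1)) => //.
    by rewrite /u rmorphB /=; ring.
  have -> : t' + u - 1 - t' = - (1 - u) by ring.
  rewrite normrN ger0_norm; last by rewrite subr_ge0; case/andP: u01.
  by move: du; clear; lra.
move=> tv sw; right.
have d_u : k1^-1 <= u <= 1 - k1^-1 by rewrite (ltW ud).
have [_ H] := far_ok_le kk2 (far t' u t01 d_u).
have s'E : t' + u = s + i2%:~R by rewrite /u; ring.
have [-> _] := Es _ _ s'E; rewrite Et; exact: H.
Qed.

End TubeGlobal.

(** * From separated normal discs to embedded tubes *)

Section TubularEmbedding.
Variables (R : realType) (m : ambient).
Local Notation n := (ambient_dim m).
Local Notation coords := (coords R m).
Local Notation space := (@Defs.space R m).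
Local Notation V := (R^o * coords)%type.
Implicit Types (del : emb R m) (g : tensor R m).

Lemma is_derive_linear (V1 V2 : normedModType R) (L : {linear V1 -> V2}) (c : R -> V1) (t : R) dc :
  continuous L -> is_derive t (1 : R) c dc -> is_derive t (1 : R) (fun s => L (c s)) (L dc).
Proof.
move=> cL [dct <-].
suff H : h^-1 *: (((fun s => L (c s)) \o shift t) (h *: (1 : R)) - L (c t)) @[h --> 0^'] --> L ('D_1 c t).
  by split; [apply/cvg_ex; eexists; exact: H|exact: cvg_lim H].
have -> : (fun h : R => h^-1 *: (((fun s => L (c s)) \o shift t) (h *: (1 : R)) - L (c t))) =
    (fun h : R => L (h^-1 *: ((c \o shift t) (h *: (1 : R)) - c t))).
  by apply/funext => h /=; rewrite [RHS](linearZ_LR L) (linearB L).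
exact: (cvg_comp _ _ dct (cL _)).
Qed.

Lemma is_derive0_cvg (W : normedModType R) (c : R -> W) dc : is_derive (0 : R) (1 : R) c dc ->
  h^-1 *: (c h - c 0) @[h --> 0^'] --> dc.
Proof.
move=> [dct <-].
have -> : (fun h : R => h^-1 *: (c h - c 0)) =
    (fun h : R => h^-1 *: ((c \o shift 0) (h *: (1 : R)) - c 0)).
  by apply/funext => h /=; rewrite [h *: 1]mulr1 addr0.
exact: dct.
Qed.

Lemma fst_continuous : continuous (fst : V -> R^o).
Proof. by move=> x; exact: cvg_fst. Qed.

Lemma snd_continuous : continuous (snd : V -> coords).
Proof. by move=> x; exact: cvg_snd. Qed.

Lemma pair_intmul (j : int) : ((1, 0) : V) *~ j = (j%:~R, 0).
Proof.
have H (k : nat) : ((1, 0) : V) *+ k = (k%:R, 0).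
  elim: k => [//|k IH]; rewrite mulrS IH -[LHS]/((1 + k%:R, 0 + 0) : V) addr0.
  by congr pair; rewrite -mulrS.
case: j => k; first exact: H.
by rewrite NegzE mulrNz -pmulrn H mulrNz -pmulrn -[LHS]/((- k.+1%:R, - 0) : V) oppr0.
Qed.

Definition tube_param del (x : V) : 'rV[R]_(n + n) := row_mx (curve del x.1) x.2.

Lemma Ck_tube_param del k : Ck k setT (tube_param del).
Proof.
apply: Ck_row_mx; [exact: openT| |exact: (Ck_lin _ _ snd_continuous)].
have H := @Ck_affine R _ _ _ k setT (curve del) (fst : {linear V -> R^o}) 0 fst_continuous (curve_smooth del k).
have -> : (fun x : V => curve del x.1) = (fun x : V => curve del (x.1 + 0)).
  by apply/funext => x; rewrite addr0.
exact: Ck_sub H.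
Qed.

(** The condition on [r] puts discs of [g]-radius [r] inside norm radius 1/k. There the inverse
    Lipschitz bound gives injectivity, immersivity and openness. *)
Lemma tubular_embeds g D E del (k r : R) : exp_chart g D E -> 0 < k -> k * r ^+ 2 <= k^-1 ^+ 2 ->
  tubular g D E del k -> normal_exp_embeds g del r.
Proof.
move=> [oD sE _ expE] k0 kr [H1 H2].
have kV0 : 0 < k^-1 by rewrite invr_gt0.
set X := normal_disc_bundle g del r.
pose F x := E (tube_param del x).
have XV x : X x -> `|x.2| <= k^-1.
  move=> [Tx _ x2r]; have [_ /(_ _ Tx) Hx _] := H1 x.1.
  rewrite -(@ler_pXn2r _ 2) ?nnegrE ?(ltW kV0) //; apply: le_trans Hx _; apply: le_trans kr.
  by rewrite ler_pM2l // ltW.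
have XD x : X x -> D (tube_param del x) by move=> /XV; have [_ _] := H1 x.1; apply.
have XE x : X x -> exp_rel g (curve del x.1) x.2 (F x) /\ normal_exp g del x = F x.
  by move=> Xx; have [Tx _ _] := Xx; exact: (expE _ _ (curve_space del x.1) Tx (XD x Xx)).
have far_near x y : X x -> X y ->
    (exists j : int, `|x.1 - (y.1 + j%:~R)| + `|x.2 - y.2| <= k * `|F x - F y|) \/ k^-1 <= `|F x - F y|.
  by move=> Xx Xy; apply: H2; [exact: XV|exact: XV|case: Xx|case: Xy].
have oU : open [set x | D (tube_param del x)].
  by apply: open_comp oD => x _; have [+ _] := Ck_tube_param del 0; exact.
have sF l : Ck l [set x | D (tube_param del x)] F.
  exact: (Ck_comp_mx oU oD (fun _ H => H) (Ck_sub (@subsetT _ _) (Ck_tube_param del l)) (sE l)).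
split; first by move=> x /XE[ex _]; eexists; exact: ex.
split.
- split=> [x Xx|x Xx].
    exists [set x | D (tube_param del x)], F; split=> //; first exact: XD.
    by move=> y; rewrite inE => -[_ /XE[]].
  by rewrite /normal_exp /= curve_period addr0.
- move=> x y Xx Xy; have [[_ ->] [_ ->]] := (XE x Xx, XE y Xy) => Fxy.
  have [[j]|] := far_near x y Xx Xy; rewrite Fxy subrr normr0.
    rewrite mulr0 => xy; exists (- j); rewrite pair_intmul.
    have /eqP : `|x.1 - (y.1 + j%:~R)| + `|x.2 - y.2| == 0.
      by rewrite eq_le xy addr_ge0.
    move=> /eqP; rewrite paddr_eq0 // !normr_eq0 !subr_eq0 => /andP[/eqP x1 /eqP x2].
    rewrite [LHS]surjective_pairing [X in _ = X + _]surjective_pairing x1 x2.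
    by congr pair; rewrite /= ?rmorphN ?addrK ?addr0.
  by rewrite leNgt kV0.
(* Near 0 one has |c h - c 0| <= k |G h - G 0|; dividing by [h], a vanishing derivative of [G]
   forces that of [c] to vanish. *)
- move=> c sc Xc; apply: contra_neq => d0.
  have dc : is_derive (0 : R) (1 : R) c (derive1 c 0).
    by rewrite derive1E; apply: derivableP; have [_ /(_ 1)[+ _]] := sc 1%N; exact.
  have dc1 := is_derive_linear (L := (fst : {linear V -> R^o})) fst_continuous dc.
  have dc2 := is_derive_linear (L := (snd : {linear V -> coords})) snd_continuous dc.
  have dg : derivable (fun t : R => curve del (c t).1) 0 1.
    apply/derivable1_diffP; apply: (@differentiable_comp _ _ _ _ (fun t : R => (c t).1) (curve del)).
      by apply/derivable1_diffP; have [] := dc1.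
    by apply/derivable1_diffP; have [] := curve_is_derive del (c 0).1.
  have dz := is_derive_row_mx (derivableP dg) dc2.
  pose G t := F (c t).
  have dG : derivable G 0 1.
    apply/derivable_mxP => i j.
    have [] := @chain_rule R R^o _ (fun t : R => tube_param del (c t)) 0 1 D (fun z => E z i j) oD
       (XD _ (Xc 0)) ((Ck_mx 1 E oD).1 (sE 1%N) i j) (ex_derive (is_derive := dz)).
    by [].
  have fG : normal_exp g del \o c = G by apply/funext => t; have [_] := XE _ (Xc t).
  rewrite fG derive1E in d0.
  have cG : G h @[h --> 0] --> G 0.
    exact: (is_derive_continuous (derivableP dG)).
  have cc : c h @[h --> 0] --> c 0 by exact: (is_derive_continuous dc).
  have near_le : \forall h \near (0 : R)^', `|c h - c 0| <= k * `|G h - G 0|.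
    have e0 : 0 < Num.min k^-1 (k^-1 / 2) by rewrite lt_min kV0 divr_gt0.
    have half0 : 0 < 2^-1 :> R by rewrite invr_gt0.
    have h1 : \forall h \near (0 : R)^', `|G h - G 0| < Num.min k^-1 (k^-1 / 2).
      by apply: nbhs_dnbhs; have /cvgrPdist_lt/(_ _ e0) := cG; apply: filterS => h; rewrite distrC.
    have h2 : \forall h \near (0 : R)^', `|c h - c 0| < 2^-1.
      by apply: nbhs_dnbhs; have /cvgrPdist_lt/(_ _ half0) := cc; apply: filterS => h; rewrite distrC.
    apply: filterS2 h1 h2 => h; rewrite lt_min => /andP[Gk Gk2] ch.
    have [[j jle]|] := far_near (c h) (c 0) (Xc h) (Xc 0); last by rewrite leNgt Gk.
    have c1 : `|(c h).1 - (c 0).1| < 2^-1.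
      by apply: le_lt_trans ch; rewrite prod_normE le_max lexx.
    (* The parameter increment and its shift by [j] are both smaller than 1/2, so |j| < 1. *)
    have j0 : j = 0.
      have : `|(c h).1 - ((c 0).1 + j%:~R)| < 2^-1.
        apply: (@le_lt_trans _ _ (k * `|G h - G 0|)).
          by apply: le_trans jle; rewrite lerDl.
        by rewrite -ltr_pdivlMl // mulrC in Gk2 *; rewrite -(invrK k) ltr_pdivrMl // mulrC.
      move: c1; rewrite !ltr_norml => /andP[a1 a2] /andP[b1 b2].
      have : `|j%:~R : R| < 1 by rewrite ltr_norml; apply/andP; split; move: a1 a2 b1 b2; clear; lra.
      by rewrite -intr_norm ltrz1; case: (j) => [[|?]|?].
    move: jle; rewrite j0 addr0 => /(le_trans _); apply.
    by rewrite prod_normE ge_max lerDl lerDr !normr_ge0.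
  have lim_c : h^-1 *: (c h - c 0) @[h --> 0^'] --> derive1 c 0.
    exact: is_derive0_cvg dc.
  have lim_G : h^-1 *: (G h - G 0) @[h --> 0^'] --> (0 : coords).
    by have := is_derive0_cvg (derivableP dG); rewrite d0.
  apply/eqP; rewrite -normr_le0 leNgt; apply/negP => c'0.
  have c'2 : 0 < `|derive1 c 0| / 2 by rewrite divr_gt0.
  have ck : 0 < `|derive1 c 0| / 2 / k by rewrite divr_gt0.
  have a1 : \forall h \near (0 : R)^', `|derive1 c 0 - h^-1 *: (c h - c 0)| < `|derive1 c 0| / 2.
    by have /cvgrPdist_lt/(_ _ c'2) := lim_c.
  have a2 : \forall h \near (0 : R)^', `|h^-1 *: (G h - G 0)| < `|derive1 c 0| / 2 / k.
    by have /cvgrPdist_lt/(_ _ ck) := lim_G; apply: filterS => h; rewrite sub0r normrN.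
  have H3 : \forall h \near (0 : R)^', [/\ `|c h - c 0| <= k * `|G h - G 0|,
      `|derive1 c 0 - h^-1 *: (c h - c 0)| < `|derive1 c 0| / 2 &
      `|h^-1 *: (G h - G 0)| < `|derive1 c 0| / 2 / k].
    by apply: filterS3 near_le a1 a2 => h.
  have [h [b1 b2 b3]] := @filter_ex _ _ (Proper_dnbhs_numFieldType (0 : R)) _ H3.
  have : `|h^-1 *: (c h - c 0)| <= k * `|h^-1 *: (G h - G 0)|.
    by rewrite !normrZ mulrCA ler_wpM2l.
  have : k * `|h^-1 *: (G h - G 0)| < `|derive1 c 0| / 2.
    by rewrite mulrC -ltr_pdivlMr.
  have := ler_normD (derive1 c 0 - h^-1 *: (c h - c 0)) (h^-1 *: (c h - c 0)).
  rewrite subrK; move: b2; clear; lra.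
- move=> U oUU invU.
  have invj (x : V) (j : int) : U (x + (j%:~R, 0)) = U x.
    have := @periodic_int R Prop (fun t => U (x + (t, 0))) _ 0 j.
    rewrite add0r => ->; last first.
      move=> t; apply/propext; have := invU (x + (t, 0)).
      by rewrite -addrA -[(t, 0) + _]/((t + 1, 0 + 0) : V) addr0 => -[].
    by congr U; rewrite [RHS]surjective_pairing; congr pair; rewrite /= addr0.
  (* A union of balls around the points [F x]. The radius is such that a value [F y] in the ball
     forces [y], up to a period, within [d] of [x], hence into [U]. *)
  exists [set q | exists x d, [/\ X x, U x, 0 < d, forall y, `|y - x| < d -> U y &
      `|q - F x| < Num.min k^-1 (d / k)]].
    rewrite openE => q [x [d [Xx Ux d0 inU qx]]].
    apply/nbhs_ballP; exists (Num.min k^-1 (d / k) - `|q - F x|); first by rewrite /= subr_gt0.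
    move=> q'; rewrite -ball_normE /= => qq; exists x, d; split=> //.
    rewrite -(subrKA q); apply: le_lt_trans (ler_normD _ _) _.
    by rewrite distrC -ltrBrDr.
  apply/seteqP; split=> q.
    move=> [x [Xx Ux] <-]; split; first by exists x.
    have /nbhs_ballP[d /= d0 dU] := open_nbhs_nbhs (conj oUU Ux).
    exists x, d; split=> //.
      by move=> y yx; apply: dU; rewrite -ball_normE /= distrC.
    by have [_ ->] := XE x Xx; rewrite subrr normr0 lt_min kV0 divr_gt0.
  move=> [[y Xy <-] [x [d [Xx Ux d0 inU]]]]; have [_ ->] := XE y Xy.
  rewrite lt_min => /andP[yk yd]; exists y => //; last by have [_ ->] := XE y Xy.
  split=> //; have [[j jle]|] := far_near y x Xy Xx; last by rewrite leNgt yk.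
  rewrite -(invj y (- j)); apply: inU.
  apply: (@le_lt_trans _ _ (k * `|F y - F x|)); last by rewrite mulrC -ltr_pdivlMr.
  apply: le_trans jle; rewrite prod_normE ge_max /=.
  have -> : y.1 + (- j)%:~R - x.1 = y.1 - (x.1 + j%:~R) by rewrite rmorphN /=; ring.
  by rewrite addr0 lerDl lerDr !normr_ge0.
Qed.

End TubularEmbedding.

Section RopelengthBound.
Variables (R : realType) (m : ambient).
Local Notation n := (ambient_dim m).
Local Notation coords := (coords R m).
Implicit Types (gam del : emb R m) (g : tensor R m).

Lemma speed_continuous g del : riemannian g -> continuous (fun t : R =>
  Num.sqrt (bilin (g (curve del t)) (derive1 (curve del) t) (derive1 (curve del) t)) : R^o).
Proof.
move=> [[U [oU SU sg _]] _] t; apply: continuous_comp; last exact: sqrt_continuous.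
have Cg : Ck 0 setT (fun t : R^o => g (curve del t)).
  by apply: (Ck_comp_mx openT oU _ (curve_smooth del 0) (sg 0%N)) => s _; apply/SU/curve_space.
have Cd := derive1_smooth del 0%N.
have [+ _] : Ck 0 setT (fun t : R^o => bilin (g (curve del t)) (derive1 (curve del) t) (derive1 (curve del) t) : R^o).
  apply: (Ck_mx 0 _ openT).1; apply: Ck_mulmx; [exact: openT| |].
    by apply: Ck_mulmx; [exact: openT|exact: Cd|exact: Cg].
  by apply: Ck_trmx; [exact: openT|exact: Cd].
by apply.
Qed.

Lemma curve_length_le g del (k : R) : riemannian g -> 0 <= k ->
  (forall t, bilin (g (curve del t)) (derive1 (curve del) t) (derive1 (curve del) t) <= k) ->
  0 <= curve_length g del <= Num.sqrt k.
Proof.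
move=> gr k0 speed; apply/andP; split.
  by apply: Rintegral_ge0 => t _; exact: sqrtr_ge0.
have itv1 : fine (lebesgue_measure (`[0, 1]%classic : set R)) = 1.
  by rewrite lebesgue_measure_itv /= lte_fin ltr01 oppr0 adde0.
rewrite -[leRHS]mulr1 -itv1 -Rintegral_cst; last exact: measurable_itv.
apply: le_Rintegral; first exact: measurable_itv.
- apply: continuous_compact_integrable; first exact: segment_compact.
  by apply: continuous_subspaceT => t; exact: speed_continuous.
- apply: continuous_compact_integrable; first exact: segment_compact.
  by apply: continuous_subspaceT => t; exact: cst_continuous.
- by move=> t _; rewrite ler_wsqrtr.
Qed.

Lemma ropelength_le g del (l r : R) : 0 <= curve_length g del <= l -> 0 < r ->
  (r%:E <= thickness g del)%E -> (ropelength g del <= (l / r)%:E)%E.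
Proof.
rewrite /ropelength => /andP[len0 lenl] r0; case: (thickness g del) => [s| |//].
  rewrite lee_fin => rs; have s0 : 0 < s := lt_le_trans r0 rs.
  rewrite inver gt_eqF // -EFinM lee_fin ler_pM //; first by rewrite invr_ge0 ltW.
  by rewrite lef_pV2.
(* Infinite thickness gives ropelength 0. *)
by move=> _; rewrite invey mule0 lee_fin divr_ge0 ?(ltW r0) // (le_trans len0).
Qed.

Lemma ropelength_locally_bounded g gam : riemannian g ->
  exists L : R, nbhs gam [set del | (ropelength g del <= L%:E)%E].
Proof.
move=> gr; have [D [E ch]] := exp_local gr.
have [k k0 tub] := tube_global gam gr ch.
(* A radius meeting the hypothesis of [tubular_embeds], since k <= (k + 1)^2. *)
pose r := k^-1 / (k + 1).
have k10 : 0 < k + 1 by rewrite addr_gt0.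
have r0 : 0 < r by rewrite divr_gt0 ?invr_gt0.
have kr : k * r ^+ 2 <= k^-1 ^+ 2.
  have -> : k * r ^+ 2 = k^-1 ^+ 2 * (k / (k + 1) ^+ 2) by rewrite /r; field; rewrite !gt_eqF.
  rewrite ler_piMr ?sqr_ge0 // ler_pdivrMr ?exprn_gt0 // mul1r expr2.
  by have := mulr_gt0 k0 k0; move: k0; clear; nra.
exists (Num.sqrt k / r).
have kV : 0 < k^-1 by rewrite invr_gt0.
apply: (@filterS _ _ (nbhs_filter gam) _ _ _ (C2_ball_nbhs gam kV)) => del /tub tb.
apply: (ropelength_le _ r0).
  apply: (curve_length_le gr (ltW k0)) => t; by case: (tb.1 t).
apply: ereal_sup_ubound; exists r; last by [].
split; first exact: (ltW r0).
exact: (tubular_embeds ch k0 kr tb).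
Qed.

End RopelengthBound.

(** * Chains in an increasing family of subspaces *)

Section FreeModuleMaps.
Variable A : pzRingType.

Lemma fcoef_bigsum (I : Type) (T : choiceType) (s : seq I) (b : I -> A)
    (h : I -> freemod A T) u :
  (\sum_(i <- s) b i *: h i) u = \sum_(i <- s) b i * (h i u : A).
Proof. by elim: s => [|i s IHs]; rewrite ?big_nil // !big_cons -IHs. Qed.

(** An injective relabelling merges no generators, so coefficients can be read off after it. *)
Lemma linext_fgen_inj (T T' : choiceType) (h : T -> T') (c : freemod A T) t :
  injective h -> linext (fun u => fgen (h u)) c (h t) = c t.
Proof.
move=> h_inj; have cD u : u \notin fset_set [set u | c u != 0] -> c u = 0.
  exact: notin_supp.
rewrite (linextE _ cD) fcoef_bigsum /=.
have [tD|tD] := boolP (t \in fset_set [set u | c u != 0]); last first.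
  rewrite cD // big_seq big1 // => u uD.
  by rewrite (inj_eq h_inj); case: eqVneq uD tD => [->|]; [move=> ->|rewrite mulr0].
rewrite (big_fsetD1 t) //= eqxx mulr1 big_seq big1 ?addr0 // => u.
by rewrite in_fsetD1 (inj_eq h_inj) eq_sym => /andP[/negbTE -> _]; rewrite mulr0.
Qed.

Lemma modspan_universal (V W : lmodType A) (G : set V) (h : {linear V -> W}) :
  (forall v, G v -> h v = 0) ->
  exists phi : {linear modspan G -> W}, forall v, phi (mod_pi G v) = h v.
Proof.
move=> hG; pose phi (q : modspan G) := h (mod_repr q).
have phiE v : phi (mod_pi G v) = h v.
  apply/eqP; rewrite -subr_eq0 -linearB; apply/eqP.
  have /mod_piP /asboolP /(_ [set u | h u = 0]) := mod_reprK (mod_pi G v).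
  apply=> [|a u w /= hu hw|]; [exact: linear0| |exact: hG].
  by rewrite linearP hu hw scaler0 addr0.
have phi_lin : linear phi.
  move=> a p q; rewrite -[p]mod_reprK -[q]mod_reprK -linearP !phiE.
  exact: linearP.
by exists (HB.pack_for {linear modspan G -> W} phi
  (GRing.isLinear.Build A (modspan G) W *:%R phi phi_lin)).
Qed.

End FreeModuleMaps.

Section SubspaceChains.
Variables (R : realType) (A : pzRingType) (X : topologicalType).
Implicit Types B C D : set X.

Lemma sing_lift B C (BC : B `<=` C) n (s : sing R C n) :
  (forall x, B (set_val (s x))) ->
  exists t : sing R B n, (subset_incl BC \o t : sing R C n) = s.
Proof.
move=> Bs; pose t x : B := SigSub (mem_set (Bs x)).
have t_cont : continuous t.
  apply: (@continuous_comp_initial _ _ _ set_val) => x.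
  apply: (@continuous_comp _ _ _ s set_val); first exact: cts_fun.
  exact: initial_continuous.
exists (HB.pack_for (sing R B n) t (isContinuous.Build _ _ t t_cont)).
by apply/continuousEP => x; apply: val_inj.
Qed.

(** It allows identities between chains of a subspace to be checked in the larger space. *)
Lemma push_incl_inj B C (BC : B `<=` C) n :
  injective (@push R A _ _ (subset_incl BC) n).
Proof.
move=> c d cd; apply: val_inj; apply/funext => s.
pose h (s : sing R B n) : sing R C n := subset_incl BC \o s.
have h_inj : injective h.
  move=> u v huv; apply/continuousEP => x.
  have /(congr1 (fun w : sing R C n => set_val (w x))) /= := huv.
  by move=> uv; apply: val_inj; exact: uv.
by rewrite /= -(linext_fgen_inj c s h_inj) -(linext_fgen_inj d s h_inj); congr (fcoef _ _).
Qed.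

Lemma push_incl_lift B C (BC : B `<=` C) n (c : chain R A C n) :
  (forall s, c s != 0 -> forall x, B (set_val (s x))) ->
  exists d, push (subset_incl BC) d = c.
Proof.
move=> Bc.
(* Simplices outside the support of [c] get the dummy lift 0. *)
have /choice[h hE] (s : sing R C n) : exists d : chain R A B n,
    c s != 0 -> push (subset_incl BC) d = fgen s.
  have [c0|/Bc/sing_lift-/(_ BC)[t ts]] := eqVneq (c s) 0; first by exists 0.
  by exists (fgen t) => _; rewrite /push linext_gen; congr fgen.
exists (linext h c).
have cD s : s \notin fset_set [set s | c s != 0] -> c s = 0 by exact: notin_supp.
rewrite (linextE _ cD) linear_sum.
rewrite [RHS](linext_eq idfun c) (linextE _ cD).
rewrite [LHS]big_seq [RHS]big_seq; apply: eq_bigr => s.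
rewrite in_fset_set; last exact: finite_fcoef.
by rewrite inE /= => cs; rewrite linearZ /= hE.
Qed.

Lemma push_incl_comp B C D (BC : B `<=` C) (CD : C `<=` D) (BD : B `<=` D) n
    (c : chain R A B n) :
  push (subset_incl CD) (push (subset_incl BC) c) = push (subset_incl BD) c.
Proof.
apply: (@eq_lin_freemod _ _ _ (@push R A _ _ (subset_incl CD) n \o
  @push R A _ _ (subset_incl BC) n) (@push R A _ _ (subset_incl BD) n)) => s.
rewrite /= /push !linext_gen; congr fgen.
by apply/continuousEP => x; apply: val_inj.
Qed.

Lemma hmap_incl_comp B C D (BC : B `<=` C) (CD : C `<=` D) (BD : B `<=` D) n
    (q : homology R A n B) :
  hmap (subset_incl CD) (hmap (subset_incl BC) q) = hmap (subset_incl BD) q.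
Proof.
rewrite -[q]mod_reprK; move: (mod_repr q) => {q} z.
rewrite (hmapE (subset_incl BC) z) (hmapE (subset_incl CD)) (hmapE _ z).
congr mod_pi; apply: val_inj; exact: (push_incl_comp BC CD BD).
Qed.

End SubspaceChains.

Lemma homology_eq0 (R : realType) (A : pzRingType) (X : topologicalType) n
    (z : Defs.kernel (@bnd R A X n)) :
  mod_pi _ z = 0 :> homology R A n X <-> exists c, kernel_val z = @bnd R A X n.+1 c.
Proof.
split=> [z0|zc]; last first.
  by rewrite -[RHS](linear0 (@mod_pi _ _ _)); apply/mod_piP/asboolP => S _ _; apply; rewrite subr0.
have /mod_piP/asboolP : mod_pi _ z = mod_pi _ 0 :> homology R A n X by rewrite linear0.
rewrite subr0 => /(_ [set v | exists c, kernel_val v = @bnd R A X n.+1 c]) [] //.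
- by exists 0; rewrite linear0.
- move=> a u w [c uc] [d wd]; exists (a *: c + d).
  apply: (etrans (y := a *: kernel_val u + kernel_val w)); first by [].
  by rewrite uc wd; exact: esym (linearP (@bnd R A X n.+1) a c d).
- by move=> c; exists c.
Qed.

Section ColimitElements.
Variables (A : pzRingType) (d : Order.disp_t) (I : orderType d).
Variables (M : I -> lmodType A) (f : forall i k, (i <= k)%O -> M i -> M k).

(** The index order is total, so a finite combination of generators can be moved to one index; [i0]
    serves the empty combination. *)
Lemma colim_in_surj (i0 : I) (q : colim f) : exists i (x : M i), q = colim_in f x.
Proof.
rewrite -[q]mod_reprK (linext_eq (@mod_pi _ _ _)).
rewrite (linextE _ (@notin_supp _ _ (mod_repr q))).
elim: (enum_fset _) => [|[i x] S [k [y yE]]].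
  by exists i0, 0; rewrite big_nil linear0.
exists (Order.max i k).
have ik : (i <= Order.max i k)%O by rewrite le_max lexx.
have ki : (k <= Order.max i k)%O by rewrite le_max lexx orbT.
exists ((mod_repr q (Tagged (fun i => M i : Type) x) : A) *: f ik x + f ki y).
by rewrite big_cons yE colim_in_is_linear !colim_inE.
Qed.

Lemma colim_universal (W : lmodType A) (to : forall i, {linear M i -> W}) :
  (forall i k (ik : (i <= k)%O) x, to k (f ik x) = to i x) ->
  exists phi : {linear colim f -> W}, forall i (x : M i), phi (colim_in f x) = to i x.
Proof.
move=> to_f; pose h : {linear freemod A {i : I & M i} -> W} :=
  linext (fun p : {i & M i} => to (tag p) (tagged p)).
have h_gen i (x : M i) : h (colim_gen x) = to i x by exact: linext_gen.
have [|phi phiE] := @modspan_universal A _ _ (colim_rel f) h.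
  move=> _ [[i [a [x [y ->]]]]|[i [k [ik [x ->]]]]]; last first.
    by rewrite (linearB h) !h_gen to_f subrr.
  by rewrite (linearB h) (linearP h) !h_gen linearP subrr.
by exists phi => i x; rewrite phiE h_gen.
Qed.

End ColimitElements.

Section ColimitOfSubspaces.
Variables (R : realType) (A : pzRingType) (X : topologicalType) (K : set X).
Variables (d : Order.disp_t) (I : orderType d) (F : I -> set X) (i0 : I).
Hypothesis F_le : forall i k : I, (i <= k)%O -> F i `<=` F k.
Hypothesis F_sub : forall i, F i `<=` K.
Hypothesis F_exhausts : forall n (s : sing R K n),
  exists i, forall x, F i (set_val (s x)).

(** The lower bound [i1] lets the index of a bounding chain be chosen beyond that of a given
    cycle. *)
Lemma chain_bounded n (c : chain R A K n) i1 :
  exists2 i, (i1 <= i)%O & forall s, c s != 0 -> forall x, F i (set_val (s x)).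
Proof.
have bounded (S : seq (sing R K n)) :
    exists2 i, (i1 <= i)%O & forall s, s \in S -> forall x, F i (set_val (s x)).
  elim: S => [|s S [i i1i Fi]]; first by exists i1.
  have [k Fk] := F_exhausts s.
  exists (Order.max i k); first by rewrite le_max i1i.
  move=> t; rewrite inE => /predU1P[->|tS] x.
    by apply: (F_le _ (Fk x)); rewrite le_max lexx orbT.
  by apply: (F_le _ (Fi t tS x)); rewrite le_max lexx.
have [i i1i Fi] := bounded (fset_set [set s | c s != 0]).
exists i => // s cs; apply: Fi; rewrite in_fset_set; last exact: finite_fcoef.
by rewrite inE.
Qed.

Variable n : nat.
Let M i : lmodType A := homology R A n (F i).
Let f i k (ik : (i <= k)%O) : M i -> M k := @hmap R A _ _ (subset_incl (F_le ik)) n.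
Let to i : M i -> homology R A n K := @hmap R A _ _ (subset_incl (@F_sub i)) n.

Theorem colim_homology : exists phi : {linear colim f -> homology R A n K},
  bijective phi /\ forall i (x : M i), phi (colim_in f x) = to x.
Proof.
have to_f i k (ik : (i <= k)%O) x : to (f ik x) = to x by exact: hmap_incl_comp.
have [phi phi_in] := colim_universal 
  (to := fun i => @hmap R A _ _ (subset_incl (@F_sub i)) n) to_f.
exists phi; split=> //.
have phi_inj : injective phi.
  apply: raddf_inj => q; have [i [x ->]] := colim_in_surj i0 q.
  move=> /(etrans (esym (phi_in i x))); rewrite -[x]mod_reprK; move: (mod_repr x) => {x} z.
  move=> /(etrans (esym (hmapE (subset_incl (@F_sub i)) z))) /homology_eq0[/= c zc].
  (* The chain [c] bounds the cycle in [K] and lies in a later [F k], so the class of [z] already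
     dies there. *)
  have [k ik Fk] := chain_bounded c i.
  have [b bc] := push_incl_lift (@F_sub k) Fk.
  rewrite -(colim_inE _ ik) (_ : f ik _ = 0) ?linear0 //.
  apply: (etrans (hmapE (subset_incl (F_le ik)) z)).
  apply/homology_eq0; exists b => /=; apply: (push_incl_inj (BC := @F_sub k)).
  apply: (etrans (push_incl_comp _ _ (@F_sub i) _)); rewrite zc -bc.
  exact: (push_bnd (subset_incl (@F_sub k)) b).
have phi_surj q : exists p, phi p = q.
  rewrite -[q]mod_reprK; move: (mod_repr q) => {q} z.
  have [i _ Fi] := chain_bounded (kernel_val z) i0.
  have [c cz] := push_incl_lift (@F_sub i) Fi.
  (* The boundary of the lift maps to that of [z], which is 0, under an injective map. *)
  have c_cycle : c \in ker_pred (@bnd R A (F i) n).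
    apply/eqP; apply: (push_incl_inj (BC := @F_sub i)).
    apply: (etrans (esym (push_bnd _ c))); rewrite cz linear0.
    exact: (kernel_valK z).
  exists (colim_in f (mod_pi _ (Defs.Kernel c_cycle) : M i)).
  rewrite phi_in; apply: (etrans (hmapE (subset_incl (@F_sub i)) _)).
  by congr mod_pi; apply: val_inj.
have [psi psiK] := choice phi_surj.
by exists psi => // p; apply: phi_inj.
Qed.

End ColimitOfSubspaces.

(** * Locally bounded quantities on singular simplices *)

Lemma compact_simplex (R : realType) n : compact (simplex R n).
Proof.
have coord_cont (i : 'I_n.+1) : continuous (fun x : 'rV[R]_n.+1 => x 0 i).
  exact: coord_continuous.
apply: bounded_closed_compact.
  exists 1; split; first exact: num_real.
  move=> M M1 x [x0 x1]; apply: mx_norm_le => [|i j].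
    by apply: le_trans (ltW M1).
  rewrite ord1 ger0_norm //; apply: le_trans (ltW M1).
  by rewrite -x1 (bigD1 j) //= lerDl sumr_ge0.
apply: (@closedI _ [set x : 'rV[R]_n.+1 | forall i, 0 <= x 0 i] [set x | \sum_i x 0 i = 1]).
  rewrite (_ : [set _ | _] = \bigcap_i [set x : 'rV[R]_n.+1 | 0 <= x 0 i]); last first.
    by apply/seteqP; split=> x h i; [move=> _; exact: h|exact: (h i I)].
  apply: closed_bigI => i _.
  by apply: (closed_comp (D := [set y : R | 0 <= y])) => [x _|]; [exact: coord_cont|exact: closed_ge].
apply: (closed_comp (D := [set y : R | y = 1]) (f := fun x : 'rV[R]_n.+1 => \sum_i x 0 i)).
  by move=> x _; apply: continuous_big => [|i _]; [exact: add_continuous|exact: coord_cont].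
exact: closed_eq.
Qed.

(** Singular simplices are maps on the subtype of [simplex], so compactness of the subset has to
    pass to the subtype; its open sets are traces. *)
Lemma compact_set_type (X : topologicalType) (B : set X) :
  compact B -> compact [set: B].
Proof.
move=> /compact_near_coveringP cB; apply/compact_near_coveringP => I F P FF P_near.
have := cB I F (fun i x => forall Bx : x \in B, P i (SigSub Bx)) FF.
have near_x x : B x -> \forall x' \near x & i \near F, forall Bx : x' \in B, P i (SigSub Bx).
  move=> Bx; have [[U V] /= [+ FV] UV] := P_near (SigSub (mem_set Bx)) Logic.I.
  rewrite nbhsE => -[W [[D oD DW] Wx] WU].
  exists (D, V); first split=> //=.
    by apply: open_nbhs_nbhs; split=> //; rewrite -DW in Wx.
  move=> [y i] /= [Dy Vi] By; apply: (UV (SigSub By, i)); split=> //=.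
  by apply: WU; rewrite -DW.
move=> /(_ near_x); apply: filterS => i Pi x _.
by have := Pi (set_val x) (set_valP x); case: x => x xB /(_ xB).
Qed.

(** [P k x] stands for a quantity at [x] being at most [k]: local boundedness is pulled back along
    [s] to the compact simplex. *)
Lemma sing_bounded (R : realType) (X : topologicalType) (K : set X)
    (P : R -> X -> Prop) n (s : sing R K n) :
  (forall k l x, k <= l -> P k x -> P l x) ->
  (forall x : X, exists k, nbhs x (P k)) ->
  exists k, forall x, P k (set_val (s x)).
Proof.
move=> P_le P_loc.
have [||x _|k _ sk] := @compact_uniform R (simplex R n) setT
    (fun k x => P k (set_val (s x))).
- exact/compact_set_type/compact_simplex.
- by move=> k l x; exact: P_le.
- have [k Pk] := P_loc (set_val (s x)); exists k.
  have sx : {for x, continuous (set_val \o s)}.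
    apply: continuous_comp; first exact: cts_fun.
    exact: initial_continuous.
  exact: (sx _ Pk).
by exists k => x; exact: sk.
Qed.

Lemma sing_sublevel (R : realType) (m : ambient) (g : tensor R m)
    (K : set (emb R m)) n (s : sing R K n) :
  riemannian g -> exists L, forall x, sublevel g K L (set_val (s x)).
Proof.
move=> g_riem; have [||L sL] := @sing_bounded R (emb R m) K
    (fun L del => (ropelength g del <= L%:E)%E) n s.
- by move=> k l del kl h; apply: le_trans h _; rewrite lee_fin.
- by move=> gam; exact: ropelength_locally_bounded.
by exists L => x; split; [exact: set_valP|exact: sL].
Qed.

Theorem corollary4p9 (R : realType) (m : ambient) (g : tensor R m)
    (g_riem : riemannian g) (K : set (emb R m)) (K_type : knot_type K)
    (A : pzRingType) (j : nat) :
  exists phi : {linear sublevel_colim g K A j -> homology R A j K},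
    bijective phi /\
    forall (L : R) (x : sublevel_homology g K A j L),
      phi (colim_in (@sublevel_map R m g K A j) x) = sublevel_to x.
Proof.
(* [0] witnesses that the index set R is inhabited. *)
exact: (colim_homology A 0 (@sublevel_le R m g K) (@sublevel_sub R m g K)
  (fun n s => sing_sublevel s g_riem) j).
Qed.
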